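(* Let $\mathfrak{m}_0\in\mathcal{P}(\mathcal{X})$ and, for $N\ge 2$, let $\mathfrak{m}^N\in\mathcal{P}(\mathcal{X}^N)$, $\gamma^N\in\mathcal{P}(\mathcal{R}^N)$ and $\epsilon_N\in[0,\infty)$. Assume: (A1) There exists a measurable function $\boldsymbol{w}:[0,\infty)\to[0,1]$ with $\boldsymbol{w}(s)\to 0$ as $s\to 0+$ such that for every $(t,x,a)\in\{0,\ldots,T-1\}\times\mathcal{X}\times\Gamma$ and all $m,\tilde m\in\mathcal{P}(\mathcal{X})$, $$\int_{\mathcal{Z}} \mathbf{1}_{\{\Psi(t,x,m,a,z)\neq\Psi(t,x,\tilde m,a,z)\}}\,\nu(dz)\le \boldsymbol{w}\bigl(\mathsf{dist}(m,\tilde m)\bigr).$$ Moreover, for every $t\in\{0,\ldots,T-1\}$ and every $\tau\in\mathcal{P}(\mathcal{X}\times\mathcal{P}(\mathcal{X})\times\Gamma)$, the map $\Psi(t,\cdot):\mathcal{X}\times\mathcal{P}(\mathcal{X})\times\Gamma\times\mathcal{Z}\to\mathcal{X}$ is $\tau\otimes\nu$-almost everywhere continuous. (A2) The cost coefficients $f$ and $F$ are continuous. (A3) For every $N$, $\gamma^N$ is a symmetric $\epsilon_N$-correlated equilibrium in restricted strategies with initial distribution $\mathfrak{m}^N$. (A4) $\epsilon_N\to 0$ as $N\to\infty$. (A5) $\mathfrak{m}^N=\otimes^N\mathfrak{m}_{0,N}$ with $\mathfrak{m}_{0,N}\in\mathcal{P}(\mathcal{X})$ and $\mathfrak{m}_{0,N}\to\mathfrak{m}_0$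 as $N\to\infty$. For each $N\ge 2$ let $((\Omega_N,\mathcal{F}_N,\mathbf{P}_N),\Phi^N_1,\ldots,\Phi^N_N,X^N_1(\cdot),\ldots,X^N_N(\cdot),\xi^N_1(\cdot),\ldots,\xi^N_N(\cdot))$ be a realization of the triple $(\mathfrak{m}^N,\gamma^N,\mathrm{Id})$, and set $$\rho^N := \mathbf{P}_N\circ\bigl(\Phi^N_1,\mu^N_1(0),\ldots,\mu^N_1(T)\bigr)^{-1},\qquad \mu^N_1(t):=\frac{1}{N-1}\sum_{j=2}^N\delta_{X^N_j(t)},\quad t\in\{0,\ldots,T\}.$$ Then $(\rho^N)$ is relatively compact as a subset of $\mathcal{P}(\mathcal{R}\times\mathcal{P}(\mathcal{X})^{T+1})$, and any limit point is a correlated solution of the mean field game in restricted strategies with initial distribution $\mathfrak{m}_0$.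
   Context: **Data.** For a Polish space $\mathcal{S}$, $\mathcal{P}(\mathcal{S})$ is the space of Borel probability measures on $\mathcal{S}$ with the topology of weak convergence. Finite sets carry the discrete topology. For finite $\mathcal{S}$, $\mathsf{dist}(m,\tilde m):=\frac12\sum_{x\in\mathcal{S}}|m(x)-\tilde m(x)|$ for $m,\tilde m\in\mathcal{P}(\mathcal{S})$. Fixed throughout: $T\in\mathbb{N}$ (time horizon); non-empty finite sets $\mathcal{X}$ (states) and $\Gamma$ (actions); $\mathcal{Z}:=[0,1]$ (noise space) with $\nu$ the uniform distribution on $\mathcal{Z}$; a measurable system function $\Psi:\{0,\ldots,T-1\}\times\mathcal{X}\times\mathcal{P}(\mathcal{X})\times\Gamma\times\mathcal{Z}\to\mathcal{X}$; bounded measurable running costs $f:\{0,\ldots,T-1\}\times\mathcal{X}\times\mathcal{P}(\mathcal{X})\times\Gamma\to\mathbb{R}$; bounded measurable terminal costs $F:\mathcal{X}\times\mathcal{P}(\mathcal{X})\to\mathbb{R}$. The finite set of restricted strategies is $\mathcal{R}:=\{\phi:\{0,\ldots,T-1\}\times\mathcal{X}\to\Gamma\}$, and the finite set of strategy modifications is $\mathcal{U}:=\{u:\mathcal{R}\to\mathcal{R}\}$, with $\mathrm{Id}\in\mathcal{U}$ the identity. For an $\mathcal{R}$-valued random variable $\Phi$, $u\circ\Phi(t,x)$ means $(u(\Phi))(t,x)$. **$N$-player game ($N\ge 2$).** Let $\mathfrak{m}^N\in\mathcal{P}(\mathcal{X}^N)$, $\gamma^N\in\mathcal{P}(\mathcal{R}^N)$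 (a correlated profile), $u\in\mathcal{U}$, $i\in\{1,\ldots,N\}$. A realization of $(\mathfrak{m}^N,\gamma^N,u)$ for player $i$ consists of a probability space $(\Omega,\mathcal{F},\mathbf{P})$ with $\mathcal{R}$-valued random variables $\Phi^N_1,\ldots,\Phi^N_N$, $\mathcal{X}$-valued random variables $X^N_j(t)$ ($1\le j\le N$, $0\le t\le T$) and $\mathcal{Z}$-valued random variables $\xi^N_j(t)$ ($1\le j\le N$, $1\le t\le T$) such that: (i) $(X^N_1(0),\ldots,X^N_N(0))$ has law $\mathfrak{m}^N$; (ii) $(\Phi^N_1,\ldots,\Phi^N_N)$ has law $\gamma^N$; (iii) the $\xi^N_j(t)$ are i.i.d. with law $\nu$; (iv) the three vectors $(\xi^N_j(t))_{j,t}$, $(X^N_j(0))_j$, $(\Phi^N_j)_j$ are independent; (v) $\mathbf{P}$-a.s., for every $t\in\{0,\ldots,T-1\}$, $$X^N_i(t+1)=\Psi\bigl(t,X^N_i(t),\mu^N_i(t),u\circ\Phi^N_i(t,X^N_i(t)),\xi^N_i(t+1)\bigr),$$ $$X^N_j(t+1)=\Psi\bigl(t,X^N_j(t),\mu^N_j(t),\Phi^N_j(t,X^N_j(t)),\xi^N_j(t+1)\bigr),\quad j\ne i,$$ where $\mu^N_l(t):=\frac{1}{N-1}\sum_{j\ne l}\delta_{X^N_j(t)}$. (For $u=\mathrm{Id}$ the notion does not depend on $i$.) The costs for player $i$ are $$J^N_i(\mathfrak{m}^N,\gamma^N,u):=\mathbf{E}\Bigl[\sum_{t=0}^{T-1}f\bigl(t,X^N_i(t),\mu^N_i(t),u\circ\Phi^N_i(t,X^N_i(t))\bigr)+F\bigl(X^N_i(T),\mu^N_i(T)\bigr)\Bigr],$$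 computed with any realization of $(\mathfrak{m}^N,\gamma^N,u)$ for player $i$ (the value does not depend on the realization). For $\epsilon\ge 0$, $\gamma^N$ is an $\epsilon$-correlated equilibrium in restricted strategies with initial distribution $\mathfrak{m}^N$ if $J^N_i(\mathfrak{m}^N,\gamma^N,\mathrm{Id})\le J^N_i(\mathfrak{m}^N,\gamma^N,u)+\epsilon$ for every $i\in\{1,\ldots,N\}$ and every $u\in\mathcal{U}$. It is symmetric if $\gamma^N$ is invariant under permutations of the components of $\mathcal{R}^N$. **Mean field game.** Let $\mathfrak{m}_0\in\mathcal{P}(\mathcal{X})$, $\rho\in\mathcal{P}(\mathcal{R}\times\mathcal{P}(\mathcal{X})^{T+1})$ (a correlated flow), $u\in\mathcal{U}$. A realization of $(\mathfrak{m}_0,\rho,u)$ consists of a probability space $(\Omega,\mathcal{F},\mathbf{P})$ with an $\mathcal{R}$-valued $\Phi$, $\mathcal{X}$-valued $X(0),\ldots,X(T)$, $\mathcal{P}(\mathcal{X})$-valued $\mu(0),\ldots,\mu(T)$ and $\mathcal{Z}$-valued $\xi(1),\ldots,\xi(T)$ random variables such that: (i) $X(0)$ has law $\mathfrak{m}_0$; (ii) $(\Phi,\mu(0),\ldots,\mu(T))$ has law $\rho$; (iii) the $\xi(t)$ are i.i.d. with law $\nu$; (iv) $\xi(\cdot)$, $X(0)$ and $(\Phi,\mu(\cdot))$ are independent; (v) $\mathbf{P}$-a.s., for every $t\in\{0,\ldots,T-1\}$, $X(t+1)=\Psi(t,X(t),\mu(t),u\circ\Phi(t,X(t)),\xi(t+1))$.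 The costs are $$J(\mathfrak{m}_0,\rho,u):=\mathbf{E}\Bigl[\sum_{t=0}^{T-1}f\bigl(t,X(t),\mu(t),u\circ\Phi(t,X(t))\bigr)+F\bigl(X(T),\mu(T)\bigr)\Bigr],$$ computed with any realization of $(\mathfrak{m}_0,\rho,u)$ (the value does not depend on the realization). The correlated flow $\rho$ is a correlated solution of the mean field game in restricted strategies with initial distribution $\mathfrak{m}_0$ if: (Optimality) $J(\mathfrak{m}_0,\rho,\mathrm{Id})\le J(\mathfrak{m}_0,\rho,u)$ for every $u\in\mathcal{U}$; (Consistency) if $((\Omega,\mathcal{F},\mathbf{P}),\Phi,X(\cdot),\mu(\cdot),\xi(\cdot))$ is a realization of $(\mathfrak{m}_0,\rho,\mathrm{Id})$, then for every $t\in\{0,\ldots,T\}$, $\mu(t)$ is a regular conditional distribution of $X(t)$ given $\mathcal{F}^\mu:=\sigma(\mu(s):s\in\{0,\ldots,T\})$. *)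

(* Defs.v *)
From HB Require Import structures.
From mathcomp Require Import all_boot all_order all_algebra all_fingroup.
From mathcomp Require Import all_classical all_reals all_analysis.
From mathcomp Require Import measurable_realfun.

Set Implicit Arguments.
Unset Strict Implicit.
Unset Printing Implicit Defensive.

Import Order.TTheory GRing.Theory Num.Theory.
Import numFieldTopology.Exports numFieldNormedType.Exports.

Local Open Scope classical_set_scope.
Local Open Scope ring_scope.

(* Non-empty finite sets; the distinguished point is arbitrary and only serves
   the library's requirement that measurable types be pointed. *)
#[short(type="pfinType")]
HB.structure Definition PFinite := {T of Finite T & Pointed T}.

(* [fpow I A] is the finite set A^I, [disc X] is X with the discrete topology,
   [tpow I S] is S^I with the product topology. *)
Definition fpow (I : finType) (A : pfinType) : Type := {ffun I -> A}.

HB.instance Definition _ (I : finType) (A : pfinType) := Finite.on (fpow I A).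
HB.instance Definition _ (I : finType) (A : pfinType) :=
  isPointed.Build (fpow I A) [ffun=> point].

Definition disc (X : pfinType) : Type := X.

HB.instance Definition _ (X : pfinType) := Pointed.on (disc X).
HB.instance Definition _ (X : pfinType) :=
  DiscreteTopology.copy (disc X) (discrete_topology X).

Definition tpow (I : Type) (S : ptopologicalType) : Type := I -> S.

HB.instance Definition _ (I : Type) (S : ptopologicalType) :=
  Pointed.on (tpow I S).
HB.instance Definition _ (I : Type) (S : ptopologicalType) :=
  Topological.copy (tpow I S) {ptws I -> S}.

HB.instance Definition _ (S S' : ptopologicalType) :=
  Topological.on (S * S')%type.

Definition borel (S : ptopologicalType) := g_sigma_algebraType (@open S).

(* [prob R S] is P(S): Borel probability measures with the topology of weak
   convergence, i.e. the coarsest one making rho |-> \int g drho continuous for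
   every bounded continuous g. *)
Section prob.
Variables (R : realType) (S : ptopologicalType).

Definition prob : Type := probability (borel S) R.

Definition test_fun : Type :=
  {g : S -> R | continuous g /\ exists M, forall s, `|g s| <= M}.

Definition integrals (rho : prob) : {ptws test_fun -> R} :=
  fun g => \int[rho]_(s in setT) sval g s.

HB.instance Definition _ := Choice.on prob.
HB.instance Definition _ := Pointed.on prob.
HB.instance Definition _ := Topological.copy prob (initial_topology integrals).

End prob.

(* The noise space is [0, 1] as a subspace of R, and [nu] is Lebesgue measure
   on it. *)
Section uniform_noise.
Variable R : realType.

Let itv01 : set R := `[0, 1].

Definition noise : Type := set_type itv01.

Let noise0_subproof : (0 : R) \in itv01.
Proof. by rewrite inE /itv01 /= in_itv /= lexx ler01. Qed.

HB.instance Definition _ := Topological.on noise.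
HB.instance Definition _ := isPointed.Build noise (SigSub noise0_subproof).

Definition nu (B : set (borel noise)) : \bar R :=
  lebesgue_measure ((set_val : noise -> R) @` B).

Let noise_val_inj : injective (set_val : noise -> R).
Proof. exact: val_inj. Qed.

Let mitv01 : measurable itv01.
Proof. exact: measurable_itv. Qed.

Lemma measurable_noise_image (B : set (borel noise)) :
  measurable B -> measurable ((set_val : noise -> R) @` B).
Proof.
have imgE (W : set R) :
    (set_val : noise -> R) @` ((set_val : noise -> R) @^-1` W) = W `&` itv01.
  rewrite eqEsubset; split=> [_ [z Wz <-]|x [Wx x01]].
    by split=> //; exact/set_mem/(valP z).
  by exists (SigSub (mem_set x01)).
pose V : set_system noise :=
  [set A | measurable ((set_val : noise -> R) @` A)].
suff: <<s @open noise >> `<=` V by exact.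
apply: smallest_sub; last first.
  move=> A [W oW <-] /=; rewrite /V /= imgE.
  by apply: measurableI => //; exact: open_measurable.
split=> [|A mA|F mF]; rewrite /V /=.
- by rewrite image_set0.
- suff -> : (set_val : noise -> R) @` (setT `\` A) =
      itv01 `\` ((set_val : noise -> R) @` A) by exact: measurableD.
  rewrite eqEsubset; split=> [_ [z [_ nAz] <-]|x [x01 nAx]].
    split; first exact/set_mem/(valP z).
    by move=> [z' Az' /noise_val_inj ez]; apply: nAz; rewrite -ez.
  exists (SigSub (mem_set x01)) => //; split=> // Ax; apply: nAx.
  by exists (SigSub (mem_set x01)).
- by rewrite image_bigcup; exact: bigcupT_measurable.
Qed.

Let nu0 : nu set0 = 0%E.
Proof. by rewrite /nu image_set0 measure0. Qed.

Let nu_ge0 B : (0 <= nu B)%E.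
Proof. exact: measure_ge0. Qed.

Let nu_sigma_additive : semi_sigma_additive nu.
Proof.
move=> F mF tF mUF; rewrite /nu image_bigcup.
apply: (@measure_semi_sigma_additive _ _ _ lebesgue_measure
  (fun n => (set_val : noise -> R) @` F n)) => //.
- by move=> n; exact: measurable_noise_image.
- apply/trivIsetP => i j _ _ ij; rewrite -subset0 => x [[y Fy <-] [z Fz]].
  move=> /noise_val_inj yz; move/trivIsetP : tF => /(_ i j I I ij) FF.
  have : (F i `&` F j) y by split; [exact: Fy|rewrite -yz].
  by rewrite FF.
- by rewrite -image_bigcup; exact: measurable_noise_image.
Qed.

HB.instance Definition _ := isMeasure.Build _ _ _ nu
  nu0 nu_ge0 nu_sigma_additive.

Let nu_setT : nu setT = 1%E.
Proof.
rewrite /nu; suff -> : (set_val : noise -> R) @` setT = itv01.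
  by rewrite /itv01 lebesgue_measure_itv /= lte_fin ltr01 oppr0 adde0.
rewrite eqEsubset; split=> [_ [z _ <-]|x x01]; first exact/set_mem/(valP z).
by exists (SigSub (mem_set x01)).
Qed.

HB.instance Definition _ := Measure_isProbability.Build _ _ _ nu nu_setT.

End uniform_noise.

Section probability_notions.
Variables (R : realType) (d : measure_display) (Omega : measurableType d).
Variable P : probability Omega R.

Definition has_law (S : ptopologicalType) (Y : Omega -> S) (rho : prob R S) :=
  forall B : set (borel S), measurable B -> P (Y @^-1` B) = rho B.

Definition sigma_gen (I : Type) (S : ptopologicalType) (Y : I -> Omega -> S) :
    set_system Omega :=
  <<s \bigcup_(i in setT)
        preimage_set_system setT (Y i : Omega -> borel S) measurable >>.

(* [B i] may be the whole space, so the product rule below covers all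
   subfamilies; likewise in [independent3]. *)
Definition iid (I : finType) (S : ptopologicalType) (Y : I -> Omega -> S)
    (rho : prob R S) :=
  (forall i, has_law (Y i) rho) /\
  forall B : I -> set (borel S), (forall i, measurable (B i)) ->
    P (\bigcap_(i in setT) (Y i @^-1` B i)) = (\prod_(i : I) P (Y i @^-1` B i))%E.

Definition independent3 (G1 G2 G3 : set_system Omega) :=
  forall A1 A2 A3, G1 A1 -> G2 A2 -> G3 A3 ->
    P (A1 `&` A2 `&` A3) = (P A1 * P A2 * P A3)%E.

Definition regular_conditional_distribution (G : set_system Omega)
    (S : ptopologicalType) (Y : Omega -> S) (kappa : Omega -> prob R S) :=
  (forall B : set (borel S), measurable B ->
     measurable_fun setT (fun w : g_sigma_algebraType G => kappa w B)) /\
  (forall (B : set (borel S)) (A : set Omega), measurable B -> G A ->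
     P (A `&` Y @^-1` B) = (\int[P]_(w in A) kappa w B)%E).

End probability_notions.

Definition dist (R : realType) (X : pfinType) (m m' : prob R (disc X)) : R :=
  2^-1 * \sum_(x : X) `|fine (m [set x]) - fine (m' [set x])|.

Definition product_law (R : realType) (I : finType) (X : pfinType)
    (m : prob R (disc (fpow I X))) (m0 : prob R (disc X)) :=
  forall B : I -> set (borel (disc X)), (forall j, measurable (B j)) ->
    m [set x : fpow I X | forall j, B j (x j)] = (\prod_(j : I) m0 (B j))%E.

Definition symmetric_law (R : realType) (n : nat) (A : pfinType)
    (gamma : prob R (disc (fpow 'I_n A))) :=
  forall (s : 'S_n) (B : set (borel (disc (fpow 'I_n A)))), measurable B ->
    gamma ((fun a : fpow 'I_n A => [ffun j => a (s j)] : fpow 'I_n A) @^-1` B)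
    = gamma B.

(* A game with at least two players has [n.+2] of them. *)
Section empirical_measure.
Variables (R : realType) (X : pfinType) (n : nat).
Variables (x : 'I_n.+2 -> X) (l : 'I_n.+2).

Definition empirical (B : set (borel (disc X))) : \bar R :=
  ((n.+1%:R^-1)%:E * \sum_(j < n.+2 | j != l) @dirac _ (borel (disc X)) (x j) R B)%E.

Let empirical0 : empirical set0 = 0%E.
Proof. by rewrite /empirical big1 ?mule0// => j _; rewrite measure0. Qed.

Let empirical_ge0 B : (0 <= empirical B)%E.
Proof.
by rewrite /empirical mule_ge0 ?lee_fin ?invr_ge0// sume_ge0.
Qed.

Let empirical_sigma_additive : semi_sigma_additive empirical.
Proof.
move=> G mG tG mUG; rewrite /empirical.
rewrite (_ : (fun m => _) = (fun m => (n.+1%:R^-1)%:E *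
   \sum_(j < n.+2 | j != l) \sum_(0 <= i < m)
     @dirac _ (borel (disc X)) (x j) R (G i))%E); last first.
  apply/funext => m; rewrite exchange_big /= ge0_sume_distrr//.
  by move=> i _; exact: sume_ge0.
apply: cvgeZl => //; apply: cvg_nnesum => [j _|j _].
  by apply: nearW => m; exact: sume_ge0.
exact: measure_semi_sigma_additive.
Qed.

HB.instance Definition _ := isMeasure.Build _ _ _ empirical
  empirical0 empirical_ge0 empirical_sigma_additive.

Let empirical_setT : empirical setT = 1%E.
Proof.
rewrite /empirical (eq_bigr (fun=> 1%E)); last by move=> j _; rewrite diracT.
rewrite sumEFin sumr_const -EFinM.
have -> : #|[pred j : 'I_n.+2 | j != l]| = n.+1.
  by rewrite (@eq_card _ _ (predC1 l))// cardC1 card_ord.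
by rewrite mulVf.
Qed.

HB.instance Definition _ := Measure_isProbability.Build _ _ _ empirical
  empirical_setT.

End empirical_measure.

Definition strategy (T : nat) (X Gamma : pfinType) : pfinType :=
  fpow ('I_T * X)%type Gamma.

Definition flow (R : realType) (T : nat) (X Gamma : pfinType) : ptopologicalType :=
  (disc (strategy T X Gamma) * tpow 'I_T.+1 (prob R (disc X)))%type.

(* Times 0..T are ['I_T.+1]; for t in 0..T-1, [now t] is t and [next t] is t+1
   as elements of 0..T. *)
Definition now (T : nat) (t : 'I_T) : 'I_T.+1 := widen_ord (leqnSn T) t.
Definition next (T : nat) (t : 'I_T) : 'I_T.+1 := lift ord0 t.

Section games.
Variables (R : realType) (T : nat) (X Gamma : pfinType).
Local Notation PX := (prob R (disc X)).
Local Notation strat := (strategy T X Gamma).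
Variable Psi : 'I_T -> X -> PX -> Gamma -> noise R -> X.
Variable f : 'I_T -> X -> PX -> Gamma -> R.
Variable F : X -> PX -> R.

(* In a realization, [xi j t] is the noise entering the step from t to t+1,
   i.e. the variable indexed by t+1 in 1..T. *)
Record N_realization (n : nat) (mN : prob R (disc (fpow 'I_n.+2 X)))
    (gamma : prob R (disc (fpow 'I_n.+2 strat))) (u : strat -> strat)
    (i : 'I_n.+2) := NRealization {
  Nr_display : measure_display;
  Nr_Omega : measurableType Nr_display;
  Nr_P : probability Nr_Omega R;
  Nr_Phi : 'I_n.+2 -> Nr_Omega -> strat;
  Nr_X : 'I_n.+2 -> 'I_T.+1 -> Nr_Omega -> X;
  Nr_xi : 'I_n.+2 -> 'I_T -> Nr_Omega -> noise R;
  Nr_mPhi : forall j,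
    measurable_fun setT (Nr_Phi j : Nr_Omega -> borel (disc strat));
  Nr_mX : forall j t,
    measurable_fun setT (Nr_X j t : Nr_Omega -> borel (disc X));
  Nr_mxi : forall j t,
    measurable_fun setT (Nr_xi j t : Nr_Omega -> borel (noise R));
  Nr_lawX0 : has_law Nr_P
    (fun w => [ffun j => Nr_X j ord0 w] : disc (fpow 'I_n.+2 X)) mN;
  Nr_lawPhi : has_law Nr_P
    (fun w => [ffun j => Nr_Phi j w] : disc (fpow 'I_n.+2 strat)) gamma;
  Nr_iid : iid Nr_P (fun jt : 'I_n.+2 * 'I_T => Nr_xi jt.1 jt.2) (@nu R);
  Nr_indep : independent3 Nr_P
    (sigma_gen (fun jt : 'I_n.+2 * 'I_T => Nr_xi jt.1 jt.2))
    (sigma_gen (fun j => Nr_X j ord0 : Nr_Omega -> disc X))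
    (sigma_gen (fun j => Nr_Phi j : Nr_Omega -> disc strat));
  Nr_dynamics : {ae Nr_P, forall w, forall (t : 'I_T) (j : 'I_n.+2),
    Nr_X j (next t) w =
      Psi t (Nr_X j (now t) w)
        (empirical R (fun k => Nr_X k (now t) w) j)
        ((if j == i then u (Nr_Phi j w) else Nr_Phi j w)
           (t, Nr_X j (now t) w))
        (Nr_xi j t w)} }.

Definition Nr_mu n mN gamma u i (r : @N_realization n mN gamma u i)
    (l : 'I_n.+2) (t : 'I_T.+1) (w : Nr_Omega r) : PX :=
  empirical R (fun k => Nr_X k t w) l.

Definition N_cost n mN gamma u i (r : @N_realization n mN gamma u i) : R :=
  fine 'E_(Nr_P r)[fun w =>
    \sum_(t < T) f t (Nr_X i (now t) w) (Nr_mu i (now t) w)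
                   (u (Nr_Phi i w) (t, Nr_X i (now t) w))
    + F (Nr_X i ord_max w) (Nr_mu i ord_max w)].

(* The cost is the same for all realizations, so the choice is immaterial. *)
Definition J_N n mN gamma u i : R :=
  xget 0 [set c | exists r : @N_realization n mN gamma u i, c = N_cost r].

Definition correlated_equilibrium n (eps : R)
    (mN : prob R (disc (fpow 'I_n.+2 X)))
    (gamma : prob R (disc (fpow 'I_n.+2 strat))) :=
  forall (i : 'I_n.+2) (u : strat -> strat),
    J_N mN gamma id i <= J_N mN gamma u i + eps.

Section flow_law.
Variables (n : nat) (mN : prob R (disc (fpow 'I_n.+2 X))).
Variables (gamma : prob R (disc (fpow 'I_n.+2 strat))) (u : strat -> strat).
Variables (i : 'I_n.+2) (r : N_realization mN gamma u i).

Definition Nr_flow (w : Nr_Omega r) : borel (flow R T X Gamma) :=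
  (Nr_Phi i w, fun t => Nr_mu i t w).

Lemma measurable_Nr_flow : measurable_fun setT Nr_flow.
Proof.
pose V (w : Nr_Omega r) : strat * {ffun 'I_n.+2 * 'I_T.+1 -> X} :=
  (Nr_Phi i w, [ffun jt => Nr_X jt.1 jt.2 w]).
pose G (v : strat * {ffun 'I_n.+2 * 'I_T.+1 -> X}) : flow R T X Gamma :=
  (v.1, fun t => empirical R (fun k => v.2 (k, t)) i : PX).
have flowE (w : Nr_Omega r) : Nr_flow w = G (V w).
  rewrite /Nr_flow /G /V /=; congr pair; apply/funext => t.
  by rewrite /Nr_mu; congr (empirical R _ i); apply/funext => k; rewrite ffunE.
have mdisc (A : pfinType) (B : set (disc A)) :
    measurable (B : set (borel (disc A))).
  by apply: sub_sigma_algebra; exact: discrete_open.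
have mV v : measurable [set w | V w = v].
  case: v => a b.
  rewrite (_ : [set w | V w = (a, b)] = (Nr_Phi i @^-1` [set a]) `&`
      \bigcap_(jt in [set: 'I_n.+2 * 'I_T.+1])
        (Nr_X jt.1 jt.2 @^-1` [set b jt])); last first.
    rewrite eqEsubset; split=> [w [<- <-]|w [/= v1 v2]].
      by split=> //= jt _; rewrite ffunE.
    by rewrite /= /V v1; congr pair; apply/ffunP => jt; rewrite ffunE; exact: v2.
  apply: measurableI.
    by rewrite -[X in measurable X]setTI; apply: Nr_mPhi => //; exact: mdisc.
  apply: fin_bigcap_measurable => // jt _.
  by rewrite -[X in measurable X]setTI; apply: Nr_mX => //; exact: mdisc.
move=> _ B _; rewrite setTI.
rewrite (_ : Nr_flow @^-1` B =
    \bigcup_(v in [set v | B (G v)]) [set w | V w = v]); last first.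
  rewrite eqEsubset; split=> w /=.
    by rewrite flowE => BGw; exists (V w).
  by move=> [v Bv Vw]; rewrite flowE Vw.
by apply: fin_bigcup_measurable => // v _; exact: mV.
Qed.

HB.instance Definition _ := isMeasurableFun.Build _ _ _ _ Nr_flow
  measurable_Nr_flow.

Definition Nr_flow_law : prob R (flow R T X Gamma) :=
  distribution (Nr_P r) Nr_flow.

End flow_law.

Record mf_realization (m0 : PX) (rho : prob R (flow R T X Gamma))
    (u : strat -> strat) := MFRealization {
  mf_display : measure_display;
  mf_Omega : measurableType mf_display;
  mf_P : probability mf_Omega R;
  mf_Phi : mf_Omega -> strat;
  mf_X : 'I_T.+1 -> mf_Omega -> X;
  mf_mu : 'I_T.+1 -> mf_Omega -> PX;
  mf_xi : 'I_T -> mf_Omega -> noise R;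
  mf_mPhi : measurable_fun setT (mf_Phi : mf_Omega -> borel (disc strat));
  mf_mX : forall t, measurable_fun setT (mf_X t : mf_Omega -> borel (disc X));
  mf_mmu : forall t, measurable_fun setT (mf_mu t : mf_Omega -> borel PX);
  mf_mxi : forall t,
    measurable_fun setT (mf_xi t : mf_Omega -> borel (noise R));
  mf_lawX0 : has_law mf_P (mf_X ord0 : mf_Omega -> disc X) m0;
  mf_lawflow : has_law mf_P
    (fun w => (mf_Phi w, fun t => mf_mu t w) : flow R T X Gamma) rho;
  mf_iid : iid mf_P mf_xi (@nu R);
  mf_indep : independent3 mf_P
    (sigma_gen mf_xi)
    (sigma_gen (fun _ : unit => mf_X ord0 : mf_Omega -> disc X))
    (sigma_gen (fun (_ : unit) w =>
       (mf_Phi w, fun t => mf_mu t w) : flow R T X Gamma));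
  mf_dynamics : {ae mf_P, forall w, forall t : 'I_T,
    mf_X (next t) w =
      Psi t (mf_X (now t) w) (mf_mu (now t) w)
        (u (mf_Phi w) (t, mf_X (now t) w)) (mf_xi t w)} }.

Definition mf_cost m0 rho u (r : @mf_realization m0 rho u) : R :=
  fine 'E_(mf_P r)[fun w =>
    \sum_(t < T) f t (mf_X (now t) w) (mf_mu (now t) w)
                   (u (mf_Phi w) (t, mf_X (now t) w))
    + F (mf_X ord_max w) (mf_mu ord_max w)].

Definition J m0 rho u : R :=
  xget 0 [set c | exists r : @mf_realization m0 rho u, c = mf_cost r].

Definition optimal m0 rho := forall u : strat -> strat, J m0 rho id <= J m0 rho u.

Definition consistent m0 rho :=
  forall (r : @mf_realization m0 rho id) (t : 'I_T.+1),
    regular_conditional_distribution (mf_P r) (sigma_gen (@mf_mu _ _ _ r))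
      (mf_X t : mf_Omega r -> disc X) (mf_mu t).

Definition correlated_solution m0 rho := optimal m0 rho /\ consistent m0 rho.

End games.

(* Main.v *)
Require Import Defs.
From HB Require Import structures.
From mathcomp Require Import all_boot all_order all_algebra all_fingroup.
From mathcomp Require Import all_classical all_reals all_analysis.
From mathcomp Require Import measurable_realfun ring.

(** Both claims rest on the compactness of the space of flows: a product of a
   finite set and of spaces of laws on a finite set.

   Relative compactness.  For S compact Hausdorff, the space of probability
   measures on S is compact ([prob_compact]): along an ultrafilter the measures
   converge on every closed set, the limit is a content on closed sets, and its
   outer regularization is a measure that dominates it
   ([content_dominated]).  Slicing continuous functions into layers turns this
   domination into an inequality between integrals, which applied to g and to
   - g shows that the ultrafilter converges weakly to that measure.

   Propagation of chaos.  Let player 0 apply a modification u.  The game is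
   coupled, on the same sample space, with a decoupled game in which the other
   players do not look at player 0.  Since player 0 weighs 1/(N-1) in what the
   others see, induction on time and the modulus of continuity of the system
   function give that the states of a player in the two games differ with a
   probability tending to 0 ([coupling_step], [coupling_limit]).  In the decoupled
   game, what player 0 sees is a function of the correlated strategies and of the
   data of the other players, hence is independent of its own initial state and
   noises: player 0 is exactly a mean field player in a random environment, and
   integrating its noises one after the other gives the conditional law [occ] of
   its state given the environment ([chain_marginal], [decoupled_marginal]).  This
   conditional law is continuous in the environment, and the environment in the
   decoupled game does not depend on u.  Therefore, for h continuous, the
   expectations of h(flow) 1_{state of player 0 = y} converge, along any filter
   along which the laws of the flows converge to rho, to the integral of
   h * occ against rho ([propagation]).

   Optimality.  The costs are finite sums of such expectations, so the costs of
   player 0 converge, for every u, to the mean field cost of u ([cost_limit],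
   [J_occ]), and the equilibrium inequalities pass to the limit.

   Consistency.  The law of the undisturbed game is invariant under permutations
   of the players ([exchange]), and two players see empirical measures at distance
   at most 1/(N-1).  Averaging over the players replaces the indicator of the
   event that player 0 is in y by the empirical mass of y, so that in the limit
   h * occ and h * mu(t)(y) have the same integral against rho for h
   continuous in mu ([exchange_limit]).  Approximating indicators of open sets by
   continuous functions, then a pi-lambda argument, extend this to all events of
   the sigma-algebra generated by mu, which is the defining property of a
   regular conditional distribution ([rcd_flow]). *)

Set Implicit Arguments.
Unset Strict Implicit.
Unset Printing Implicit Defensive.

Import Order.TTheory GRing.Theory Num.Theory.
Import numFieldTopology.Exports numFieldNormedType.Exports.

Local Open Scope classical_set_scope.
Local Open Scope ring_scope.

(** * Regularizing a content on the closed sets of a compact space *)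

Section content_measure.
Context {R : realType} {S : ptopologicalType}.
Hypotheses (hS : hausdorff_space S) (cS : compact [set: S]).
Variable lam : set S -> R.
Hypothesis lam0 : lam set0 = 0.
Hypothesis lam_mono : forall K L, closed K -> closed L -> K `<=` L -> lam K <= lam L.
Hypothesis lam_sub : forall K L, closed K -> closed L ->
  lam (K `|` L) <= lam K + lam L.
Hypothesis lam_add : forall K L, closed K -> closed L -> K `&` L = set0 ->
  lam K + lam L <= lam (K `|` L).
Hypothesis lamT : lam setT = 1.

Local Open Scope ereal_scope.

Definition inner (O : set S) : \bar R :=
  ereal_sup [set (lam K)%:E | K in [set K | closed K /\ K `<=` O]].

Let le_inner K O : closed K -> K `<=` O -> (lam K)%:E <= inner O.
Proof. by move=> cK KO; apply: ereal_sup_ubound; exists K. Qed.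

Let inner_le O x : (forall K, closed K -> K `<=` O -> (lam K)%:E <= x) ->
  inner O <= x.
Proof. by move=> h; apply: ge_ereal_sup => _ [K [cK KO] <-]; exact: h. Qed.

Let inner_ge0 O : 0 <= inner O.
Proof. by rewrite -[0]/(0%R%:E) -lam0 le_inner//; exact: closed0. Qed.

Let inner_le1 O : inner O <= 1.
Proof.
by apply: inner_le => K cK KO; rewrite lee_fin -lamT lam_mono//; exact: closedT.
Qed.

(** By normality, K minus U has a neighbourhood B with closure in O; then K is
   the union of its parts in the closure of B and off the interior of B. *)
Lemma closed_splitU (K O U : set S) : closed K -> open O -> open U ->
  K `<=` O `|` U ->
  exists K1 K2, [/\ closed K1, closed K2, K1 `<=` O, K2 `<=` U & K = K1 `|` K2].
Proof.
move=> cK oO oU KOU.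
have cA : closed (K `\` U) by rewrite setDE; apply: closedI => //; exact: open_closedC.
have [|B BA clBO] := compact_normal hS cS cA (_ : set_nbhs (K `\` U) O).
  move=> x [Kx nUx]; apply: open_nbhs_nbhs; split => //.
  by have [] := KOU x Kx.
exists (K `&` closure B), (K `&` ~` B°); split => //.
- by apply: closedI => //; exact: closed_closure.
- by apply: closedI => //; exact/open_closedC/open_interior.
- by move=> x [_]; exact: clBO.
- move=> x [Kx nBx]; apply: contrapT => nUx.
  by apply: nBx; exact: BA.
- rewrite -setIUr (_ : _ `|` _ = setT) ?setIT//; rewrite -subTset => x _.
  have [Bx|nBx] := pselect (B° x); last by right.
  by left; apply: subset_closure; exact: interior_subset.
Qed.

Let lam_le_sum (O : (set S)^nat) n : (forall i, open (O i)) ->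
  forall K, closed K -> K `<=` \big[setU/set0]_(i < n) O i ->
  (lam K)%:E <= \sum_(i < n) inner (O i).
Proof.
move=> oO; elim: n => [|n ih] K cK; rewrite !(big_ord0, big_ord_recr)/= => KO.
  by move: KO; rewrite subset0 => ->; rewrite lam0.
have [||K1 [K2 [cK1 cK2 K1O K2O ->]]] := closed_splitU cK _ _ KO => //.
  by rewrite -bigcup_mkord; apply: bigcup_open => i _; exact: oO.
apply: (@le_trans _ _ ((lam K1)%:E + (lam K2)%:E)).
  by rewrite -EFinD lee_fin lam_sub.
by apply: leeD; [exact: ih|exact: le_inner].
Qed.

(** Compactness leaves finitely many open sets to add up. *)
Let inner_bigcup (O : (set S)^nat) : (forall i, open (O i)) ->
  inner (\bigcup_i O i) <= \sum_(i <oo) inner (O i).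
Proof.
move=> oO; apply: inner_le => K cK KO.
have : compact K by apply: (subclosed_compact cK cS).
rewrite compact_cover => /(_ nat setT O (fun i _ => oO i) KO) [D _ KD].
pose n := (\max_(i <- finmap.enum_fset D) i).+1.
apply: (@le_trans _ _ (\sum_(i < n) inner (O i))).
  apply: lam_le_sum => // x /KD [i /= iD Oix].
  rewrite -bigcup_mkord; exists i => //=; rewrite ltnS.
  by apply: leq_bigmax_seq.
rewrite -(big_mkord xpredT (fun i => inner (O i))).
exact: nneseries_lim_ge.
Qed.

Definition outer (A : set S) : \bar R :=
  ereal_inf [set inner O | O in [set O | open O /\ A `<=` O]].

Let outer_le A O : open O -> A `<=` O -> outer A <= inner O.
Proof. by move=> oO AO; apply: ereal_inf_lbound; exists O. Qed.

Let le_outer A x : (forall O, open O -> A `<=` O -> x <= inner O) -> x <= outer A.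
Proof. by move=> h; apply: le_ereal_inf_tmp => _ [U [oU AU] <-]; exact: h. Qed.

Let outer_ge0 A : 0 <= outer A.
Proof. by apply: le_outer => O _ _. Qed.

Let outer0 : outer set0 = 0.
Proof.
apply/eqP; rewrite eq_le outer_ge0 andbT (le_trans (outer_le open0 _))//.
by apply: inner_le => K cK; rewrite subset0 => ->; rewrite lam0.
Qed.

Let outer_mono : {homo outer : A B / A `<=` B >-> A <= B}.
Proof.
by move=> A B AB; apply: le_outer => O oO BO; apply: outer_le => //; exact: subset_trans BO.
Qed.

Let outer_fin A : outer A \is a fin_num.
Proof.
rewrite ge0_fin_numE// (@le_lt_trans _ _ 1) ?ltry//.
by rewrite (le_trans (outer_le openT _)).
Qed.

Let outer_sub : sigma_subadditive outer.
Proof.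
move=> A; apply/lee_addgt0Pr => e e0.
(* V n is an open set containing A n, optimal up to e / 2 ^ n.+1. *)
have /choice [V PV] : forall n, exists O, [/\ open O, A n `<=` O &
    inner O <= outer (A n) + (e / (2 ^ n.+1)%:R)%:E].
  move=> n; have [|_ [U [oU AU] <-] lt] := @lb_ereal_inf_adherent _
    [set inner O | O in [set O | open O /\ A n `<=` O]] (e / (2 ^ n.+1)%:R) _ (outer_fin (A n)).
    by rewrite divr_gt0// ltr0n expn_gt0.
  by exists U; split => //; exact: ltW.
apply: le_trans (epsilon_trick xpredT (fun n => outer_ge0 (A n)) (ltW e0)).
apply: (@le_trans _ _ (inner (\bigcup_n V n))).
  apply: outer_le; first by apply: bigcup_open => n _; have [] := PV n.
  by apply: subset_bigcup => n _; have [] := PV n.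
apply: le_trans (inner_bigcup _) _; first by move=> n; have [] := PV n.
by apply: lee_nneseries => // n _; have [] := PV n.
Qed.

HB.instance Definition _ := isOuterMeasure.Build R S outer
  outer0 outer_ge0 outer_mono outer_sub.

(** Exhaust the part of U in O by a closed K, then the rest of U minus K by a
   closed L: on the disjoint sets K and L the content is additive. *)
Let open_caratheodory O : open O -> outer.-caratheodory O.
Proof.
move=> oO; apply: le_caratheodory_measurable => X; apply: le_outer => U oU XU.
have oUO : open (U `&` O) by exact: openI.
apply: (@le_trans _ _ (inner (U `&` O) + outer (X `&` ~` O))).
  by apply: leeD2r; apply: outer_le => // x [/XU].
rewrite -leeBrDr//; apply: inner_le => K cK KUO.
rewrite leeBrDr// addeC -leeBrDr//.
have oUK : open (U `&` ~` K) by apply: openI => //; exact: closed_openC.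
apply: (@le_trans _ _ (inner (U `&` ~` K))).
  by apply: outer_le => // x [/XU Ux nOx]; split => // /KUO [].
apply: inner_le => L cL LUK; rewrite leeBrDr// -EFinD.
apply: (@le_trans _ _ (lam (L `|` K))%:E).
  rewrite lee_fin; apply: lam_add => //; rewrite -subset0 => x [Lx Kx].
  by have [_] := LUK x Lx; exact.
by apply: le_inner; [exact: closedU|move=> x [/LUK[]|/KUO[]]].
Qed.

Let borel_caratheodory (B : set (borel S)) : measurable B -> outer.-caratheodory B.
Proof.
suff : <<s @open S >> `<=` (@measurable _ (caratheodory_type outer)) by exact.
apply: smallest_sub; last by move=> O oO; exact: open_caratheodory.
exact: sigma_algebra_measurable.
Qed.

(** The same function as [outer] under another name, which carries a measure
   structure on the Borel sigma-algebra. *)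
Definition reg (B : set (borel S)) : \bar R := outer B.

Let reg0 : reg set0 = 0. Proof. exact: outer0. Qed.
Let reg_ge0 B : 0 <= reg B. Proof. exact: outer_ge0. Qed.
Let reg_sigma_additive : semi_sigma_additive reg.
Proof.
move=> F mF tF mUF.
apply: (@caratheodory_measure_sigma_additive R S outer) => //.
- by move=> n; exact: borel_caratheodory.
- exact: borel_caratheodory.
Qed.

HB.instance Definition _ := isMeasure.Build _ _ _ reg reg0 reg_ge0 reg_sigma_additive.

Let regT : reg setT = 1.
Proof.
apply/eqP; rewrite eq_le (le_trans (outer_le openT _))//=.
apply: le_outer => O oO TO; rewrite -lamT le_inner//; exact: closedT.
Qed.

HB.instance Definition _ := Measure_isProbability.Build _ _ _ reg regT.

(** The content need not be regular, so only an inequality relates it to the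
   measure on closed sets.  The total masses being equal, this is enough to
   identify integrals of continuous functions. *)
Lemma content_dominated : exists mu : prob R S,
  forall K, closed K -> (lam K)%:E <= mu K.
Proof.
exists (reg : prob R S) => K cK; apply: le_outer => O oO KO; exact: le_inner.
Qed.

End content_measure.

(** * Expectations of bounded measurable functions *)

Lemma measurable_preimage d d' (T : measurableType d) (T' : measurableType d')
    (f : T -> T') (A : set T') :
  measurable_fun setT f -> measurable A -> measurable (f @^-1` A).
Proof. by move=> mf mA; rewrite -[X in measurable X]setTI; exact: mf. Qed.

Definition bmeas {d} {T : measurableType d} {R : realType} (h : T -> R) :=
  measurable_fun setT h /\ exists M : R, forall x, `|h x| <= M.

Section bounded_measurable.
Context {d} {T : measurableType d} {R : realType}.
Implicit Types h g : T -> R.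

Lemma bmeas_cst (c : R) : bmeas (fun _ : T => c).
Proof. by split; [exact: measurable_cst|exists `|c|]. Qed.

Lemma bmeasD h g : bmeas h -> bmeas g -> bmeas (fun x => h x + g x).
Proof.
move=> [mh [M hM]] [mg [N gN]]; split; first exact: measurable_funD.
by exists (M + N) => x; rewrite (le_trans (ler_normD _ _))// lerD.
Qed.

Lemma bmeasM h g : bmeas h -> bmeas g -> bmeas (fun x => h x * g x).
Proof.
move=> [mh [M hM]] [mg [N gN]]; split; first exact: measurable_funM.
by exists (M * N) => x; rewrite normrM ler_pM.
Qed.

Lemma bmeasB h g : bmeas h -> bmeas g -> bmeas (fun x => h x - g x).
Proof.
move=> [mh [M hM]] [mg [N gN]]; split; first exact: measurable_funB.
by exists (M + N) => x; rewrite (le_trans (ler_normB _ _))// lerD.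
Qed.

Lemma bmeas_norm h : bmeas h -> bmeas (fun x => `|h x|).
Proof.
move=> [mh [M hM]]; split; first exact: measurableT_comp.
by exists M => x; rewrite normr_id.
Qed.

Lemma bmeas_sum I (s : seq I) (p : pred I) (h : I -> T -> R) :
  (forall i, bmeas (h i)) -> bmeas (fun x => \sum_(i <- s | p i) h i x).
Proof.
move=> mh; elim: s => [|i s ih].
  by under eq_fun do rewrite big_nil; exact: bmeas_cst.
under eq_fun do rewrite big_cons; case: (p i) => //; exact: bmeasD.
Qed.

Lemma bmeas_indic (A : set T) : measurable A -> bmeas (\1_A : T -> R).
Proof.
move=> mA; split; first exact: measurable_indic.
by exists 1 => x; rewrite indicE ger0_norm; [rewrite lern1; exact: leq_b1|exact: ler0n].
Qed.

Lemma bmeas_comp d' (T' : measurableType d') (f : T' -> T) h :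
  measurable_fun setT f -> bmeas h -> bmeas (h \o f).
Proof. by move=> mf [mh [M hM]]; split; [exact: measurableT_comp|exists M => x /=]. Qed.

End bounded_measurable.

Section expectation.
Context {d} {T : measurableType d} {R : realType}.
Variable P : probability T R.
Implicit Types h g : T -> R.

Definition Ex h : R := \int[P]_(x in setT) h x.

Lemma bmeas_integrable h : bmeas h -> P.-integrable setT (EFin \o h).
Proof.
move=> [mh [M hM]]; apply: measurable_bounded_integrable => //.
  by rewrite (le_lt_trans (probability_le1 P _)) ?ltry.
exists M; split; first exact: num_real.
by move=> x Mx z _ /=; rewrite (le_trans (hM z))// ltW.
Qed.

Lemma ExE h : bmeas h -> (\int[P]_x (h x)%:E)%E = (Ex h)%:E.
Proof. by move=> bh; rewrite /Ex /Rintegral fineK// integrable_fin_num//; exact: bmeas_integrable. Qed.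

Lemma Ex_cst (c : R) : Ex (fun=> c) = c.
Proof. by rewrite /Ex Rintegral_cst// [X in fine X]probability_setT mulr1. Qed.

Lemma ExD h g : bmeas h -> bmeas g -> Ex (fun x => h x + g x) = Ex h + Ex g.
Proof. by move=> bh bg; rewrite /Ex RintegralD//; exact: bmeas_integrable. Qed.

Lemma ExB h g : bmeas h -> bmeas g -> Ex (fun x => h x - g x) = Ex h - Ex g.
Proof. by move=> bh bg; rewrite /Ex RintegralB//; exact: bmeas_integrable. Qed.

Lemma ExZl h (c : R) : bmeas h -> Ex (fun x => c * h x) = c * Ex h.
Proof. by move=> bh; rewrite /Ex RintegralZl//; exact: bmeas_integrable. Qed.

Lemma Ex_sum I (s : seq I) (p : pred I) (h : I -> T -> R) :
  (forall i, bmeas (h i)) ->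
  Ex (fun x => \sum_(i <- s | p i) h i x) = \sum_(i <- s | p i) Ex (h i).
Proof.
move=> mh; elim: s => [|i s ih].
  by under eq_fun do rewrite big_nil; rewrite Ex_cst big_nil.
under eq_fun do rewrite big_cons; rewrite big_cons; case: (p i) => //.
by rewrite ExD ?ih//; exact: bmeas_sum.
Qed.

Lemma le_Ex h g : bmeas h -> bmeas g -> (forall x, h x <= g x) -> Ex h <= Ex g.
Proof. by move=> bh bg hg; apply: le_Rintegral => //; exact: bmeas_integrable. Qed.

Lemma Ex_norm h : bmeas h -> `|Ex h| <= Ex (fun x => `|h x|).
Proof. by move=> bh; apply: le_normr_Rintegral => //; exact: bmeas_integrable. Qed.

Lemma Ex_indic (A : set T) : measurable A -> Ex \1_A = fine (P A).
Proof. by move=> mA; rewrite /Ex /Rintegral integral_indic// setIT. Qed.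

Lemma Ex_ae h g : bmeas h -> bmeas g -> {ae P, forall x, h x = g x} ->
  Ex h = Ex g.
Proof.
move=> [mh _] [mg _] hg; rewrite /Ex /Rintegral; congr fine.
apply: ae_eq_integral => //; first exact/measurable_EFinP.
  exact/measurable_EFinP.
by apply: filterS hg => x /= + _; move=> ->.
Qed.

Lemma prob_le1 (A : set T) : measurable A -> fine (P A) <= 1.
Proof. by move=> mA; rewrite -lee_fin fineK ?fin_num_measure// probability_le1. Qed.

Lemma prob_mono (A B : set T) : measurable A -> measurable B -> A `<=` B ->
  fine (P A) <= fine (P B).
Proof.
by move=> mA mB AB; rewrite fine_le ?fin_num_measure// le_measure// inE.
Qed.

End expectation.

Lemma Ex_law {R : realType} d d' (T : measurableType d) (S : measurableType d')
    (P : probability T R) (Q : probability S R) (f : T -> S) (h : S -> R) :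
  measurable_fun setT f -> (forall B, measurable B -> P (f @^-1` B) = Q B) ->
  bmeas h -> Ex P (h \o f) = Ex Q h.
Proof.
move=> mf fQ bh; rewrite /Ex /Rintegral; congr fine.
pose f' : {mfun T >-> S} := HB.pack f (isMeasurableFun.Build _ _ _ _ f mf).
have mh : measurable_fun setT (EFin \o h).
  by apply/measurable_EFinP; case: bh.
have ih : P.-integrable (f' @^-1` setT) ((EFin \o h) \o f').
  by apply: bmeas_integrable; exact: bmeas_comp.
rewrite -[LHS](integral_pushforward (measurable_funPT f') mh ih measurableT).
by apply: eq_measure_integral => A mA _; exact: fQ.
Qed.

Lemma Ex_fin {R : realType} d (T : measurableType d) (P : probability T R)
    (E : finType) (W : T -> E) (h : E -> R) :
  (forall e, measurable (W @^-1` [set e])) ->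
  Ex P (h \o W) = \sum_e h e * fine (P (W @^-1` [set e])).
Proof.
move=> mW.
have -> : h \o W = fun x => \sum_e h e * \1_(W @^-1` [set e]) x.
  apply/funext => x /=; rewrite (bigD1 (W x))//= indicE mem_set// mulr1.
  rewrite big1 ?addr0// => e eW; rewrite indicE memNset ?mulr0// => /= We.
  by rewrite We eqxx in eW.
have bi e : bmeas (\1_(W @^-1` [set e]) : T -> R) by exact: bmeas_indic.
rewrite Ex_sum; first by apply: eq_bigr => e _; rewrite ExZl// Ex_indic.
by move=> e; apply: bmeasM => //; exact: bmeas_cst.
Qed.

Lemma bmeas_fin {R : realType} d (T : measurableType d)
    (E : finType) (W : T -> E) (h : E -> R) :
  (forall e, measurable (W @^-1` [set e])) -> bmeas (h \o W).
Proof.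
move=> mW; split; last first.
  exists (\sum_e `|h e|) => x; rewrite (bigD1 (W x))//= lerDl sumr_ge0//.
move=> _ B mB; rewrite setTI.
rewrite (_ : _ @^-1` _ = \bigcup_(e in [set e | B (h e)]) (W @^-1` [set e])).
  exact: fin_bigcup_measurable.
by rewrite eqEsubset; split => [x Bx|x [e Be We]]; [exists (W x)|rewrite /= We].
Qed.

Lemma Ex_dominated {R : realType} d (W : measurableType d) (P : probability W R)
    (h : nat -> W -> R) (g : W -> R) (M : R) :
  (forall n, measurable_fun setT (h n)) -> bmeas g ->
  (forall n w, `|h n w| <= M) -> (forall w, h n w @[n --> \oo] --> g w) ->
  Ex P (h n) @[n --> \oo] --> Ex P g.
Proof.
move=> mh bg hM hg.
have bh n : bmeas (h n) by split => //; exists M.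
have := @dominated_cvg _ W R P setT measurableT (fun n w => (h n w)%:E) (fun w => (g w)%:E)
  (fun=> M%:E) _ _ _ _ _.
move=> H; apply: fine_cvg; rewrite -/(Ex P g) -ExE//; apply: H.
- by move=> n; exact/measurable_EFinP.
- by move=> w _; apply: cvg_EFin; [exact: nearW|exact: hg].
- by [].
- by have := bmeas_integrable P (bmeas_cst M).
- by move=> n w _; rewrite lee_fin.
Qed.

Section lambda.
Context {R : realType} {d} {W : measurableType d} (P : probability W R).
Variables (g1 g2 : W -> R).
Hypotheses (bg1 : bmeas g1) (bg2 : bmeas g2).

(** By dominated convergence the events over which g1 and g2 have the same
   integral form a lambda-system. *)
Lemma pi_lambda_integral (G : set_system W) : setI_closed G -> G setT ->
  G `<=` measurable ->
  (forall A, G A -> Ex P (fun w => \1_A w * g1 w) = Ex P (fun w => \1_A w * g2 w)) ->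
  forall A, <<s G >> A -> Ex P (fun w => \1_A w * g1 w) = Ex P (fun w => \1_A w * g2 w).
Proof.
move=> GI GT Gm Gg A sA.
pose L := [set B | measurable B /\
  Ex P (fun w => \1_B w * g1 w) = Ex P (fun w => \1_B w * g2 w)].
suff : <<s G >> `<=` L by move=> /(_ _ sA)[].
have bB (g : W -> R) (B : set W) : bmeas g -> measurable B -> bmeas (fun w => \1_B w * g w : R).
  by move=> bg mB; apply: bmeasM => //; exact: bmeas_indic.
apply: lambda_system_subset => //; last by move=> B GB; split; [exact: Gm|exact: Gg].
split => //.
- by split => //; exact: Gg.
- move=> B C CB [mB eB] [mC eC]; split; first exact: measurableD.
  have E (g : W -> R) : bmeas g -> Ex P (fun w => \1_(B `\` C) w * g w) =
      Ex P (fun w => \1_B w * g w) - Ex P (fun w => \1_C w * g w).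
    move=> bg; rewrite -ExB; [|exact: bB..]; congr Ex; apply/funext => w.
    rewrite -mulrBl; congr (_ * _); rewrite !indicE in_setD.
    case: (boolP (w \in C)) => [/set_mem/CB/mem_set ->|_]; first by rewrite subrr.
    by rewrite andbT subr0.
  by rewrite !E// eB eC.
- move=> B ndB LB; have mB n : measurable (B n) by have [] := LB n.
  split; first exact: bigcupT_measurable.
  have cE (g : W -> R) : bmeas g -> Ex P (fun w => \1_(B n) w * g w) @[n --> \oo] -->
      Ex P (fun w => \1_(\bigcup_n B n) w * g w).
    move=> bg; have [mg [M gM]] := bg.
    apply: (Ex_dominated (M := M)).
    + by move=> n; have [] := bB g _ bg (mB n).
    + by apply: bB => //; exact: bigcupT_measurable.
    + move=> n w; rewrite normrM (le_trans _ (gM w))// ler_piMl//.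
      by rewrite indicE ger0_norm ?ler0n// lern1 leq_b1.
    + move=> w; apply: cvgM; last exact: cvg_cst.
      apply: cvg_near_cst; have [[n _ Bnw]|nB] := pselect ((\bigcup_n B n) w).
        exists n => // k /= nk; rewrite !indicE !mem_set//; first by exists n.
        by have /subsetPset := ndB _ _ nk; exact.
      apply: nearW => k; rewrite !indicE !memNset// => Bk; apply: nB; by exists k.
  apply: (cvg_unique (@Rhausdorff R) (cE g1 bg1)).
  rewrite (_ : (fun n => _) = (fun n => Ex P (fun w => \1_(B n) w * g2 w))); first exact: cE.
  by apply/funext => n; have [] := LB n.
Qed.

End lambda.

(** * Spaces of probability measures are compact *)

Section layer_cake.
Variable R : realType.

(** The sum counts the integers in [1, n] that do not exceed y. *)
Lemma layer_cake_nat n (y : R) : 0 <= y ->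
  \sum_(k < n) (k.+1%:R <= y)%R%:R <= y /\
  (y <= n%:R -> y <= 1 + \sum_(k < n) (k.+1%:R <= y)%R%:R).
Proof.
elim: n y => [|n ih] y y0.
  by rewrite big_ord0 addr0; split=> // /le_trans; apply.
have [y1|y1] := lerP 1 y; last first.
  rewrite big1; last first.
    by move=> k _; rewrite leNgt (lt_le_trans y1)// ler1n.
  by rewrite addr0; split => // _; exact: ltW.
have [|h1 h2] := ih (y - 1); first by rewrite subr_ge0.
have E : \sum_(k < n.+1) (k.+1%:R <= y)%R%:R =
    1 + \sum_(k < n) (k.+1%:R <= y - 1)%R%:R :> R.
  rewrite big_ord_recl y1; congr (_ + _); apply: eq_bigr => k _.
  by rewrite lerBrDr natr1.
rewrite E; split=> [|yn]; first by rewrite addrC -lerBrDr.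
by rewrite -lerBlDl h2// lerBlDr natr1.
Qed.

(** For g with values in [0, 1] this compares g with a combination of the
   indicators of the closed sets where g >= k/(n+1), up to the mesh 1/(n+1). *)
Lemma layer_cake n (y : R) : 0 <= y <= 1 ->
  n.+1%:R^-1 * \sum_(k < n.+1) (k.+1%:R / n.+1%:R <= y)%R%:R <= y /\
  y <= n.+1%:R^-1 + n.+1%:R^-1 * \sum_(k < n.+1) (k.+1%:R / n.+1%:R <= y)%R%:R.
Proof.
move=> /andP[y0 y1].
have n0 : (0 : R) < n.+1%:R by rewrite ltr0n.
have [|h1 h2] := layer_cake_nat n.+1 (y := n.+1%:R * y); first by rewrite mulr_ge0.
have -> : \sum_(k < n.+1) (k.+1%:R / n.+1%:R <= y)%R%:R =
    \sum_(k < n.+1) (k.+1%:R <= n.+1%:R * y)%R%:R :> R.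
  by apply: eq_bigr => k _; rewrite ler_pdivrMr// mulrC.
rewrite -[X in _ + X]/(_ * _) -[X in X + _]mulr1 -mulrDr.
rewrite ler_pdivrMl// ler_pdivlMl//; split => //.
by apply: h2; rewrite ler_piMr// ltW.
Qed.

End layer_cake.

Section topology.

Lemma initial_cvgP (W : choiceType) (V : topologicalType) (f : W -> V)
    (F : set_system W) (w : W) : Filter F ->
  (F --> (w : initial_topology f)) <-> (f x @[x --> F] --> f w).
Proof.
move=> FF; split=> [Fw|Fw A].
  by apply: cvg_trans (@initial_continuous W V f w); exact: cvg_app.
rewrite /= nbhsE => -[B [[C oC <-] Cfw] BA].
suff FC : F (f @^-1` C) by exact: filterS FC.
by move: Fw => /(_ C); apply; exact: open_nbhs_nbhs.
Qed.

Lemma ptws_cvgP (I : Type) (V : topologicalType) (F : set_system {ptws I -> V})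
    (f : {ptws I -> V}) : Filter F ->
  F --> f <-> forall i, g i @[g --> F] --> f i.
Proof.
move=> FF; rewrite (cvg_sup _ f FF).
by split=> h i; have := h i; rewrite initial_cvgP.
Qed.

End topology.

Lemma pairl_continuous {S S' : topologicalType} (y : S') : continuous (pair^~ y : S -> S * S').
Proof.
move=> x A [[U V] /= [xU yV] UV]; apply: filterS xU => z Uz; apply: UV.
by split => //; exact: nbhs_singleton.
Qed.

Lemma pairr_continuous {S S' : topologicalType} (x : S) : continuous (pair x : S' -> S * S').
Proof.
move=> y A [[U V] /= [xU yV] UV]; apply: filterS yV => z Vz; apply: UV.
by split => //; exact: nbhs_singleton.
Qed.

(** The filter replaces a convergent subsequence: it is generated by the tails
   and by the preimages of the neighbourhoods of p. *)
Lemma cluster_filter {T : topologicalType} (x : nat -> T) (p : T) :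
  cluster (x @ \oo) p ->
  exists V : set_system nat, [/\ ProperFilter V, \oo `<=` V & x n @[n --> V] --> p].
Proof.
move=> clp.
pose V := filter_from [set C : set T * set nat | nbhs p C.1 /\ \oo C.2]
  (fun C => x @^-1` C.1 `&` C.2).
exists V; split.
- apply: filter_from_proper; last first.
    move=> [W B] /= [pW B_oo].
    have xB : (x @ \oo) (x @` B) by apply: filterS B_oo => n Bn; exists n.
    by have [_ [[n Bn <-] Wn]] := clp _ _ xB pW; exists n.
  apply: filter_from_filter; first by exists (setT, setT); split; exact: filterT.
  move=> [W1 B1] [W2 B2] /= [pW1 oB1] [pW2 oB2].
  exists (W1 `&` W2, B1 `&` B2); first by split; exact: filterI.
  by move=> n /= [[? ?] [? ?]].
- move=> B oB; exists (setT, B) => /=; first by split => //; exact: filterT.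
  by move=> n [].
- move=> W pW; exists (W, setT) => /=; first by split => //; exact: filterT.
  by move=> n [].
Qed.

Section borel_measurability.
Context {R : realType} {S : ptopologicalType}.

Lemma continuous_borel (g : S -> R) : continuous g ->
  measurable_fun setT (g : borel S -> R).
Proof.
move=> cg; apply: (measurability _ (RGenOpens.measurableE R)) => _ [_ [a [b ->]] <-].
by rewrite setTI; apply: sub_sigma_algebra; move/continuousP : cg; apply; exact: interval_open.
Qed.

Lemma closed_borel (K : set S) : closed K -> measurable (K : set (borel S)).
Proof.
move=> cK; rewrite -[K]setCK; apply: measurableC.
by apply: sub_sigma_algebra; exact: closed_openC.
Qed.

Lemma continuous_bounded (g : S -> R) : compact [set: S] -> continuous g ->
  exists M, forall s, `|g s| <= M.
Proof.
move=> cS cg.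
have [M [_ MP]] : bounded_set (g @` setT).
  apply: compact_bounded; apply: continuous_compact => //.
  exact: continuous_subspaceT.
exists (M + 1) => s; apply: MP; first by rewrite ltrDl.
by exists s.
Qed.

Lemma continuous_bmeas (g : S -> R) : compact [set: S] -> continuous g ->
  bmeas (g : borel S -> R).
Proof.
move=> cS cg; split; first exact: continuous_borel.
exact: continuous_bounded.
Qed.

Lemma prob_cvgP (F : set_system (prob R S)) (mu : prob R S) : Filter F ->
  (forall g : S -> R, continuous g -> (exists M, forall s, `|g s| <= M) ->
    Ex rho (g : borel S -> R) @[rho --> F] --> Ex mu (g : borel S -> R)) ->
  F --> mu.
Proof.
by move=> FF h; apply/initial_cvgP/ptws_cvgP => -[g [cg bg]]; exact: (h g cg bg).
Qed.

Lemma cvg_prob (F : set_system (prob R S)) (mu : prob R S) (g : S -> R) : Filter F ->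
  continuous g -> (exists M, forall s, `|g s| <= M) -> F --> mu ->
  Ex rho (g : borel S -> R) @[rho --> F] --> Ex mu (g : borel S -> R).
Proof.
move=> FF cg bg.
move/initial_cvgP/ptws_cvgP => /(_ (exist _ g (conj cg bg))).
exact.
Qed.

End borel_measurability.

(** The image ultrafilter lives on a compact interval. *)
Lemma ultra_cvg_bounded {R : realType} {T : Type} (U : set_system T)
    (h : T -> R) (M : R) : UltraFilter U -> (forall x, `|h x| <= M) ->
  cvg (h x @[x --> U]).
Proof.
move=> UU hM.
have UF : ProperFilter U := @ultra_proper _ U UU.
have UhU : UltraFilter (h @ U).
  apply: Build_UltraFilter => G PG hUG; rewrite eqEsubset; split => // A GA.
  have [//|UnA] := in_ultra_setVsetC (h @^-1` A) UU.
  have : G set0 by rewrite -(setICr A); apply: filterI => //; exact: hUG.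
  by move/(@filter_not_empty _ _ PG).
have hU : (h @ U) `[- M, M]%classic.
  change (U (h @^-1` `[- M, M]%classic)); apply: filterS (@filterT _ U _) => x _; rewrite /= in_itv/= -ler_norml; exact: hM.
have := @segment_compact R (- M) M; rewrite compact_ultra => /(_ _ UhU hU).
by move=> [l [_ hl]]; apply/cvg_ex; exists l.
Qed.

Section prob_compact.
Context {R : realType} {S : ptopologicalType}.
Hypotheses (hS : hausdorff_space S) (cS : compact [set: S]).

Section ultralimit.
Variable U : set_system (prob R S).
Context {UU : UltraFilter U}.
Let UF : ProperFilter U := @ultra_proper _ U UU.

Definition pr (A : set S) (rho : prob R S) : R := fine (rho (A : set (borel S))).

Definition ulim (A : set S) : R := lim (pr A @ U).

Let ulim_cvg K : closed K ->
  pr K @ U --> ulim K.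
Proof.
move=> /(closed_borel (S:=S)) mK; apply: (@ultra_cvg_bounded R (prob R S) U (pr K) 1 UU) => rho.
by rewrite /pr ger0_norm ?prob_le1// fine_ge0.
Qed.

(** Finite additivity and monotonicity pass to the limit along U, so that the
   limits on closed sets form a content. *)
Lemma ulim_dominated : exists mu : prob R S, forall K, closed K ->
  ulim K <= fine (mu (K : set (borel S))).
Proof.
have [|||||mu muP] := content_dominated hS cS (lam := ulim).
- apply: (@cvg_unique _ (@Rhausdorff R) _ _ _ _ (ulim_cvg closed0)).
  apply: cvg_near_cst; apply: nearW => rho.
  by rewrite /pr measure0.
- move=> K L cK cL KL; apply: (ler_cvg_to (ulim_cvg cK) (ulim_cvg cL)).
  by apply: nearW => rho; apply: prob_mono => //; exact: closed_borel.
- move=> K L cK cL.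
  apply: (ler_cvg_to (ulim_cvg (closedU cK cL)) (cvgD (ulim_cvg cK) (ulim_cvg cL))).
  have mK := closed_borel cK; have mL := closed_borel cL.
  apply: nearW => rho; rewrite /GRing.add /= /pr -fineD ?fin_num_measure// fine_le ?fin_num_measure//.
  - exact: measurableU.
  - by rewrite fin_numD !fin_num_measure.
  - exact: measureU2.
- move=> K L cK cL KL.
  apply: (ler_cvg_to (cvgD (ulim_cvg cK) (ulim_cvg cL)) (ulim_cvg (closedU cK cL))).
  have mK := closed_borel cK; have mL := closed_borel cL.
  by apply: nearW => rho /=; rewrite /pr measureU// fineD ?fin_num_measure.
- apply: (@cvg_unique _ (@Rhausdorff R) _ _ _ _ (ulim_cvg closedT)).
  apply: cvg_near_cst; apply: nearW => rho.
  by rewrite /pr probability_setT.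
exists mu => K cK; rewrite -lee_fin fineK ?muP// fin_num_measure//.
exact: closed_borel.
Qed.

Let upper_set (g : S -> R) (c : R) := [set s | c <= g s].

Let closed_upper g c : continuous g -> closed (upper_set g c).
Proof.
move=> cg; rewrite (_ : upper_set g c = g @^-1` [set x | c <= x])//.
by apply: closed_comp; [move=> x _; exact: cg|exact: closed_ge].
Qed.

(** Domination on closed sets gives domination of integrals by slicing the
   graph of the integrand into horizontal layers. *)
Let ulim_le01 (mu : prob R S) (g : S -> R) (l : R) :
  (forall K, closed K -> ulim K <= fine (mu (K : set (borel S)))) ->
  continuous g -> (forall s, 0 <= g s <= 1) ->
  Ex rho (g : borel S -> R) @[rho --> U] --> l ->
  l <= Ex mu (g : borel S -> R).
Proof.
move=> dom cg g01 gl.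
pose A n k := upper_set g (k.+1%:R / n.+1%:R).
have cA n k : closed (A n k) by exact: closed_upper.
have mA n k : measurable (A n k : set (borel S)) by exact: closed_borel.
have bg : bmeas (g : borel S -> R) by exact: continuous_bmeas.
pose s n (s : borel S) : R := n.+1%:R^-1 * \sum_(k < n.+1) \1_(A n k) s.
have sE n x : s n x = n.+1%:R^-1 * \sum_(k < n.+1) (k.+1%:R / n.+1%:R <= g x)%R%:R.
  rewrite /s; congr (_ * _); apply: eq_bigr => k _; rewrite indicE.
  congr (nat_of_bool _)%:R; apply/idP/idP => [/set_mem//|lex]; exact/mem_set.
have bi n k : bmeas (\1_(A n k) : borel S -> R) by exact: bmeas_indic.
have bsum n : bmeas (fun x : borel S => \sum_(k < n.+1) \1_(A n k) x : R).
  exact: bmeas_sum.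
have bs n : bmeas (s n) by apply: bmeasM => //; exact: bmeas_cst.
have Exs n (rho : prob R S) :
    Ex rho (s n) = n.+1%:R^-1 * \sum_(k < n.+1) fine (rho (A n k)).
  rewrite ExZl// Ex_sum//; congr (_ * _); apply: eq_bigr => k _.
  by rewrite Ex_indic.
have H n : l <= n.+1%:R^-1 + Ex mu (g : borel S -> R).
  have c1 : n.+1%:R^-1 + n.+1%:R^-1 * \sum_(k < n.+1) pr (A n k) rho
      @[rho --> U] --> n.+1%:R^-1 + n.+1%:R^-1 * \sum_(k < n.+1) ulim (A n k).
    apply: cvgD; first exact: cvg_cst.
    apply: cvgM; first exact: cvg_cst.
    by apply: cvg_big => [|k _]; [exact: add_continuous|exact: ulim_cvg].
  apply: (@le_trans _ _ (n.+1%:R^-1 + n.+1%:R^-1 * \sum_(k < n.+1) ulim (A n k))).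
    apply: (ler_cvg_to gl c1); apply: nearW => rho.
    rewrite -Exs -[X in X + _](Ex_cst rho) -ExD//; last exact: bmeas_cst.
    apply: le_Ex => //; first by apply: bmeasD => //; exact: bmeas_cst.
    by move=> x; rewrite sE; have [] := layer_cake n (g01 x).
  apply: lerD => //; apply: (@le_trans _ _ (Ex mu (s n))).
    by rewrite Exs ler_wpM2l// ler_sum// => k _; exact: dom.
  apply: le_Ex => // x; rewrite sE; by have [] := layer_cake n (g01 x).
apply/ler_addgt0Pl => e e0.
have [n ne] : exists n, n.+1%:R^-1 < e.
  exists (Num.bound e^-1); rewrite invf_plt ?posrE//.
  by rewrite (lt_trans (archi_boundP _)) ?invr_ge0 ?ltr_nat// ltW.
by rewrite (le_trans (H n))// lerD2r ltW.
Qed.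

(** A dominating measure of the same mass cannot be strictly larger: the
   inequality of integrals holds for g and for - g. *)
Lemma ultra_prob_cvg : exists mu : prob R S, U --> mu.
Proof.
have [mu dom] := ulim_dominated; exists mu; apply: prob_cvgP => g cg [M gM].
have M0 : 0 <= M by rewrite (le_trans _ (gM point)).
have bg : bmeas (g : borel S -> R) by exact: continuous_bmeas.
have gM' s : - M <= g s <= M by rewrite -ler_norml.
have c0 : 0 < 2 * M + 1 by rewrite ltr_wpDl// mulr_ge0.
have Exle (rho : prob R S) : `|Ex rho (g : borel S -> R)| <= M.
  rewrite (le_trans (Ex_norm rho bg))// -[leRHS](Ex_cst rho).
  by apply: le_Ex => //; [exact: bmeas_norm|exact: bmeas_cst].
have /cvg_ex[l gl] := ultra_cvg_bounded UU Exle.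
have affine (s : R) (rho : prob R S) :
    Ex rho ((fun x => (2 * M + 1)^-1 * (M + s * g x)) : borel S -> R) =
    (2 * M + 1)^-1 * (M + s * Ex rho (g : borel S -> R)).
  have bsg : bmeas ((fun x => s * g x) : borel S -> R).
    by apply: bmeasM => //; exact: bmeas_cst.
  rewrite ExZl ?ExD ?ExZl ?Ex_cst//; first exact: bmeas_cst.
  by apply: bmeasD => //; exact: bmeas_cst.
have main (s : R) : (forall x, - M <= s * g x <= M) ->
    s * l <= s * Ex mu (g : borel S -> R).
  move=> sM.
  (* The rescaling (M + s g) / (2 M + 1) takes its values in [0, 1]. *)
  have : (2 * M + 1)^-1 * (M + s * l) <=
      Ex mu ((fun x => (2 * M + 1)^-1 * (M + s * g x)) : borel S -> R).
    apply: ulim_le01 => //.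
    - move=> x; apply: cvgM; first exact: cvg_cst.
      apply: cvgD; first exact: cvg_cst.
      by apply: cvgM; [exact: cvg_cst|exact: cg].
    - move=> x; have /andP[s1 s2] := sM x.
      rewrite mulr_ge0 ?invr_ge0 ?(ltW c0)//=; last by rewrite -lerBlDl sub0r.
      rewrite ler_pdivrMl// mulr1 mulr2n mulrDl mul1r -addrA lerD2l.
      by rewrite (le_trans s2)// lerDl.
    - under eq_fun do rewrite affine.
      apply: cvgM; first exact: cvg_cst.
      apply: cvgD; first exact: cvg_cst.
      by apply: cvgM => //; exact: cvg_cst.
  by rewrite affine ler_pM2l ?invr_gt0// lerD2l.
suff -> : Ex mu (g : borel S -> R) = l by [].
apply/eqP; rewrite eq_le; apply/andP; split.
  have := main (-1); rewrite !mulN1r lerN2; apply => x.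
  by rewrite mulN1r lerN2 lerNl andbC.
by have := main 1; rewrite !mul1r; apply => x; rewrite mul1r.
Qed.

End ultralimit.

(** Compactness of the space of probability measures: along an ultrafilter the
   measures converge setwise to a content, whose regularization has the same
   integrals of continuous functions. *)
Theorem prob_compact : compact [set: prob R S].
Proof.
rewrite compact_ultra => U UU _; have [mu Umu] := @ultra_prob_cvg U UU.
by exists mu.
Qed.

End prob_compact.

(** * Topologies given by a pseudometric *)

(** The spaces at hand carry weak and product topologies; a pseudometric is kept
   apart from them, as a function inducing the topology. *)
Definition metrizes {R : realType} (S : topologicalType) (D : S -> S -> R) :=
  [/\ forall p, D p p = 0, forall p q, D p q = D q p,
      forall p q r, D p r <= D p q + D q r &
      forall p A, nbhs p A <-> exists2 e, 0 < e & [set q | D p q < e] `<=` A].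

(** The converse inclusion of neighbourhoods is the convergence to p of the
   filter generated by the balls of center p. *)
Lemma metrizesP {R : realType} (S : topologicalType) (D : S -> S -> R) :
  (forall p, D p p = 0) -> (forall p q, D p q = D q p) ->
  (forall p q r, D p r <= D p q + D q r) ->
  (forall p, D p q @[q --> p] --> 0) ->
  (forall p (F : set_system S), Filter F -> D p q @[q --> F] --> 0 -> F --> p) ->
  metrizes D.
Proof.
move=> D0 Dsym Dtri Dcvg cvgD; split=> // p A.
have D_ge0 q : 0 <= D p q.
  by have := Dtri p q p; rewrite D0 (Dsym q) -mulr2n pmulrn_lge0.
split=> [pA|[e e0 eA]]; last first.
  have := Dcvg p; move=> /(@cvgrPdist_lt _ R^o) /(_ e e0); apply: filterS => q.
  by rewrite sub0r normrN ger0_norm//; exact: eA.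
pose F := filter_from [set e : R | 0 < e] (fun e => [set q | D p q < e]).
have FF : Filter F.
  apply: filter_from_filter; first by exists 1 => /=.
  move=> i j /= i0 j0; exists (Num.min i j); first by rewrite /= lt_min i0.
  by move=> q /=; rewrite lt_min => /andP[].
have Fp : F --> p.
  apply: cvgD; apply/(@cvgrPdist_lt _ R^o) => e e0; exists e => //= q /=.
  by rewrite sub0r normrN ger0_norm.
by have [e e0 eA] := Fp _ pA; exists e.
Qed.

Section metrizes.
Context {R : realType} {S : ptopologicalType} {D : S -> S -> R}.
Hypothesis mD : metrizes D.

Let D0 p : D p p = 0. Proof. by case: mD. Qed.
Let Dsym p q : D p q = D q p. Proof. by case: mD. Qed.
Let Dtri p q r : D p r <= D p q + D q r. Proof. by case: mD. Qed.

Lemma metrizes_nbhs p (A : set S) :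
  nbhs p A <-> exists2 e, 0 < e & [set q | D p q < e] `<=` A.
Proof. by case: mD. Qed.

Lemma metrizes_ge0 p q : 0 <= D p q.
Proof. by have := Dtri p q p; rewrite D0 (Dsym q) -mulr2n pmulrn_lge0. Qed.

Lemma metrizes_ball p e : 0 < e -> nbhs p [set q | D p q < e].
Proof. by move=> e0; apply/metrizes_nbhs; exists e. Qed.

Lemma metrizes_continuousP (g : S -> R) :
  (forall p e, 0 < e -> exists2 d, 0 < d & forall q, D p q < d -> `|g p - g q| < e) ->
  continuous g.
Proof.
move=> gP p; apply/(@cvgrPdist_lt _ R^o) => e e0; have [d d0 dP] := gP p e e0.
by apply: filterS (metrizes_ball p d0) => q; exact: dP.
Qed.

Lemma lipschitz_continuous (g : S -> R) :
  (forall p q, g p <= D p q + g q) -> continuous g.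
Proof.
move=> gD; apply: metrizes_continuousP => p e e0; exists e => // q Dpq.
rewrite ltr_norml; apply/andP; split.
  by rewrite ltrBrDl ltrBlDr (le_lt_trans (gD q p))// Dsym addrC ltrD2l.
by rewrite ltrBlDr (le_lt_trans (gD p q))// ltrD2r.
Qed.

Lemma metrizes_continuous p : continuous (D p).
Proof. by apply: lipschitz_continuous => q r; rewrite addrC (Dsym q). Qed.

Lemma open_metrizes_ball p e : open [set q | D p q < e].
Proof.
rewrite (_ : [set q | _] = D p @^-1` [set x | x < e])//.
by apply: open_comp; [move=> q _; exact: metrizes_continuous|exact: open_lt].
Qed.

Lemma metrizes_hausdorff : (forall p q, D p q = 0 -> p = q) -> hausdorff_space S.
Proof.
move=> D_eq p q clpq; apply: D_eq; apply/eqP; rewrite eq_le metrizes_ge0 andbT.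
apply/ler_addgt0Pl => e e0; rewrite addr0.
have e20 : 0 < e / 2 by rewrite divr_gt0.
have [r [pr qr]] := clpq _ _ (metrizes_ball p e20) (metrizes_ball q e20).
rewrite (le_trans (Dtri p r q))// [leRHS]splitr; apply: lerD; first exact: ltW.
by rewrite Dsym ltW.
Qed.

Hypothesis cS : compact [set: S].

Lemma compact_unif_continuous (g : S -> R) (e : R) : continuous g -> 0 < e ->
  exists2 d, 0 < d & forall p q, D p q < d -> `|g p - g q| < e.
Proof.
move=> cg e0; have e20 : 0 < e / 2 by rewrite divr_gt0.
move: cS => /compact_near_coveringP/(_ R 0^'+
  (fun d p => forall q, D p q < d -> `|g p - g q| < e) _) [].
  move=> p _; have /metrizes_nbhs[d d0 dP] :
      nbhs p [set q | `|g p - g q| < e / 2].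
    by have /(@cvgrPdist_lt _ R^o)/(_ _ e20) := cg p.
  have d20 : 0 < d / 2 by rewrite divr_gt0.
  exists ([set q | D p q < d / 2], [set c | c < d / 2]) => /=.
    by split; [exact: metrizes_ball|exact: nbhs_right_lt].
  move=> [q c] /= [Dpq cd] s Dqs.
  rewrite -(subrK (g p) (g q)) -addrA (le_lt_trans (ler_normD _ _))//.
  rewrite (splitr e) ltrD//; first by rewrite distrC dP//= (lt_trans Dpq)// ltr_pdivrMr// ltr_pMr// ltr1n.
  apply: dP => /=; rewrite (le_lt_trans (Dtri p q s))// (splitr d) ltrD//.
  exact: lt_trans cd.
move=> d /= d0 dP; exists (d / 2); first by rewrite divr_gt0.
move=> p q; apply: (dP (d / 2)) => //=; last by rewrite divr_gt0.
by rewrite sub0r normrN gtr0_norm ?divr_gt0// ltr_pdivrMr// ltr_pMr// ltr1n.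
Qed.

Lemma finite_net (e : R) : 0 < e ->
  exists s : seq S, forall p, exists2 c, c \in s & D c p < e.
Proof.
move=> e0; move: cS; rewrite compact_cover => /(_ S setT
  (fun c => [set q | D c q < e]) (fun c _ => open_metrizes_ball c e)) [].
  by move=> p _; exists p => //=; rewrite D0.
move=> s _ sP; exists (finmap.enum_fset s) => p; have [c /= cs Dcp] := sP p I.
by exists c.
Qed.

(** Nets of radius 1/(n+1) give a countable base of balls, so that a map
   is Borel measurable as soon as its distances to points are measurable. *)
Lemma measurable_metrizes d (T : measurableType d) (Y : T -> S) :
  (forall p, measurable_fun setT (fun w => D p (Y w))) ->
  measurable_fun setT (Y : T -> borel S).
Proof.
move=> mY; apply: (@measurability _ _ T (borel S) setT Y (@open S) erefl) => _ [A oA <-]; rewrite setTI.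
have /choice[s sP] : forall n, exists s : seq S,
    forall p, exists2 c, c \in s & D c p < n.+1%:R^-1.
  by move=> n; exact: finite_net.
pose B n := \bigcup_(c in [set c | c \in s n /\ [set q | D c q < n.+1%:R^-1] `<=` A])
  [set q | D c q < n.+1%:R^-1].
rewrite (_ : A = \bigcup_n B n); last first.
  rewrite eqEsubset; split => [p Ap|p [n _ [c [_ cA]] Dcp]]; last exact: cA.
  have /metrizes_nbhs[e e0 eA] : nbhs p A by exact: open_nbhs_nbhs.
  have [n ne] : exists n, n.+1%:R^-1 < e / 2.
    exists (Num.bound (e / 2)^-1); rewrite invf_plt ?posrE ?divr_gt0//.
    by rewrite (lt_trans (archi_boundP _)) ?invr_ge0 ?ltr_nat// ltW// divr_gt0.
  have [c cs Dcp] := sP n p; exists n => //; exists c => //; split => // q Dcq.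
  apply: eA => /=; rewrite (le_lt_trans (Dtri p c q))// (splitr e) ltrD//.
    by rewrite Dsym (lt_trans Dcp).
  exact: lt_trans Dcq _.
rewrite preimage_bigcup; apply: bigcupT_measurable => n.
rewrite preimage_bigcup; apply: fin_bigcup_measurable.
  by apply: (@sub_finite_set _ _ [set` s n]) => // c [].
move=> c _; rewrite -[X in measurable X]setTI.
have := mY c measurableT `]-oo, n.+1%:R^-1[%classic (measurable_itv _).
by congr measurable; apply/seteqP; split => w [_]; rewrite /= in_itv.
Qed.

(** The functions are min (1, n * distance to the complement of A). *)
Lemma open_approx (A : set S) : open A -> exists h : nat -> S -> R,
  [/\ forall n, continuous (h n), forall n p, 0 <= h n p <= 1 &
      forall p, h n p @[n --> \oo] --> (\1_A p : R)].
Proof.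
move=> oA; have [nA|/set0P[c nAc]] := eqVneq (~` A) set0.
  exists (fun _ _ => 1); split=> [n p|n p|p]; first exact: cvg_cst.
    by rewrite ler01 lexx.
  rewrite indicE mem_set; first exact: cvg_cst.
  by apply: contrapT => nAp; have : (~` A) p by []; rewrite nA.
pose E p := [set D p q | q in ~` A]; pose f p := inf (E p).
have Elb p : has_lbound (E p) by exists 0 => _ [q _ <-]; exact: metrizes_ge0.
have E0 p : E p !=set0 by exists (D p c), c.
have f_ge0 p : 0 <= f p.
  by apply: lb_le_inf => // _ [q _ <-]; exact: metrizes_ge0.
have fD p q : f p <= D p q + f q.
  rewrite -lerBlDl; apply: lb_le_inf => // _ [r nAr <-]; rewrite lerBlDl.
  by rewrite (le_trans _ (Dtri p q r))//; apply: ge_inf => //; exists r.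
have cf : continuous f by exact: lipschitz_continuous.
have f0 p : ~ A p -> f p = 0.
  move=> nAp; apply/eqP; rewrite eq_le f_ge0 andbT -(D0 p).
  by apply: ge_inf => //; exists p.
have f_gt0 p : A p -> 0 < f p.
  move=> Ap; have /metrizes_nbhs[e e0 eA] : nbhs p A by exact: open_nbhs_nbhs.
  apply: lt_le_trans e0 _; apply: lb_le_inf => // _ [q nAq <-].
  by rewrite leNgt; apply/negP => /eA.
exists (fun n p => Num.min 1 (n%:R * f p)); split=> [n p|n p|p].
- apply: (@continuous_min R S (fun=> 1) (fun p => n%:R * f p)); first exact: cvg_cst.
  by apply: cvgM; [exact: cvg_cst|exact: cf].
- by rewrite le_min ler01 mulr_ge0//= ge_min lexx.
- rewrite indicE; have [Ap|nAp] := pselect (A p); last first.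
    rewrite memNset// f0//; apply: cvg_near_cst; apply: nearW => n.
    by rewrite mulr0; apply/min_idPr; exact: ler01.
  rewrite mem_set//; apply: cvg_near_cst; near=> n.
  apply/min_idPl; rewrite -ler_pdivrMr ?f_gt0// mul1r.
  near: n; exists (Num.bound (f p)^-1) => // n /= le.
  by rewrite ltW// (lt_le_trans (archi_boundP _)) ?invr_ge0// ler_nat.
Unshelve. all: by end_near. Qed.

End metrizes.

(** * Metrics on laws, flows, and their compactness *)

(** The other fields of a probability measure are proofs. *)
Lemma eq_probability {R : realType} d (T : measurableType d)
    (P Q : probability T R) : P = Q :> (set T -> \bar R) -> P = Q.
Proof.
case: P Q => [P [[p1 p2] [p3] [p4] [p5] [p6] [p7] [p8]]].
case=> [Q [[q1 q2] [q3] [q4] [q5] [q6] [q7] [q8]]] /= PQ.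
move: q1 q2 q3 q4 q5 q6 q7 q8; rewrite -{}PQ => q1 q2 q3 q4 q5 q6 q7 q8.
by rewrite (_ : q1 = p1)// (_ : q2 = p2)// (_ : q3 = p3)// (_ : q4 = p4)//
  (_ : q5 = p5)// (_ : q6 = p6)// (_ : q7 = p7)// (_ : q8 = p8).
Qed.

Section disc.
Context (X : pfinType).

Lemma compact_disc : compact [set: disc X].
Proof. by apply: finite_compact; apply: (@sub_finite_set _ _ [set: X]). Qed.

Lemma hausdorff_disc : hausdorff_space (disc X).
Proof. exact: discrete_hausdorff. Qed.

Lemma open_disc (A : set (disc X)) : open A.
Proof. exact: discrete_open. Qed.

Lemma measurable_disc (A : set (borel (disc X))) : measurable A.
Proof. by apply: sub_sigma_algebra; exact: open_disc. Qed.

Lemma continuous_disc (V : topologicalType) (g : disc X -> V) : continuous g.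
Proof. by apply/continuousP => A _; exact: open_disc. Qed.

Lemma nbhs_disc (x : disc X) : nbhs x [set x].
Proof. by apply: open_nbhs_nbhs; split => //; exact: open_disc. Qed.

End disc.
#[global] Hint Resolve measurable_disc : core.

Section laws.
Context {R : realType} {X : pfinType}.
Local Notation PX := (prob R (disc X)).
Implicit Types m : PX.

Definition mass m (x : X) : R := fine (m [set x]).

Lemma Ex_mass m (h : X -> R) :
  Ex m (h : borel (disc X) -> R) = \sum_x h x * mass m x.
Proof. by rewrite -[X in Ex m X]/(h \o idfun) Ex_fin. Qed.

Lemma mass_inj m m' : mass m =1 mass m' -> m = m'.
Proof.
move=> mm'.
have E : m = m' :> (set (borel (disc X)) -> \bar R).
  apply/funext => B.
  have e (m1 : PX) : m1 B = (\sum_x \1_B x * mass m1 x)%:E.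
    rewrite -(Ex_mass m1 (\1_B : X -> R)) Ex_indic// fineK//.
    exact: fin_num_measure.
  by rewrite !e; congr EFin; apply: eq_bigr => x _; rewrite mm'.
exact: eq_probability.
Qed.

Lemma distE m m' : dist m m' = 2^-1 * \sum_x `|mass m x - mass m' x|.
Proof. by []. Qed.

Lemma dist_sym m m' : dist m m' = dist m' m.
Proof. by rewrite !distE; congr (_ * _); apply: eq_bigr => x _; rewrite distrC. Qed.

Lemma distxx m : dist m m = 0.
Proof. by rewrite distE big1 ?mulr0// => x _; rewrite subrr normr0. Qed.

Lemma dist_tri m1 m2 m3 : dist m1 m3 <= dist m1 m2 + dist m2 m3.
Proof.
rewrite !distE -mulrDr ler_wpM2l ?invr_ge0// -big_split/= ler_sum// => x _.
exact: ler_distD.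
Qed.

Lemma mass_dist m m' x : `|mass m x - mass m' x| <= 2 * dist m m'.
Proof.
rewrite distE mulrA divff ?mul1r// (bigD1 x)//= lerDl.
by apply: sumr_ge0.
Qed.

Lemma dist_eq0 m m' : dist m m' = 0 -> m = m'.
Proof.
move=> d0; apply: mass_inj => x; apply/eqP; rewrite -subr_eq0 -normr_le0.
by rewrite (le_trans (mass_dist _ _ _))// d0 mulr0.
Qed.

Lemma cvg_mass (F : set_system PX) m x : Filter F -> F --> m ->
  mass q x @[q --> F] --> mass m x.
Proof.
move=> FF Fm.
have E (q : PX) : mass q x = Ex q (\1_[set x] : borel (disc X) -> R) by rewrite Ex_indic.
under eq_fun do rewrite E; rewrite E; apply: cvg_prob => //.
  exact: continuous_disc.
exists 1 => s; rewrite indicE ger0_norm; [rewrite lern1; exact: leq_b1|exact: ler0n].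
Qed.

Let dist_cvg (F : set_system PX) m : Filter F -> F --> m ->
  dist m q @[q --> F] --> 0.
Proof.
move=> FF Fm.
rewrite -[X in _ --> X](mulr0 2^-1).
under eq_fun do rewrite distE.
apply: cvgM; first exact: cvg_cst.
have sum0 : \sum_(x : X) (0 : R) = 0 by rewrite big1.
rewrite -[X in _ --> X]sum0.
apply: cvg_big => [|x _]; first exact: add_continuous.
have -> : 0 = `|mass m x - mass m x| :> R by rewrite subrr normr0.
by apply: cvg_norm; apply: cvgB; [exact: cvg_cst|exact: cvg_mass].
Qed.

(** On a finite set weak convergence is the convergence of the mass of each
   point. *)
Lemma dist_metrizes : metrizes (@dist R X).
Proof.
apply: metrizesP => [||||m F FF mF].
- exact: distxx.
- exact: dist_sym.
- exact: dist_tri.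
- by move=> m; exact: (dist_cvg (nbhs_filter m) (@cvg_id _ _)).
- apply: prob_cvgP => g _ _; rewrite Ex_mass.
  under eq_fun do rewrite Ex_mass.
  apply: cvg_big => [|x _]; first exact: add_continuous.
  apply: cvgM; first exact: cvg_cst.
  apply/(@cvgrPdist_lt _ R^o) => e e0.
  have e20 : 0 < e / 2 by rewrite divr_gt0.
  move: mF => /(@cvgrPdist_lt _ R^o)/(_ _ e20); apply: filterS => q.
  rewrite sub0r normrN => le; rewrite (le_lt_trans (mass_dist _ _ _))//.
  by rewrite mulrC -ltr_pdivlMr// (le_lt_trans (ler_norm _)).
Qed.

Lemma dist_ge0 m m' : 0 <= dist m m'.
Proof. exact: (metrizes_ge0 dist_metrizes). Qed.

Lemma compact_laws : compact [set: PX].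
Proof. by apply: prob_compact; [exact: hausdorff_disc|exact: compact_disc]. Qed.

Lemma mass_continuous x : continuous (fun m : PX => mass m x).
Proof. by move=> m; exact: (cvg_mass (nbhs_filter m) (@cvg_id _ _)). Qed.

End laws.

Section powers.
Context {R : realType} {I : finType} {S : ptopologicalType} {D : S -> S -> R}.

Definition tdist (p q : tpow I S) : R := \sum_i D (p i) (q i).

Hypothesis mD : metrizes D.

Lemma tdist_ge i p q : D (p i) (q i) <= tdist p q.
Proof.
rewrite /tdist (bigD1 i)//= lerDl sumr_ge0// => j _; exact: (metrizes_ge0 mD).
Qed.

Lemma proj_tpow_continuous i : continuous (fun p : tpow I S => p i).
Proof. by move=> p; have /ptws_cvgP := @cvg_id _ (nbhs p); exact. Qed.

Lemma tdist_metrizes : metrizes tdist.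
Proof.
have [D0 Dsym Dtri Dn] := mD.
apply: metrizesP => [p|p q|p q r|p|p F FF pF].
- by rewrite /tdist big1.
- by apply: eq_bigr => i _.
- by rewrite -big_split; apply: ler_sum => i _; exact: Dtri.
- have sum0 : \sum_(i : I) (0 : R) = 0 by rewrite big1.
  rewrite -[X in _ --> X]sum0.
  apply: cvg_big => [|i _]; first exact: add_continuous.
  rewrite -[X in _ --> X](D0 (p i)).
  have := @proj_tpow_continuous i p; move/(cvg_comp _ (D (p i))); apply.
  exact: (metrizes_continuous mD).
- apply/ptws_cvgP => i A; rewrite /= => /(metrizes_nbhs mD)[e e0 eA].
  move: pF => /(@cvgrPdist_lt _ R^o)/(_ _ e0); apply: filterS => q.
  rewrite sub0r normrN => le; apply: eA => /=.
  by rewrite (le_lt_trans (tdist_ge i p q))// (le_lt_trans (ler_norm _)).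
Qed.

Lemma compact_tpow : compact [set: S] -> compact [set: tpow I S].
Proof.
move=> cS; have := @tychonoff I (fun=> S) (fun=> setT) (fun=> cS).
by rewrite (_ : [set f | _] = setT)//; apply/seteqP; split.
Qed.

End powers.

Section disc_product.
Context {R : realType} {A : pfinType} {S : ptopologicalType} {D : S -> S -> R}.

Definition pdist (p q : disc A * S) : R := (p.1 != q.1)%:R + D p.2 q.2.

Hypothesis mD : metrizes D.

Lemma pdist_metrizes : metrizes pdist.
Proof.
have [D0 Dsym Dtri Dn] := mD.
apply: metrizesP => [p|p q|p q r|p|p F FF pF].
- by rewrite /pdist eqxx D0 addr0.
- by rewrite /pdist eq_sym Dsym.
- rewrite /pdist addrACA lerD// -natrD ler_nat.
  by have [->|] := eqVneq p.1 q.1; rewrite ?add0n//= => _; case: (_ != _).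
- rewrite -[X in _ --> X]addr0; apply: cvgD.
    apply: cvg_near_cst.
    have : nbhs p [set q : disc A * S | q.1 = p.1].
      exists ([set p.1], setT) => /=; first by split; [exact: nbhs_disc|exact: filterT].
      by move=> q [].
    by apply: filterS => q /= ->; rewrite eqxx.
  rewrite -[X in _ --> X](D0 p.2).
  have p2 : (q.2 : S) @[q --> p] --> p.2.
    move=> B Bp; exists (setT, B) => /=; first by split => //; exact: filterT.
    by move=> q [].
  by apply: (cvg_comp _ (D p.2) p2); exact: (metrizes_continuous mD).
- have small e : 0 < e -> F [set q | pdist p q < e].
    move=> e0; move: pF => /(@cvgrPdist_lt _ R^o)/(_ _ e0); apply: (@filterS _ F FF) => q.
    by rewrite sub0r normrN; apply: le_lt_trans; exact: ler_norm.
  have D_ge0 := metrizes_ge0 mD.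
  move=> B [[B1 B2] /= [/nbhs_singleton pB1 /(metrizes_nbhs mD)[e e0 eB2]] B12].
  have c0 : 0 < Num.min e 1 by rewrite lt_min e0 ltr01.
  apply: (@filterS _ F FF) (small _ c0) => q /=; rewrite lt_min /pdist.
  have [pq|_] := eqVneq p.1 q.1; last by rewrite [X in _ && X]ltNge lerDl D_ge0 andbF.
  rewrite add0r => /andP[qe _]; apply: B12; split => /=; first by rewrite -pq.
  exact: eB2.
Qed.

Lemma compact_disc_prod : compact [set: S] -> compact [set: disc A * S].
Proof. by move=> cS; rewrite -setXTT; apply: compact_setX => //; exact: compact_disc. Qed.

End disc_product.

Section flows.
Context (R : realType) (T : nat) (X Gamma : pfinType).
Local Notation PX := (prob R (disc X)).
Local Notation flow := (flow R T X Gamma).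

Definition fdist : flow -> flow -> R := pdist (D := tdist (D := @dist R X)).

Lemma fdist_metrizes : metrizes fdist.
Proof. by apply: pdist_metrizes; apply: tdist_metrizes; exact: dist_metrizes. Qed.

Lemma compact_flow : compact [set: flow].
Proof. by apply: compact_disc_prod; apply: compact_tpow; exact: compact_laws. Qed.

Lemma hausdorff_flow : hausdorff_space flow.
Proof.
apply: (metrizes_hausdorff fdist_metrizes) => -[a m] [a' m'].
rewrite /fdist /pdist /= => /eqP; rewrite paddr_eq0 ?ler0n//; last first.
  by apply: sumr_ge0 => t _; exact: dist_ge0.
rewrite pnatr_eq0 eqb0 negbK => /andP[/eqP -> /eqP d0]; congr pair.
apply/funext => t; apply: dist_eq0; apply/eqP; rewrite eq_le dist_ge0 andbT -d0.
exact: (tdist_ge dist_metrizes).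
Qed.

Lemma fdist_eq1 (p q : flow) : fdist p q < 1 -> p.1 = q.1.
Proof.
rewrite /fdist /pdist; have [//|_] := eqVneq p.1 q.1; rewrite ltNge lerDl.
by rewrite sumr_ge0// => t _; exact: dist_ge0.
Qed.

Lemma dist_fdist t (p q : flow) : dist (p.2 t) (q.2 t) <= fdist p q.
Proof.
rewrite (le_trans (tdist_ge dist_metrizes t p.2 q.2))// /fdist /pdist lerDr.
exact: ler0n.
Qed.

(** The strategies being discrete, continuity in the marginal is all that
   matters; this covers the costs and the kernels of the mean field dynamics. *)
Lemma flow_marginal_continuous t (k : strategy T X Gamma -> PX -> R) :
  (forall a, continuous (k a)) ->
  continuous (fun v : flow => k v.1 (v.2 t)).
Proof.
move=> ck p; apply/(@cvgrPdist_lt _ R^o) => e e0.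
have /(metrizes_nbhs dist_metrizes)[d d0 dP] :
    nbhs (p.2 t) [set m | `|k p.1 (p.2 t) - k p.1 m| < e].
  by have /(@cvgrPdist_lt _ R^o)/(_ _ e0) := ck p.1 (p.2 t).
have c0 : 0 < Num.min d 1 by rewrite lt_min d0 ltr01.
apply: filterS (metrizes_ball fdist_metrizes p c0) => q /=; rewrite lt_min.
move=> /andP[pq /fdist_eq1 <-]; apply: dP => /=.
by rewrite (le_lt_trans (dist_fdist _ _ _)).
Qed.

End flows.

(** * Independence *)

Section independent_family.
Context {R : realType} {d} {T : measurableType d} (P : probability T R).
Context (J : finType) (G : J -> set_system T).

Definition indep_family := forall A : J -> set T, (forall i, G i (A i)) ->
  P (\bigcap_(i in setT) A i) = (\prod_i P (A i))%E.

Hypothesis Gm : forall i, G i `<=` measurable.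
Hypothesis GI : forall i, setI_closed (G i).
Hypothesis GT : forall i, G i setT.
Hypothesis Gind : indep_family.

Definition gen (M : pred J) : set_system T := <<s \bigcup_(i in [set i | M i]) G i >>.

(** For B fixed, both sides are finite measures in A, and they agree on the
   pi-system of rectangles of members in M. *)
Lemma indep_split (M : pred J) (A : set T) (B : J -> set T) :
  gen M A -> (forall i, G i (B i)) ->
  P (A `&` \bigcap_(i in [set i | ~~ M i]) B i) =
    (P A * \prod_(i | ~~ M i) P (B i))%E.
Proof.
move=> MA GB.
pose C := \bigcap_(i in [set i | ~~ M i]) B i.
have mC : measurable C.
  by apply: fin_bigcap_measurable => // i _; exact: Gm (GB i).
pose c := fine (\prod_(i | ~~ M i) P (B i))%E.
have cE : c%:E = (\prod_(i | ~~ M i) P (B i))%E.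
  rewrite fineK//; elim/big_ind: _ => //= [x y|i _]; first exact: fin_numM.
  by rewrite fin_num_measure//; exact: Gm (GB i).
have c0 : 0 <= c by rewrite fine_ge0// prode_ge0.
pose H := [set D | exists2 E : J -> set T, (forall i, G i (E i)) &
  (forall i, ~~ M i -> E i = setT) /\ D = \bigcap_(i in setT) E i].
have PH E : (forall i, G i (E i)) -> (forall i, ~~ M i -> E i = setT) ->
    P (\bigcap_(i in setT) E i `&` C) = (P (\bigcap_(i in setT) E i) * c%:E)%E.
  move=> GE EM; rewrite cE.
  rewrite (_ : _ `&` C = \bigcap_(i in setT) (if M i then E i else B i)).
    rewrite !Gind//; last by move=> i; case: ifP.
    rewrite (bigID M)/= [in RHS](bigID M)/= [X in (_ * X * _)%E]big1 ?mule1; last first.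
      by move=> i nMi; rewrite EM// probability_setT.
    congr (_ * _)%E; first by apply: eq_bigr => i ->.
    by apply: eq_bigr => i /negbTE ->.
  apply/seteqP; split=> [w [Ew Cw] i _|w EBw].
    by case: ifPn => Mi; [exact: Ew|exact: Cw].
  split=> i.
    by move=> _; have := EBw i I; case: ifPn => // nMi _; rewrite EM.
  by move=> /= nMi; have := EBw i I; rewrite (negbTE nMi).
have HM : <<s setT, [set X | H X /\ X `<=` setT] >> A.
  move: A MA; apply: smallest_sub; first exact: smallest_sigma_algebra.
  move=> A [i /= Mi GA]; apply: sub_sigma_algebra; split => //.
  exists (fun j => if j == i then A else setT).
    by move=> j; case: eqP => // ->.
  split=> [j nMj|]; first by case: eqP => // ji; rewrite ji Mi in nMj.
  apply/seteqP; split=> [w Aw j _|w /(_ i I)]; first by case: eqP.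
  by rewrite eqxx.
suff : mrestr P mC A = mscale (NngNum c0) P A.
  by rewrite /mrestr /mscale /= muleC cE.
apply: (g_sigma_algebra_measure_unique_trace H setT) => //.
- by move=> _ [[E GE [_ ->]] _]; apply: fin_bigcap_measurable => // i _; exact: Gm (GE i).
- move=> _ _ [[E GE [EM ->]] _] [[F GF [FM ->]] _]; split => //.
  exists (fun i => E i `&` F i); first by move=> i; exact: GI.
  by split=> [i nMi|]; [rewrite EM// FM// setTI|rewrite bigcapI].
- have := PH (fun=> setT); rewrite (_ : \bigcap_(i in _) _ = setT).
    move=> PHT; change (P (setT `&` C) = (c%:E * P setT)%E).
    by rewrite PHT// muleC.
  by apply/seteqP; split.
- move=> _ [[E GE [EM ->]] _].
  set X := (\bigcap_(i in _) _); change (P (X `&` C) = (c%:E * P X)%E).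
  by rewrite PH// muleC.
- change (P (setT `&` C) < +oo)%E; rewrite setTI (le_lt_trans (probability_le1 P mC))//.
  exact: ltry.
Qed.

Lemma indep_gen1 (M : pred J) (i : J) (A B : set T) : ~~ M i -> gen M A -> G i B ->
  P (A `&` B) = (P A * P B)%E.
Proof.
move=> nMi MA GB.
have := @indep_split M A (fun j => if j == i then B else setT) MA.
rewrite (bigD1 i)//= eqxx big1 ?mule1; last first.
  by move=> j /andP[_ /negbTE ->]; rewrite probability_setT.
move=> <-; last by move=> j; case: eqP => // ->.
congr (P (_ `&` _)); apply/seteqP; split=> [w Bw j _|w /(_ i nMi)].
  by case: eqP.
by rewrite eqxx.
Qed.

End independent_family.

(** * Integrating out an independent noise *)

Section one_step.
Context {R : realType} {d d1 d2} {T : measurableType d}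
  {T1 : measurableType d1} {T2 : measurableType d2}.
Context (P : probability T R) (nu : probability T2 R) (U : T -> T1) (xi : T -> T2).
Hypotheses (mU : measurable_fun setT U) (mxi : measurable_fun setT xi).
Hypothesis ind : forall A B, measurable A -> measurable B ->
  P (U @^-1` A `&` xi @^-1` B) = (P (U @^-1` A) * nu B)%E.

(** The law of (U, xi) is a product measure, to which Fubini applies. *)
Lemma integrate_noise (h : T1 -> R) (A : set (T1 * T2)) :
  bmeas h -> measurable A ->
  Ex P (fun w => h (U w) * \1_A (U w, xi w)) =
  Ex P (fun w => h (U w) * fine (nu (xsection A (U w)))).
Proof.
move=> bh mA.
pose U' : {mfun T >-> T1} := HB.pack U (isMeasurableFun.Build _ _ _ _ U mU).
pose PU : probability T1 R := distribution P U'.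
have mUxi : measurable_fun setT (fun w => (U w, xi w)) by exact: measurable_fun_pair.
pose W : {mfun T >-> (T1 * T2)%type} :=
  HB.pack (fun w => (U w, xi w)) (isMeasurableFun.Build _ _ _ _ _ mUxi).
pose PW : probability (T1 * T2)%type R := distribution P W.
have PWE X : measurable X -> (PU \x nu)%E X = PW X.
  apply: product_measure_unique => B C mB mC; rewrite /PW /distribution /pushforward /=.
  by rewrite -ind//; congr (P _); apply/seteqP; split.
have bhA : bmeas (fun x : T1 * T2 => h x.1 * \1_A x).
  apply: bmeasM; last exact: bmeas_indic.
  by apply: (bmeas_comp _ bh); exact: measurable_fst.
have bnu : bmeas (fun x : T1 => h x * fine (nu (xsection A x))).
  apply: bmeasM => //; split; last first.
    by exists 1 => x; rewrite ger0_norm ?fine_ge0// prob_le1//; exact: measurable_xsection.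
  by apply: measurableT_comp => //; exact: measurable_fun_xsection.
transitivity (Ex PW (fun x => h x.1 * \1_A x)).
  by rewrite -[LHS]/(Ex P ((fun x => h x.1 * \1_A x) \o W)); apply: Ex_law.
transitivity (Ex PU (fun x => h x * fine (nu (xsection A x)))); last first.
  by rewrite -[RHS]/(Ex P ((fun x => h x * fine (nu (xsection A x))) \o U));
    apply/esym; apply: Ex_law.
rewrite /Ex /Rintegral; congr fine.
rewrite (@eq_measure_integral _ _ _ _ (PU \x nu)%E PW); last by move=> X mX _; exact/esym/PWE.
rewrite -integral12_prod_meas1//=; last first.
  have /integrableP[m1 i1] := bmeas_integrable PW bhA.
  apply/integrableP; split => //.
  by rewrite (@eq_measure_integral _ _ _ _ PW) => // X mX _; exact: PWE.
apply: eq_integral => x _; rewrite /fubini_F /=.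
have mAx : measurable (xsection A x) by exact: measurable_xsection.
rewrite EFinM fineK ?fin_num_measure//.
under eq_integral do rewrite EFinM.
rewrite integralZl//; last first.
  have := @bmeas_integrable _ _ _ nu (\1_(xsection A x)) (bmeas_indic mAx).
  congr (_.-integrable _ _); apply/funext => z /=.
  by rewrite !indicE mem_xsection.
congr (_ * _)%E; rewrite -[xsection A x]setIT -integral_indic ?setIT//.
by apply: eq_integral => z _; rewrite !indicE mem_xsection.
Qed.

End one_step.

(** * Chains driven by an environment and independent noise *)

Section chain.
Context {S : Type} {X : pfinType} {Z : Type} {T : nat}.
Variable step : 'I_T -> S -> X -> Z -> X.

(** Times are natural numbers for the sake of structural recursion; the chain
   stops moving at the horizon T. *)
Fixpoint chain (v : S) (x : X) (z : 'I_T -> Z) (k : nat) : X :=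
  if k is k'.+1 then
    let y := chain v x z k' in
    if insub k' is Some t then step t v y (z t) else y
  else x.

Lemma chainS v x z (t : 'I_T) :
  chain v x z t.+1 = step t v (chain v x z t) (z t).
Proof. by rewrite /= valK. Qed.

End chain.

Section chain_measurable.
Context {d dS dZ} {W : measurableType d} {S : measurableType dS} {X : pfinType}
  {Z : measurableType dZ} {T : nat}.
Variable step : 'I_T -> S -> X -> Z -> X.
Hypothesis mstep : forall t x y,
  measurable [set q : S * Z | step t q.1 x q.2 = y].
Variables (V : W -> S) (X0 : W -> X) (xi : 'I_T -> W -> Z).
Hypothesis mV : measurable_fun setT V.
Hypothesis mX0 : forall y, measurable [set w | X0 w = y].

Lemma measurable_chain k : (forall t : 'I_T, (t < k)%N -> measurable_fun setT (xi t)) ->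
  forall y, measurable [set w | chain step (V w) (X0 w) (xi ^~ w) k = y].
Proof.
elim: k => [_ y|k ih mxi y /=]; first exact: mX0.
have ih' := ih (fun t tk => mxi t (ltnW tk)).
case: insubP => [t _ tk|_]; last exact: ih'.
rewrite (_ : [set w | _] = \bigcup_(x in [set: X])
    ([set w | chain step (V w) (X0 w) (xi ^~ w) k = x] `&`
     ((fun w => (V w, xi t w)) @^-1` [set q | step t q.1 x q.2 = y]))).
  apply: fin_bigcup_measurable => // x _; apply: measurableI => //.
  apply: measurable_preimage (mstep t x y); apply: measurable_fun_pair => //.
  by apply: mxi; rewrite -tk.
apply/seteqP; split=> w /=; first by move=> e; eexists.
by move=> [x _ [-> e]].
Qed.

End chain_measurable.

Section chain_marginal.
Context {R : realType} {d dS dZ} {W : measurableType d} {S : measurableType dS}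
  {X : pfinType} {Z : measurableType dZ} {T : nat}.
Variable nu : probability Z R.
Variable step : 'I_T -> S -> X -> Z -> X.
Hypothesis mstep : forall t x y,
  measurable [set q : S * Z | step t q.1 x q.2 = y].

Definition kern (t : 'I_T) (v : S) (x y : X) : R :=
  fine (nu [set z | step t v x z = y]).

(** The marginal laws of the chain in the environment v, started from m. *)
Fixpoint marg (m : X -> R) (v : S) (k : nat) (y : X) : R :=
  if k is k'.+1 then
    if insub k' is Some t then \sum_x marg m v k' x * kern t v x y
    else marg m v k' y
  else m y.

Let kern_xsection t v x y :
  [set z | step t v x z = y] = xsection [set q : S * Z | step t q.1 x q.2 = y] v.
Proof. by apply/seteqP; split => z; rewrite /xsection /= in_setE. Qed.

Lemma measurable_step t v x y : measurable [set z | step t v x z = y].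
Proof. by rewrite kern_xsection; exact: measurable_xsection. Qed.

Lemma kern_ge0 t v x y : 0 <= kern t v x y.
Proof. exact: fine_ge0. Qed.

Lemma kern_le1 t v x y : kern t v x y <= 1.
Proof. by apply: prob_le1; exact: measurable_step. Qed.

Lemma sum_kern t v x : \sum_y kern t v x y = 1.
Proof.
have m y : measurable ((step t v x) @^-1` [set y]) := measurable_step t v x y.
have := Ex_fin nu (fun=> 1) m; rewrite Ex_cst => ->.
by apply: eq_bigr => y _; rewrite mul1r.
Qed.

Lemma bmeas_kern t x y : bmeas (fun v => kern t v x y).
Proof.
split; last by exists 1 => v; rewrite ger0_norm ?kern_ge0 ?kern_le1.
rewrite /kern; under eq_fun do rewrite kern_xsection.
by apply: measurableT_comp => //; exact: measurable_fun_xsection.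
Qed.

Lemma bmeas_marg m k y : bmeas (fun v => marg m v k y).
Proof.
elim: k y => [|k ih] y /=; first exact: bmeas_cst.
case: insubP => [t _ _|_]; last exact: ih.
by apply: bmeas_sum => x; apply: bmeasM; [exact: ih|exact: bmeas_kern].
Qed.

(** The kernels being stochastic, marginals depend on the initial law
   without expansion of the l1 norm. *)
Lemma marg_contract m m' v k :
  \sum_y `|marg m v k y - marg m' v k y| <= \sum_y `|m y - m' y|.
Proof.
elim: k => [|k ih] //=; case: insubP => [t _ _|_] //.
apply: le_trans ih.
apply: (@le_trans _ _ (\sum_y \sum_x `|marg m v k x - marg m' v k x| * kern t v x y)).
  apply: ler_sum => y _; rewrite -sumrB; apply: le_trans (ler_norm_sum _ _ _) _.
  by apply: ler_sum => x _; rewrite -mulrBl normrM (ger0_norm (kern_ge0 _ _ _ _)).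
rewrite exchange_big/=; apply: ler_sum => x _.
by rewrite -mulr_sumr sum_kern mulr1.
Qed.

Variable P : probability W R.
Variables (V : W -> S) (X0 : W -> X) (xi : 'I_T -> W -> Z) (m0 : prob R (disc X)).
Hypothesis mV : measurable_fun setT V.
Hypothesis mX0 : measurable_fun setT (X0 : W -> borel (disc X)).
Hypothesis mxi : forall t, measurable_fun setT (xi t).
Hypothesis law_X0 : forall B : set (borel (disc X)), P (X0 @^-1` B) = m0 B.
Hypothesis law_xi : forall t B, measurable B -> P (xi t @^-1` B) = nu B.
Hypothesis ind : forall A (B : set (borel (disc X))) C,
  measurable A -> (forall t, measurable (C t)) ->
  P (V @^-1` A `&` X0 @^-1` B `&` \bigcap_(t in setT) (xi t @^-1` C t)) =
  (P (V @^-1` A) * P (X0 @^-1` B) * \prod_t P (xi t @^-1` C t))%E.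

(** The independent sources of randomness: the environment, the initial state
   and the noise of each step. *)
Let src (i : option (option 'I_T)) : set_system W :=
  match i with
  | None => [set V @^-1` A | A in measurable]
  | Some None => [set X0 @^-1` B | B in [set: set X]]
  | Some (Some t) => [set xi t @^-1` C | C in measurable]
  end.

Let src_measurable i : src i `<=` measurable.
Proof.
case: i => [[t|]|] _ [A mA <-].
- exact: (measurable_preimage (mxi t) mA).
- exact: (measurable_preimage mX0 (@measurable_disc X A)).
- exact: (measurable_preimage mV mA).
Qed.

Let src_setI i : setI_closed (src i).
Proof.
case: i => [[t|]|] _ _ [A mA <-] [B mB <-]; exists (A `&` B) => //;
  exact: measurableI.
Qed.

Let src_setT i : src i setT.
Proof. by case: i => [[t|]|]; exists setT. Qed.

Let src_indep : indep_family P src.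
Proof.
move=> E srcE; rewrite (bigD1 None)//= (bigD1 (Some None))//=.
have [A mA EA] := srcE None; have [B _ EB] := srcE (Some None).
have /choice[C CE] : forall t, exists C, measurable C /\ xi t @^-1` C = E (Some (Some t)).
  by move=> t; have [C mC <-] := srcE (Some (Some t)); exists C.
transitivity (P (V @^-1` A `&` X0 @^-1` B `&` \bigcap_(t in setT) (xi t @^-1` C t))).
  congr (P _); rewrite EA EB; apply/seteqP; split=> [w Ew|w [[w1 w2] w3] [[t|]|] _//].
    by split; [split; exact: Ew|move=> t _; rewrite (CE t).2; exact: Ew].
  by rewrite -(CE t).2; exact: w3.
rewrite ind//; last by move=> t; have [] := CE t.
rewrite EA EB -muleA; congr (_ * (_ * _))%E.
rewrite [RHS](reindex_omap (fun t => Some (Some t)) (fun i => if i is Some j then j else None)).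
  by apply: eq_big => [t|t _]; rewrite ?eqxx//= (CE t).2.
by case=> [[t|]|].
Qed.

Let Y k w := chain step (V w) (X0 w) (xi ^~ w) k.

Let mY k y : measurable [set w | Y k w = y].
Proof.
apply: measurable_chain => // z.
by exact: (measurable_preimage mX0 (@measurable_disc X [set z])).
Qed.

Let past (k : nat) (i : option (option 'I_T)) :=
  if i is Some (Some t) then (t < k)%N else true.

Let mVY k : measurable_fun setT (fun w : g_sigma_algebraType (\bigcup_(i in [set i | past k i]) src i) =>
   (V w, Y k w : borel (disc X))).
Proof.
have m i A : past k i -> src i A -> gen src (past k) A.
  by move=> pi iA; apply: sub_sigma_algebra; exists i.
have mV' : measurable_fun setT
    (V : g_sigma_algebraType (\bigcup_(i in [set i | past k i]) src i) -> S).
  by move=> _ A mA; rewrite setTI; apply: (m None) => //; exists A.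
apply: measurable_fun_pair => // _ B mB; rewrite setTI.
rewrite (_ : _ @^-1` B = \bigcup_(y in B) [set w | Y k w = y]); last first.
  by apply/seteqP; split=> [w Bw|w /= [y By ->]//]; exists (Y k w).
apply: fin_bigcup_measurable; first exact: finite_finset.
move=> y _; apply: measurable_chain => // [z|t tk].
  by apply: (m (Some None)) => //; exists [set z].
by move=> _ A mA; rewrite setTI; apply: (m (Some (Some t))) => //; exists A.
Qed.

(** The environment and the state at time t depend on the sources preceding the
   noise of the step from t. *)
Let VY_indep (t : 'I_T) (A : set (S * borel (disc X))) C :
  measurable A -> measurable C ->
  P ((fun w => (V w, Y t w : borel (disc X))) @^-1` A `&` xi t @^-1` C) =
  (P ((fun w => (V w, Y t w : borel (disc X))) @^-1` A) * nu C)%E.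
Proof.
move=> mA mC; rewrite -(law_xi t)//.
apply: (indep_gen1 src_measurable src_setI src_setT src_indep (M := past t) (i := Some (Some t))).
- by rewrite /= ltnn.
- exact: (measurable_preimage (@mVY t) mA).
- by exists C.
Qed.

(** The marginal of the chain given the environment.  By induction on time, one
   application of [integrate_noise] replaces the indicator of the next state by
   the transition probability from the current one. *)
Lemma chain_marginal (h : S -> R) k y : bmeas h ->
  Ex P (fun w => h (V w) * \1_[set w | Y k w = y] w) =
  Ex P (fun w => h (V w) * marg (mass m0) (V w) k y).
Proof.
elim: k h y => [|k ih] h y bh.
  have ind0 A B : measurable A -> measurable (B : set (borel (disc X))) ->
      P (V @^-1` A `&` X0 @^-1` B) = (P (V @^-1` A) * m0 B)%E.
    move=> mA mB; have := @ind A B (fun=> setT) mA (fun=> measurableT).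
    rewrite big1; last by move=> t _; rewrite preimage_setT probability_setT.
    rewrite mule1 law_X0 => <-; congr (P _); apply/seteqP; split=> w //.
    by case.
  have mA : measurable [set q : S * borel (disc X) | q.2 = y].
    rewrite (_ : [set q | _] = setT `*` [set y]); last first.
      by apply/seteqP; split => [q|q []].
    by apply: measurableX => //; exact: measurable_disc.
  have := integrate_noise mV mX0 ind0 bh mA; rewrite /Y /= => E.
  transitivity (Ex P (fun w => h (V w) * \1_[set q : S * borel (disc X) | q.2 = y] (V w, X0 w))).
    by [].
  rewrite E; congr Ex; apply/funext => w; congr (_ * fine (m0 _)).
  by apply/seteqP; split => x; rewrite /xsection /= in_setE.
rewrite /Y /=; case: insubP => [t _ tk|_]; last exact: ih.
pose A x := [set q : S * borel (disc X) * Z | step t q.1.1 x q.2 = y].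
(* Given the state x at time t, A x is the event that the step leads to y. *)
have mA x : measurable (A x).
  have -> : A x = (fun q => (q.1.1, q.2)) @^-1` [set q : S * Z | step t q.1 x q.2 = y] by [].
  apply: measurable_preimage => //; apply: measurable_fun_pair => //.
  exact: measurableT_comp.
pose g x (q : S * borel (disc X)) := h q.1 * \1_[set x] q.2.
have bg x : bmeas (g x).
  apply: bmeasM; first exact: (bmeas_comp measurable_fst bh).
  by apply: (bmeas_comp measurable_snd (bmeas_indic _)); exact: measurable_disc.
have mU : measurable_fun setT (fun w => (V w, Y t w : borel (disc X))).
  apply: measurable_fun_pair => // _ B mB; rewrite setTI.
  rewrite (_ : _ @^-1` B = \bigcup_(z in B) [set w | Y t w = z]); last first.
    by apply/seteqP; split=> [w Bw|w /= [z Bz ->]//]; exists (Y t w).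
  by apply: fin_bigcup_measurable => //; exact: finite_finset.
have bI (z : X) : bmeas (\1_[set w | Y t w = z] : W -> R) by exact: bmeas_indic.
have bhV : bmeas (h \o V) by exact: bmeas_comp.
have bK x : bmeas ((fun v => kern t v x y) \o V) by apply: bmeas_comp => //; exact: bmeas_kern.
have bM x : bmeas ((fun v => marg (mass m0) v t x) \o V).
  by apply: bmeas_comp => //; exact: bmeas_marg.
transitivity (Ex P (fun w => \sum_x g x (V w, Y t w) * \1_(A x) ((V w, Y t w), xi t w))).
  congr Ex; apply/funext => w; rewrite (bigD1 (Y t w))//= big1 ?addr0 => [|x xY].
    rewrite /g /= [in RHS]indicE mem_set// mulr1; congr (_ * _).
    by rewrite !indicE /Y tk; congr (_%:R); apply/idP/idP => /set_mem/= e; exact/mem_set.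
  by rewrite /g /= indicE memNset ?mulr0 ?mul0r//= => e; rewrite e eqxx in xY.
rewrite Ex_sum; last first.
  move=> x; apply: bmeasM; first exact: (bmeas_comp mU).
  have mUx : measurable_fun setT (fun w => ((V w, Y t w : borel (disc X)), xi t w)).
    exact: measurable_fun_pair.
  exact: (bmeas_comp mUx (bmeas_indic (mA x))).
transitivity (\sum_x Ex P (fun w => (h (V w) * kern t (V w) x y) * \1_[set w | Y t w = x] w)).
  apply: eq_bigr => x _; rewrite (integrate_noise mU (mxi t) (@VY_indep t))//.
  congr Ex; apply/funext => w; rewrite /g /= mulrAC; congr (_ * _ * _).
    by rewrite /kern; congr (fine (nu _)); apply/seteqP; split => z; rewrite /xsection /A /= in_setE.
transitivity (\sum_x Ex P (fun w => (h (V w) * kern t (V w) x y) * marg (mass m0) (V w) t x)).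
  apply: eq_bigr => x _; rewrite /Y tk.
  exact: (ih (fun v => h v * kern t v x y) x (bmeasM bh (bmeas_kern t x y))).
rewrite -Ex_sum => [|x]; last exact: (bmeasM (bmeasM bhV (bK x)) (bM x)).
congr Ex; apply/funext => w; rewrite mulr_sumr; apply: eq_bigr => x _.
by rewrite -tk mulrAC mulrA.
Qed.

End chain_marginal.

(** * The mean field game *)

Lemma sigma_gen_preimage d (W : measurableType d) (I : Type) (S : ptopologicalType)
    (Y : I -> W -> S) i (B : set (borel S)) :
  measurable B -> sigma_gen Y (Y i @^-1` B).
Proof.
move=> mB; apply: sub_sigma_algebra; exists i => //.
by exists B => //; rewrite setTI.
Qed.

Lemma sigma_gen_bigcap d (W : measurableType d) (I : finType) (S : ptopologicalType)
    (Y : I -> W -> S) (B : I -> set (borel S)) :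
  (forall i, measurable (B i)) ->
  sigma_gen Y (\bigcap_(i in setT) (Y i @^-1` B i)).
Proof.
move=> mB; apply: (@fin_bigcap_measurable _ (g_sigma_algebraType
  (\bigcup_(i in setT) preimage_set_system setT (Y i : W -> borel S) measurable))) => //.
by move=> i _; exact: sigma_gen_preimage.
Qed.

Section mean_field.
Context {R : realType} {T : nat} {X Gamma : pfinType}.
Local Notation PX := (prob R (disc X)).
Local Notation strat := (strategy T X Gamma).
Local Notation flow := (flow R T X Gamma).
Variable Psi : 'I_T -> X -> PX -> Gamma -> noise R -> X.
Variable f : 'I_T -> X -> PX -> Gamma -> R.
Variable F : X -> PX -> R.
Hypothesis Psi_measurable : forall t : 'I_T, measurable_fun setT
  (fun q : borel (disc X) * borel PX * borel (disc Gamma) * borel (noise R) =>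
     Psi t q.1.1.1 q.1.1.2 q.1.2 q.2 : borel (disc X)).

Definition mf_step (u : strat -> strat) (t : 'I_T) (v : borel flow) (x : X)
    (z : borel (noise R)) : X :=
  Psi t x ((v : flow).2 (now t)) (u (v : flow).1 (t, x)) z.

Lemma measurable_flow_fst : measurable_fun setT (fst : borel flow -> borel (disc strat)).
Proof.
move=> _ B _; rewrite setTI; apply: sub_sigma_algebra.
apply: (open_comp (f := fst)); last exact: open_disc.
by move=> p _; exact: cvg_fst.
Qed.

Lemma flow_snd_continuous t : continuous (fun v : flow => v.2 t).
Proof.
move=> p; apply: (cvg_comp snd (fun m : tpow 'I_T.+1 PX => m t)); first exact: cvg_snd.
exact: proj_tpow_continuous.
Qed.

Lemma measurable_flow_snd t : measurable_fun setT (fun v : borel flow => v.2 t : borel PX).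
Proof.
apply: (@measurability _ _ (borel flow) (borel PX) setT _ (@open PX) erefl).
move=> _ [A oA <-]; rewrite setTI; apply: sub_sigma_algebra.
by apply: (open_comp (f := fun v : flow => v.2 t)) => // p _; exact: flow_snd_continuous.
Qed.

Lemma measurable_mf_step u t x y :
  measurable [set q : borel flow * borel (noise R) | mf_step u t q.1 x q.2 = y].
Proof.
pose a (v : borel flow) : borel (disc Gamma) := u v.1 (t, x).
have ma : measurable_fun setT (fun q : borel flow * borel (noise R) => a q.1).
  have mg : measurable_fun setT
      (fun b : borel (disc strat) => u b (t, x) : borel (disc Gamma)).
    by move=> _ B _; exact: measurable_disc.
  exact: (measurableT_comp mg (measurableT_comp measurable_flow_fst measurable_fst)).
have mm : measurable_fun setT
    (fun q : borel flow * borel (noise R) => q.1.2 (now t) : borel PX).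
  exact: (measurableT_comp (measurable_flow_snd (now t)) measurable_fst).
have := measurable_preimage (f := fun q : borel flow * borel (noise R) =>
  (((x : borel (disc X), q.1.2 (now t) : borel PX), a q.1), q.2)) _
  (measurable_preimage (Psi_measurable t) (@measurable_disc X [set y])).
by apply; do 3 apply: measurable_fun_pair => //.
Qed.

(** The conditional law, given strategy and flow, of the state at time k of a
   mean field player starting from m. *)
Definition occ (u : strat -> strat) (m : X -> R) (k : nat) (y : X) (v : flow) : R :=
  marg (@nu R : probability (borel (noise R)) R) (mf_step u) m v k y.

Lemma bmeas_occ u m k y : bmeas (occ u m k y : borel flow -> R).
Proof. exact: (bmeas_marg (@nu R) (measurable_mf_step u)). Qed.

(** Measurability into the Borel sigma-algebra of the product topology is
   checked on distances to points. *)
Lemma measurable_flow d (W : measurableType d) (Phi : W -> strat)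
    (mu : 'I_T.+1 -> W -> PX) :
  measurable_fun setT (Phi : W -> borel (disc strat)) ->
  (forall t, measurable_fun setT (mu t : W -> borel PX)) ->
  measurable_fun setT (fun w => (Phi w, fun t => mu t w) : borel flow).
Proof.
move=> mPhi mmu; apply: (measurable_metrizes (fdist_metrizes R T X Gamma)).
  exact: compact_flow.
move=> p; apply: measurable_funD.
  have mg : measurable_fun setT (fun a : borel (disc strat) => (p.1 != a)%:R : R).
    by move=> _ B _; exact: measurable_disc.
  exact: (measurableT_comp mg mPhi).
apply: measurable_sum => t.
have md : measurable_fun setT (@dist R X (p.2 t) : borel PX -> R).
  by apply: continuous_borel; exact: (metrizes_continuous dist_metrizes).
exact: (measurableT_comp md (mmu t)).
Qed.

Section realization.
Context {m0 : PX} {rho : prob R flow} {u : strat -> strat}.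
Variable r : mf_realization Psi m0 rho u.

Let V (w : mf_Omega r) : borel flow := (mf_Phi w, fun t => mf_mu t w).

Lemma measurable_mf_flow : measurable_fun setT V.
Proof. by apply: measurable_flow; [exact: mf_mPhi|exact: mf_mmu]. Qed.

Lemma mf_indep_family (A : set (borel flow)) (B : set (borel (disc X)))
    (C : 'I_T -> set (borel (noise R))) :
  measurable A -> (forall t, measurable (C t)) ->
  mf_P r (V @^-1` A `&` mf_X (m:=r) ord0 @^-1` B `&` \bigcap_(t in setT) (mf_xi (m:=r) t @^-1` C t)) =
  (mf_P r (V @^-1` A) * mf_P r (mf_X (m:=r) ord0 @^-1` B) * \prod_t mf_P r (mf_xi (m:=r) t @^-1` C t))%E.
Proof.
move=> mA mC; rewrite -(proj2 (mf_iid r))//.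
rewrite [LHS](_ : _ = mf_P r (\bigcap_(t in setT) (mf_xi (m:=r) t @^-1` C t) `&`
    mf_X (m:=r) ord0 @^-1` B `&` V @^-1` A)); last first.
  by congr (mf_P r _); rewrite setIC [V @^-1` _ `&` _]setIC setIA.
rewrite (mf_indep (m:=r)); first by rewrite muleC [X in (_ * X)%E = _]muleC muleA.
- exact: sigma_gen_bigcap.
- exact: (@sigma_gen_preimage _ _ unit (disc X) (fun _ => mf_X (m:=r) ord0) tt B).
- exact: (@sigma_gen_preimage _ _ unit flow (fun _ => V) tt A).
Qed.

Definition mf_chain (u' : strat -> strat) (k : nat) (w : mf_Omega r) : X :=
  chain (mf_step u') (V w) (mf_X (m:=r) ord0 w) (fun t => mf_xi (m:=r) t w) k.

Lemma mf_chain_eq : {ae mf_P r, forall w, forall t : 'I_T.+1,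
  mf_X (m:=r) t w = mf_chain u t w}.
Proof.
apply: filterS (mf_dynamics r) => w dyn [k kT] /=.
elim: k kT => [|k ih] kT.
  by rewrite /mf_chain /=; congr mf_X; exact: val_inj.
have kT' : (k < T)%N by [].
have kT1 : (k < T.+1)%N := ltnW kT'.
rewrite (_ : Ordinal kT = Defs.next (Ordinal kT')); last exact: val_inj.
have -> : mf_chain u k.+1 w = mf_step u (Ordinal kT') (V w) (mf_chain u k w)
    (mf_xi (Ordinal kT') w) by rewrite /mf_chain -chainS.
rewrite dyn /mf_step -(ih kT1).
by rewrite (_ : now (Ordinal kT') = Ordinal kT1)//; exact: val_inj.
Qed.

Lemma mf_marginal u' (h : flow -> R) k y : bmeas (h : borel flow -> R) ->
  Ex (mf_P r) (fun w => h (V w) * \1_[set w | mf_chain u' k w = y] w) =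
  Ex rho (fun v => h v * occ u' (mass m0) k y v).
Proof.
move=> bh; rewrite /mf_chain.
rewrite (@chain_marginal _ _ _ _ _ _ _ _ _ (@nu R) (mf_step u') (measurable_mf_step u')
  (mf_P r) V (mf_X (m:=r) ord0) (mf_xi (m:=r)) m0)//.
- rewrite -[LHS]/(Ex (mf_P r) ((fun v => h v * occ u' (mass m0) k y v) \o V)).
  apply: Ex_law; first exact: measurable_mf_flow.
    exact: mf_lawflow.
  by apply: bmeasM => //; exact: bmeas_occ.
- exact: measurable_mf_flow.
- exact: mf_mX.
- exact: mf_mxi.
- by move=> B; apply: mf_lawX0; exact: measurable_disc.
- by move=> t B mB; apply: (proj1 (mf_iid r)).
- exact: mf_indep_family.
Qed.

(** The modification acts on the states only, so the dynamics can be replayed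
   with another one on the same sample space.  Hence realizations exist for all
   modifications or for none. *)
Definition mf_deviate (u' : strat -> strat) : mf_realization Psi m0 rho u'.
Proof.
apply: (@MFRealization _ _ _ _ _ _ _ _ _ (mf_Omega r) (mf_P r) (mf_Phi (m:=r))
  (fun t => mf_chain u' t) (mf_mu (m:=r)) (mf_xi (m:=r))).
- exact: mf_mPhi.
- move=> t _ B _; rewrite setTI.
  rewrite (_ : _ @^-1` B = \bigcup_(y in B) [set w | mf_chain u' t w = y]); last first.
    by apply/seteqP; split=> [w Bw|w /= [y By ->]//]; exists (mf_chain u' t w).
  apply: fin_bigcup_measurable; first exact: finite_finset.
  move=> y _; apply: measurable_chain.
  + exact: measurable_mf_step.
  + exact: measurable_mf_flow.
  + by move=> z; exact: (measurable_preimage (mf_mX (m:=r) ord0) (@measurable_disc X [set z])).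
  + by move=> s _; exact: mf_mxi.
- exact: mf_mmu.
- exact: mf_mxi.
- exact: mf_lawX0.
- exact: mf_lawflow.
- exact: mf_iid.
- exact: mf_indep.
- apply: aeW => w t.
  by rewrite /mf_chain -[nat_of_ord (Defs.next t)]/(t.+1) chainS.
Defined.

Lemma mf_state_marginal (h : flow -> R) (t : 'I_T.+1) y : bmeas (h : borel flow -> R) ->
  Ex (mf_P r) (fun w => h (V w) * \1_[set w | mf_X (m:=r) t w = y] w) =
  Ex rho (fun v => h v * occ u (mass m0) t y v).
Proof.
move=> bh; have bhV := bmeas_comp measurable_mf_flow bh.
rewrite -mf_marginal//; apply: Ex_ae.
- apply: bmeasM => //; apply: bmeas_indic.
  exact: (measurable_preimage (mf_mX (m:=r) t) (@measurable_disc X [set y])).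
- apply: bmeasM => //; apply: bmeas_indic.
  exact: (measurable_preimage (mf_mX (m:=mf_deviate u) t) (@measurable_disc X [set y])).
- apply: filterS mf_chain_eq => w /(_ t) e; congr (_ * _).
  by rewrite !indicE; congr (nat_of_bool _)%:R; apply/idP/idP => /set_mem /= h1;
    apply/mem_set => /=; rewrite ?e -?h1// -?e.
Qed.

End realization.

Hypothesis f_continuous : forall t x a, continuous (fun m : PX => f t x m a).
Hypothesis F_continuous : forall x, continuous (F x).

Definition running (u : strat -> strat) (t : 'I_T) (y : X) (v : flow) : R :=
  f t y (v.2 (now t)) (u v.1 (t, y)).

Definition terminal (y : X) (v : flow) : R := F y (v.2 ord_max).

Lemma running_continuous u t y : continuous (running u t y).
Proof.
by apply: (flow_marginal_continuous (k := fun a m => f t y m (u a (t, y)))).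
Qed.

Lemma terminal_continuous y : continuous (terminal y).
Proof. by apply: (flow_marginal_continuous (k := fun _ m => F y m)). Qed.

Definition mean_cost (m : X -> R) (u : strat -> strat) (v : flow) : R :=
  \sum_(t < T) \sum_y running u t y v * occ u m t y v +
  \sum_y terminal y v * occ u m T y v.

(** Each term of the cost is a function of the flow and of one state. *)
Lemma mf_cost_occ m0 rho u (r : mf_realization Psi m0 rho u) :
  mf_cost f F r = Ex rho (mean_cost (mass m0) u : borel flow -> R).
Proof.
have brun t y : bmeas (running u t y : borel flow -> R).
  by apply: continuous_bmeas; [exact: compact_flow|exact: running_continuous].
have bter y : bmeas (terminal y : borel flow -> R).
  by apply: continuous_bmeas; [exact: compact_flow|exact: terminal_continuous].
pose V (w : mf_Omega r) : borel flow := (mf_Phi w, fun t => mf_mu t w).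
have mV : measurable_fun setT V by exact: measurable_mf_flow.
have bI t y : bmeas (\1_[set w | mf_X (m:=r) t w = y] : mf_Omega r -> R).
  by apply: bmeas_indic; exact: (measurable_preimage (mf_mX (m:=r) t) (@measurable_disc X [set y])).
rewrite /mf_cost unlock.
transitivity (Ex (mf_P r) (fun w =>
    \sum_(t < T) \sum_y running u t y (V w) * \1_[set w | mf_X (m:=r) (now t) w = y] w +
    \sum_y terminal y (V w) * \1_[set w | mf_X (m:=r) ord_max w = y] w)).
  congr Ex; apply/funext => w; congr (_ + _).
    apply: eq_bigr => t _; rewrite (bigD1 (mf_X (now t) w))//= indicE mem_set// mulr1.
    by rewrite big1 ?addr0// => y yX; rewrite indicE memNset ?mulr0// => /= e; rewrite e eqxx in yX.
  rewrite (bigD1 (mf_X ord_max w))//= indicE mem_set// mulr1.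
  by rewrite big1 ?addr0// => y yX; rewrite indicE memNset ?mulr0// => /= e; rewrite e eqxx in yX.
have bh (h : flow -> R) t y : bmeas (h : borel flow -> R) ->
    bmeas (fun w => h (V w) * \1_[set w | mf_X (m:=r) t w = y] w).
  by move=> bh; apply: bmeasM => //; exact: (bmeas_comp mV bh).
have bo (h : flow -> R) k y : bmeas (h : borel flow -> R) ->
    bmeas (fun v : borel flow => h v * occ u (mass m0) k y v).
  by move=> bh'; apply: bmeasM => //; exact: bmeas_occ.
have brunE t y := bh _ (now t) y (brun t y).
have brunO (t : 'I_T) y := bo _ t y (brun t y).
have bterE y := bh _ ord_max y (bter y).
have bterO y := bo _ T y (bter y).
have bsE t := @bmeas_sum _ _ R _ (index_enum X) xpredT _ (brunE t).
have bsO t := @bmeas_sum _ _ R _ (index_enum X) xpredT _ (brunO t).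
rewrite /mean_cost !ExD; [|exact: bmeas_sum..].
congr (_ + _).
  rewrite (Ex_sum _ _ _ bsE) (Ex_sum _ _ _ bsO); apply: eq_bigr => t _.
  rewrite (Ex_sum _ _ _ (brunE t)) (Ex_sum _ _ _ (brunO t)).
  by apply: eq_bigr => y _; exact: mf_state_marginal.
rewrite (Ex_sum _ _ _ bterE) (Ex_sum _ _ _ bterO).
by apply: eq_bigr => y _; exact: mf_state_marginal.
Qed.

Lemma J_occ m0 rho u : (exists u', inhabited (mf_realization Psi m0 rho u')) ->
  J Psi f F m0 rho u = Ex rho (mean_cost (mass m0) u : borel flow -> R).
Proof.
move=> [u' [r]]; rewrite /J.
set C := [set c | _]; have [r' ->] : C (xget 0 C).
  by apply: (@xgetI _ _ _ (mf_cost f F (mf_deviate r u))); exists (mf_deviate r u).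
exact: mf_cost_occ.
Qed.

(** Without realization the cost takes its default value, and optimality is an
   equality. *)
Lemma J_empty m0 rho u : ~ (exists u', inhabited (mf_realization Psi m0 rho u')) ->
  J Psi f F m0 rho u = 0.
Proof.
move=> nr; rewrite /J; case: xgetP => // c _ [r _].
by case: nr; exists u.
Qed.

End mean_field.

(** * The game of finitely many players *)

Lemma fin_measurable_set d (W : measurableType d) (E : finType) (U : W -> E) :
  (forall e, measurable (U @^-1` [set e])) ->
  forall B : set E, measurable (U @^-1` B).
Proof.
move=> mU B.
rewrite (_ : U @^-1` B = \bigcup_(e in B) (U @^-1` [set e])).
  by apply: fin_bigcup_measurable => //; exact: finite_finset.
by apply/seteqP; split=> [w Bw|w /= [e Be ->]//]; exists (U w).
Qed.

(** The factor of h through U is obtained by choice, which spares an explicit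
   formula for it. *)
Lemma bmeas_factor {R : realType} d (W : measurableType d) (E : finType) (U : W -> E)
    (h : W -> R) : (forall e, measurable (U @^-1` [set e])) ->
  (forall w w', U w = U w' -> h w = h w') -> bmeas h.
Proof.
move=> mU hU.
pose g e := if pselect (exists w, U w = e) is left p then h (projT1 (cid p)) else 0.
rewrite (_ : h = g \o U); first exact: bmeas_fin.
apply/funext => w; rewrite /g /=; case: pselect => [p|]; last by case; exists w.
by apply: hU; rewrite (projT2 (cid p)).
Qed.

Section empirical.
Context {R : realType} {X : pfinType} {n : nat}.
Implicit Types x : 'I_n.+2 -> X.
Local Notation PX := (prob R (disc X)).
Local Notation emp x l := (empirical R x l : PX).

Lemma mass_empirical x l y :
  mass (emp x l) y = n.+1%:R^-1 * \sum_(j < n.+2 | j != l) (x j == y)%:R.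
Proof.
have E : (\sum_(j < n.+2 | j != l) @dirac _ (borel (disc X)) (x j) R [set y] =
    (\sum_(j < n.+2 | j != l) (x j == y)%:R)%:E)%E.
  rewrite -sumEFin; apply: eq_bigr => j _; rewrite diracE; congr (nat_of_bool _)%:R%:E.
  by apply/idP/idP => [/set_mem/eqP//|/eqP ->]; exact/mem_set.
by rewrite /mass /= /empirical E -EFinM.
Qed.

Lemma eq_empirical x x' l : (forall j, j != l -> x j = x' j) -> emp x l = emp x' l.
Proof.
move=> xx'; apply: mass_inj => y; rewrite !mass_empirical; congr (_ * _).
by apply: eq_bigr => j jl; rewrite xx'.
Qed.

Lemma dist_empirical x x' l :
  dist (emp x l) (emp x' l) <= n.+1%:R^-1 * \sum_(j < n.+2 | j != l) (x j != x' j)%:R.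
Proof.
rewrite distE.
have le y : `|mass (emp x l) y - mass (emp x' l) y| <=
    n.+1%:R^-1 * \sum_(j < n.+2 | j != l) `|(x j == y)%:R - (x' j == y)%:R|.
  rewrite !mass_empirical -mulrBr normrM ger0_norm ?invr_ge0//.
  by rewrite ler_wpM2l ?invr_ge0// -sumrB ler_norm_sum.
apply: (@le_trans _ _ (2^-1 * \sum_y (n.+1%:R^-1 *
    \sum_(j < n.+2 | j != l) `|(x j == y)%:R - (x' j == y)%:R|))).
  by rewrite ler_wpM2l ?invr_ge0// ler_sum.
rewrite -mulr_sumr mulrCA ler_wpM2l ?invr_ge0// exchange_big/= mulr_sumr.
apply: ler_sum => j _.
have [->|xx'] := eqVneq (x j) (x' j).
  by rewrite big1 ?mulr0// => y _; rewrite subrr normr0.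
rewrite ler_pdivrMl// mulr1 (bigD1 (x j))//= (bigD1 (x' j))/=; last by rewrite eq_sym.
rewrite !eqxx [x' j == _]eq_sym (negbTE xx') subr0 sub0r normrN normr1.
rewrite big1 ?addr0// => y /andP[/negbTE y1 /negbTE y2].
by rewrite eq_sym y1 eq_sym y2 subrr normr0.
Qed.

(** The two measures differ by the exchange of one atom of mass 1/(n+1). *)
Lemma dist_empirical_player x l l' : dist (emp x l) (emp x l') <= n.+1%:R^-1.
Proof.
have [->|ll'] := eqVneq l l'; first by rewrite distxx invr_ge0.
rewrite distE.
have E y : mass (emp x l) y - mass (emp x l') y =
    n.+1%:R^-1 * ((x l' == y)%:R - (x l == y)%:R).
  rewrite !mass_empirical -mulrBr; congr (_ * _).
  rewrite (bigD1 l')/=; last by rewrite eq_sym.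
  rewrite [X in _ - X](bigD1 l)//= opprD addrACA [X in _ + X](_ : _ = 0) ?addr0//.
  by apply/eqP; rewrite subr_eq0; apply/eqP; apply: eq_bigl => j; rewrite andbC.
under eq_bigr => y _ do rewrite E normrM ger0_norm ?invr_ge0//.
rewrite -mulr_sumr mulrCA ler_piMr ?invr_ge0//.
rewrite ler_pdivrMl// mulr1.
have [e|xx'] := eqVneq (x l') (x l).
  by rewrite e big1// => y _; rewrite subrr normr0.
rewrite (bigD1 (x l'))//= (bigD1 (x l))/=; last by rewrite eq_sym.
rewrite !eqxx [x l == _]eq_sym (negbTE xx') subr0 sub0r normrN normr1.
rewrite big1 ?addr0// => y /andP[/negbTE y1 /negbTE y2].
by rewrite eq_sym y1 eq_sym y2 subrr normr0.
Qed.

Lemma mass_empirical_sum x l y (c : R) :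
  c * mass (emp x l) y = n.+1%:R^-1 * \sum_(j < n.+2 | j != l) c * (x j == y)%:R.
Proof. by rewrite mass_empirical mulrCA mulr_sumr. Qed.

End empirical.

Section game.
Context {R : realType} {T : nat} {X Gamma : pfinType} {n : nat}.
Local Notation PX := (prob R (disc X)).
Local Notation strat := (strategy T X Gamma).
Local Notation N := n.+2.
Local Notation strats := (fpow 'I_N strat).
Local Notation states := (fpow 'I_N X).
Variable Psi : 'I_T -> X -> PX -> Gamma -> noise R -> X.

(** The flag b selects the true game (true) or the decoupled game (false), in
   which the other players see player 0 at a fixed state, so that their evolution
   does not depend on player 0. *)
Definition view (b : bool) (x : states) : 'I_N -> X :=
  fun j => if b || (j != ord0) then x j else point.

Definition emp (b : bool) (x : states) (j : 'I_N) : PX := empirical R (view b x) j.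

Definition played (u : strat -> strat) (phi : strats) (j : 'I_N) : strat :=
  if j == ord0 then u (phi j) else phi j.

Definition game_step (b : bool) (u : strat -> strat) (t : 'I_T) (phi : strats)
    (x : states) (j : 'I_N) (z : noise R) : X :=
  Psi t (x j) (emp b x j) (played u phi j (t, x j)) z.

Fixpoint game (b : bool) (u : strat -> strat) (phi : strats) (x : states)
    (z : 'I_N -> 'I_T -> noise R) (k : nat) : states :=
  if k is k'.+1 then
    let y := game b u phi x z k' in
    if insub k' is Some t then [ffun j => game_step b u t phi y j (z j t)] else y
  else x.

Lemma gameS b u phi x z (t : 'I_T) j :
  game b u phi x z t.+1 j = game_step b u t phi (game b u phi x z t) j (z j t).
Proof. by rewrite /= valK ffunE. Qed.

Lemma emp_eq b b' (x x' : states) :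
  (forall j, j != ord0 -> x j = x' j) -> emp b x ord0 = emp b' x' ord0.
Proof.
by move=> xx'; apply: eq_empirical => j j0; rewrite /view j0 !orbT xx'.
Qed.

Lemma emp_decoupled j (x x' : states) :
  (forall j, j != ord0 -> x j = x' j) -> emp false x j = emp false x' j.
Proof.
by move=> xx'; apply: eq_empirical => i _; rewrite /view /=; case: ifP => // /xx'.
Qed.

(** Neither the modification nor the data of player 0 enter the evolution of the
   others. *)
Lemma decoupled_others u u' phi (x x' : states) (z z' : 'I_N -> 'I_T -> noise R) k :
  (forall j, j != ord0 -> x j = x' j) -> (forall j, j != ord0 -> z j = z' j) ->
  forall j, j != ord0 -> game false u phi x z k j = game false u' phi x' z' k j.
Proof.
move=> xx' zz'; elim: k => [|k ih] j j0; first exact: xx'.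
rewrite /=; case: insubP => [t _ _|_]; last exact: ih.
rewrite !ffunE /game_step /played (negbTE j0) ih// zz'//.
by rewrite (emp_decoupled j ih).
Qed.

(** The summand 1 accounts for player 0, whom the decoupled game shows at a fixed
   state. *)
Lemma dist_emp (x x' : states) j :
  dist (emp true x j) (emp false x' j) <=
  n.+1%:R^-1 * (1 + \sum_(i < N | i != j) (x i != x' i)%:R).
Proof.
apply: le_trans (dist_empirical _ _ _) _; rewrite ler_wpM2l ?invr_ge0//.
apply: (@le_trans _ _ (\sum_(i < N | i != j) ((i == ord0)%:R + (x i != x' i)%:R))).
  apply: ler_sum => i _; rewrite /view /=.
  have [_|_] := eqVneq i ord0; last by rewrite add0r.
  by rewrite (@le_trans _ _ 1)// ?lerDl// lern1 leq_b1.
rewrite big_split lerD2r.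
apply: (@le_trans _ _ (\sum_(i < N) (i == ord0)%:R)).
  by rewrite [leRHS](bigID (fun i => i != j))/= lerDl sumr_ge0.
rewrite (bigD1 ord0)//= big1 ?addr0// => i /negbTE ->//.
Qed.

Hypothesis Psi_measurable : forall t : 'I_T, measurable_fun setT
  (fun q : borel (disc X) * borel PX * borel (disc Gamma) * borel (noise R) =>
     Psi t q.1.1.1 q.1.1.2 q.1.2 q.2 : borel (disc X)).

Lemma measurable_Psi t x m a : measurable_fun setT (Psi t x m a : borel (noise R) -> borel (disc X)).
Proof.
have mp : measurable_fun setT (fun z : borel (noise R) =>
    ((((x : borel (disc X)), (m : borel PX)), (a : borel (disc Gamma))), z)).
  by do 3 apply: measurable_fun_pair => //.
exact: (measurableT_comp (Psi_measurable t) mp).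
Qed.

Lemma measurable_game_step b u t phi x j y :
  measurable ([set z | game_step b u t phi x j z = y] : set (borel (noise R))).
Proof.
exact: (measurable_preimage (measurable_Psi t (x j) (emp b x j) (played u phi j (t, x j)))
  (@measurable_disc X [set y])).
Qed.

Lemma measurable_game d (W : measurableType d) (Phi : W -> strats) (X0 : W -> states)
    (xi : 'I_N -> 'I_T -> W -> noise R) b u k :
  (forall a, measurable (Phi @^-1` [set a])) ->
  (forall a, measurable (X0 @^-1` [set a])) ->
  (forall j (t : 'I_T), (t < k)%N -> measurable_fun setT (xi j t : W -> borel (noise R))) ->
  forall x, measurable ((fun w => game b u (Phi w) (X0 w) (fun j t => xi j t w) k) @^-1` [set x]).
Proof.
move=> mPhi mX0; elim: k => [_ x|k ih mxi x]; first exact: mX0.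
have ih' := ih (fun j t tk => mxi j t (ltnW tk)).
rewrite [X in measurable (X @^-1` _)]/=; case: insubP => [t _ tk|_]; last exact: ih'.
pose U w : (strats * states)%type := (Phi w, game b u (Phi w) (X0 w) (fun j t => xi j t w) k).
have mU e : measurable (U @^-1` [set e]).
  rewrite (_ : _ @^-1` _ = Phi @^-1` [set e.1] `&`
     (fun w => game b u (Phi w) (X0 w) (fun j t => xi j t w) k) @^-1` [set e.2]).
    exact: measurableI.
  by case: e => a y; apply/seteqP; split=> w; rewrite /U /= => -[-> ->].
rewrite (_ : _ @^-1` _ = \bigcup_(e in [set: (strats * states)%type]) (U @^-1` [set e] `&`
    \bigcap_(j in [set: 'I_N]) (xi j t @^-1` [set z | game_step b u t e.1 e.2 j z = x j]))).
  apply: fin_bigcup_measurable => [|e _]; first exact: finite_finset.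
  apply: measurableI => //; apply: fin_bigcap_measurable => [|j _]; first exact: finite_finset.
  have mj := mxi j t; rewrite tk ltnSn in mj.
  exact: (measurable_preimage (mj isT) (@measurable_game_step b u t e.1 e.2 j (x j))).
apply/seteqP; split=> w /=.
  by move=> <-; exists (U w) => //; split => // j _ /=; rewrite ffunE.
by move=> [_ _ [/= <- Ux]]; apply/ffunP => j; rewrite ffunE; exact: Ux.
Qed.

End game.

Local Notation nPhi r := (@Nr_Phi _ _ _ _ _ _ _ _ _ _ r).
Local Notation nX r := (@Nr_X _ _ _ _ _ _ _ _ _ _ r).
Local Notation nxi r := (@Nr_xi _ _ _ _ _ _ _ _ _ _ r).
Local Notation nmPhi r := (@Nr_mPhi _ _ _ _ _ _ _ _ _ _ r).
Local Notation nmX r := (@Nr_mX _ _ _ _ _ _ _ _ _ _ r).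
Local Notation nmxi r := (@Nr_mxi _ _ _ _ _ _ _ _ _ _ r).
Local Notation nindep r := (@Nr_indep _ _ _ _ _ _ _ _ _ _ r).

Section realization.
Context {R : realType} {T : nat} {X Gamma : pfinType} {n : nat}.
Local Notation PX := (prob R (disc X)).
Local Notation strat := (strategy T X Gamma).
Local Notation N := n.+2.
Local Notation strats := (fpow 'I_N strat).
Local Notation states := (fpow 'I_N X).
Local Notation paths := {ffun 'I_T.+1 -> states}.
Variable Psi : 'I_T -> X -> PX -> Gamma -> noise R -> X.
Hypothesis Psi_measurable : forall t : 'I_T, measurable_fun setT
  (fun q : borel (disc X) * borel PX * borel (disc Gamma) * borel (noise R) =>
     Psi t q.1.1.1 q.1.1.2 q.1.2 q.2 : borel (disc X)).
Variables (mN : prob R (disc states)) (gamma : prob R (disc strats)) (m0N : PX).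
Hypothesis mN_product : product_law mN m0N.

Section one_realization.
Context {u0 : strat -> strat} {i0 : 'I_N}.
Variable r : N_realization Psi mN gamma u0 i0.
Local Notation Om := (Nr_Omega r).
Local Notation P := (Nr_P r).

(** The data of one realization drive both games, for all modifications. *)
Definition rPhi (w : Om) : strats := [ffun j => Nr_Phi j w].
Definition rX0 (w : Om) : states := [ffun j => Nr_X j ord0 w].
Definition rgame b u (k : nat) (w : Om) : states :=
  game Psi b u (rPhi w) (rX0 w) (fun j t => Nr_xi j t w) k.

Lemma rPhiE w j : rPhi w j = Nr_Phi j w.
Proof. by rewrite /rPhi ffunE. Qed.

Lemma measurable_rPhi a : measurable (rPhi @^-1` [set a]).
Proof.
rewrite (_ : _ @^-1` _ = \bigcap_(j in [set: 'I_N]) (nPhi r j @^-1` [set a j])).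
  apply: fin_bigcap_measurable => [|j _]; first exact: finite_finset.
  exact: (measurable_preimage (nmPhi r j) (@measurable_disc strat [set a j])).
apply/seteqP; split=> w /=; first by move=> <- j _ /=; rewrite ffunE.
by move=> e; apply/ffunP => j; rewrite ffunE; exact: e.
Qed.

Lemma measurable_rX0 a : measurable (rX0 @^-1` [set a]).
Proof.
rewrite (_ : _ @^-1` _ = \bigcap_(j in [set: 'I_N]) (nX r j ord0 @^-1` [set a j])).
  apply: fin_bigcap_measurable => [|j _]; first exact: finite_finset.
  exact: (measurable_preimage (nmX r j ord0) (@measurable_disc X [set a j])).
apply/seteqP; split=> w /=; first by move=> <- j _ /=; rewrite ffunE.
by move=> e; apply/ffunP => j; rewrite ffunE; exact: e.
Qed.

Lemma measurable_rgame b u k x : measurable (rgame b u k @^-1` [set x]).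
Proof.
apply: (measurable_game Psi_measurable b u (k := k) measurable_rPhi measurable_rX0).
by move=> j t _; exact: Nr_mxi.
Qed.

Lemma law_rPhi (B : set strats) : P (rPhi @^-1` B) = gamma B.
Proof. exact: (Nr_lawPhi r (@measurable_disc _ B)). Qed.

Lemma law_X j (B : set X) : P (nX r j ord0 @^-1` B) = m0N B.
Proof.
have := mN_product (B := fun i => if i == j then B else setT) (fun=> @measurable_disc _ _).
rewrite (bigD1 j)//= eqxx big1 ?mule1; last first.
  by move=> i /negbTE ->; exact: probability_setT.
move=> <-; rewrite -(Nr_lawX0 r (@measurable_disc _ _)); congr (P _).
apply/seteqP; split=> w /=.
  by move=> Bw i; case: eqP => // ->; rewrite ffunE.
by move/(_ j); rewrite eqxx ffunE.
Qed.

(** The independent sources of randomness.  The strategies are correlated and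
   form one source, whereas each initial state and each noise is a source of its
   own. *)
Definition src (i : option ('I_N + 'I_N * 'I_T)) : set_system Om :=
  match i with
  | None => sigma_gen (fun j => nPhi r j : Om -> disc strat)
  | Some (inl j) => [set nX r j ord0 @^-1` B | B in [set: set X]]
  | Some (inr jt) => [set nxi r jt.1 jt.2 @^-1` C | C in
      (measurable : set (set (borel (noise R))))]
  end.

Lemma src_measurable i : src i `<=` measurable.
Proof.
case: i => [[j|jt]|] /=.
- by move=> _ [B _ <-]; exact: (measurable_preimage (nmX r j ord0) (@measurable_disc X B)).
- by move=> _ [C mC <-]; exact: (measurable_preimage (nmxi r jt.1 jt.2) mC).
- apply: smallest_sub; first exact: sigma_algebra_measurable.
  by move=> _ [j _ [B mB <-]]; exact: (nmPhi r j).
Qed.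

Lemma src_setI i : setI_closed (src i).
Proof.
case: i => [[j|jt]|] /=.
- by move=> _ _ [B _ <-] [C _ <-]; exists (B `&` C).
- by move=> _ _ [B mB <-] [C mC <-]; exists (B `&` C) => //; exact: measurableI.
- move=> A B mA mB; exact: (@measurableI _ (g_sigma_algebraType
    (\bigcup_(j in [set: 'I_N]) preimage_set_system setT
       (nPhi r j : Om -> borel (disc strat)) measurable)) A B).
Qed.

Lemma src_setT i : src i setT.
Proof.
case: i => [[j|jt]|] /=; [by exists setT|by exists setT|].
exact: (@measurableT _ (g_sigma_algebraType
    (\bigcup_(j in [set: 'I_N]) preimage_set_system setT
       (nPhi r j : Om -> borel (disc strat)) measurable))).
Qed.

(** Three independences combine: that of the three blocks, that of the noises and
   the product form of the initial law. *)
Lemma src_indep : indep_family P src.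
Proof.
move=> E srcE.
have /choice[B EB] : forall j, exists B, nX r j ord0 @^-1` B = E (Some (inl j)).
  by move=> j; have [B _ <-] := srcE (Some (inl j)); exists B.
have /choice[C EC] : forall jt, exists C, measurable (C : set (borel (noise R))) /\
    nxi r jt.1 jt.2 @^-1` C = E (Some (inr jt)).
  by move=> jt; have [C mC <-] := srcE (Some (inr jt)); exists C.
have bigcapE : \bigcap_(i in setT) E i =
    \bigcap_(jt in [set: 'I_N * 'I_T]) (nxi r jt.1 jt.2 @^-1` C jt) `&`
    \bigcap_(j in [set: 'I_N]) (nX r j ord0 @^-1` B j) `&` E None.
  apply/seteqP; split=> [w Ew|w [[wC wB] wE] [[j|jt]|] _//].
  - split; last exact: Ew.
    split=> [jt _|j _]; first by rewrite (EC jt).2; exact: Ew.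
    by rewrite EB; exact: Ew.
  - by rewrite -EB; exact: wB.
  - by rewrite -(EC jt).2; exact: wC.
rewrite bigcapE (nindep r); last exact: (srcE None).
- rewrite (proj2 (Nr_iid r)); last by move=> jt; have [] := EC jt.
  have -> : P (\bigcap_(j in [set: 'I_N]) (nX r j ord0 @^-1` B j)) =
      (\prod_j P (nX r j ord0 @^-1` B j))%E.
    under eq_bigr do rewrite law_X.
    rewrite -(mN_product (fun=> @measurable_disc _ _)).
    rewrite -(Nr_lawX0 r (@measurable_disc _ _)); congr (P _).
    apply/seteqP; split=> w /= Bw j; first by rewrite ffunE; exact: Bw.
    by move=> _; have := Bw j; rewrite ffunE.
  rewrite (bigD1 None)//= [RHS]muleC; congr (_ * _)%E; rewrite muleC.
  rewrite (bigID (fun i => if i is Some (inl _) then true else false))/=.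
  congr (_ * _)%E.
    rewrite [RHS](reindex_omap (fun j => Some (inl j))
      (fun i => if i is Some (inl j) then Some j else None)); last by case=> [[j|jt]|].
    by apply: eq_big => [j|j _]; rewrite /= ?eqxx// EB.
  rewrite [RHS](reindex_omap (fun jt => Some (inr jt))
      (fun i => if i is Some (inr jt) then Some jt else None)); last by case=> [[j|jt]|].
  by apply: eq_big => [jt|jt _]; rewrite /= ?eqxx// (EC jt).2.
- exact: (@sigma_gen_bigcap _ _ _ _ (fun jt => nxi r jt.1 jt.2) C (fun jt => (EC jt).1)).
- exact: (@sigma_gen_bigcap _ _ _ (disc X) (fun j => nX r j ord0) B (fun j => @measurable_disc _ _)).
Qed.

Lemma src_rPhi a : src None (rPhi @^-1` [set a]).
Proof.
rewrite (_ : _ @^-1` _ = \bigcap_(j in [set: 'I_N]) (nPhi r j @^-1` [set a j])).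
  exact: (@sigma_gen_bigcap _ _ _ (disc strat) (fun j => nPhi r j)
    (fun j => [set a j]) (fun j => @measurable_disc _ _)).
apply/seteqP; split=> w /=; first by move=> <- j _ /=; rewrite ffunE.
by move=> e; apply/ffunP => j; rewrite ffunE; exact: e.
Qed.

Definition rpath b u (w : Om) : strats * paths := (rPhi w, [ffun k : 'I_T.+1 => rgame b u k w]).

Lemma measurable_rpath b u e : measurable (rpath b u @^-1` [set e]).
Proof.
rewrite (_ : _ @^-1` _ = rPhi @^-1` [set e.1] `&`
    \bigcap_(k in [set: 'I_T.+1]) (rgame b u k @^-1` [set e.2 k])).
  apply: measurableI; first exact: measurable_rPhi.
  apply: fin_bigcap_measurable => [|k _]; first exact: finite_finset.
  exact: measurable_rgame.
case: e => a x; apply/seteqP; split=> w /=; rewrite /rpath.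
  by move=> [<- <-]; split => // k _ /=; rewrite ffunE.
by move=> [-> xw]; congr pair; apply/ffunP => k; rewrite ffunE; exact: xw.
Qed.

End one_realization.

(** The probability of a trajectory e of the game.  It involves the initial
   laws only, which makes the costs independent of the realization, and its
   invariance under permutations of the players can be read off. *)
Definition path_prob b u (e : strats * paths) : \bar R :=
  (gamma [set e.1] * \prod_j m0N [set e.2 ord0 j] *
   \prod_(jt : 'I_N * 'I_T) @nu R
     [set z | game_step Psi b u jt.2 e.1 (e.2 (now jt.2)) jt.1 z = e.2 (Defs.next jt.2) jt.1])%E.

(** Each step of a trajectory is an event of one noise, so that the trajectories
   are rectangles of independent sources. *)
Lemma path_law u0 i0 (r : N_realization Psi mN gamma u0 i0) b u e :
  Nr_P r (rpath (r:=r) b u @^-1` [set e]) = path_prob b u e.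
Proof.
case: e => a x.
pose E (i : option ('I_N + 'I_N * 'I_T)) : set (Nr_Omega r) :=
  match i with
  | None => rPhi (r:=r) @^-1` [set a]
  | Some (inl j) => nX r j ord0 @^-1` [set x ord0 j]
  | Some (inr jt) => nxi r jt.1 jt.2 @^-1`
     [set z | game_step Psi b u jt.2 a (x (now jt.2)) jt.1 z = x (Defs.next jt.2) jt.1]
  end.
have mC (jt : 'I_N * 'I_T) := measurable_game_step Psi_measurable b u jt.2 a
  (x (now jt.2)) jt.1 (x (Defs.next jt.2) jt.1).
have srcE i : src (r:=r) i (E i).
  case: i => [[j|jt]|] /=; [by exists [set x ord0 j]|by eexists; first exact: mC|].
  exact: src_rPhi.
rewrite (_ : _ @^-1` _ = \bigcap_(i in setT) E i).
  rewrite (src_indep srcE) (bigD1 None)//= law_rPhi /path_prob -muleA; congr (_ * _)%E.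
  rewrite (bigID (fun i => if i is Some (inl _) then true else false))/=.
  congr (_ * _)%E.
    rewrite [LHS](reindex_omap (fun j => Some (inl j))
      (fun i => if i is Some (inl j) then Some j else None)); last by case=> [[j|jt]|].
    by apply: eq_big => [j|j _]; rewrite /= ?eqxx// law_X.
  rewrite [LHS](reindex_omap (fun jt => Some (inr jt))
      (fun i => if i is Some (inr jt) then Some jt else None)); last by case=> [[j|jt]|].
  apply: eq_big => [jt|jt _]; rewrite /= ?eqxx//.
  exact: (proj1 (Nr_iid r) jt _ (mC jt)).
apply/seteqP; split=> w.
  move=> /= [ea ex] [[j|jt]|] _ //=.
    by rewrite -ex ffunE /rgame /= ffunE.
  by rewrite -ea -ex !ffunE /rgame gameS.
move=> Ew; have ea : rPhi (r:=r) w = a := Ew None I.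
rewrite /= /rpath ea; congr pair; apply/ffunP => -[k kT]; rewrite ffunE /=.
elim: k kT => [|k ih] kT.
  rewrite (_ : Ordinal kT = ord0); last exact: val_inj.
  by apply/ffunP => j; rewrite /rgame /= ffunE; exact: (Ew (Some (inl j)) I).
have kT' : (k < T)%N by [].
have kT1 : (k < T.+1)%N := ltnW kT'.
rewrite (_ : Ordinal kT = Defs.next (Ordinal kT')); last exact: val_inj.
apply/ffunP => j; rewrite /rgame -[k.+1]/((Ordinal kT' : nat).+1) gameS.
rewrite -[game _ _ _ _ _ _ _]/(rgame (r:=r) b u k w) (ih kT1) ea.
have := Ew (Some (inr (j, Ordinal kT'))) I => /=.
by rewrite (_ : now (Ordinal kT') = Ordinal kT1)//; exact: val_inj.
Qed.

Lemma Ex_path u0 i0 (r : N_realization Psi mN gamma u0 i0) b u (H : strats * paths -> R) :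
  Ex (Nr_P r) (H \o rpath (r:=r) b u) = \sum_e H e * fine (path_prob b u e).
Proof.
rewrite Ex_fin; last exact: measurable_rpath.
by apply: eq_bigr => e _; rewrite path_law.
Qed.

Variable f : 'I_T -> X -> PX -> Gamma -> R.
Variable F : X -> PX -> R.

Definition player_cost (u : strat -> strat) (e : strats * paths) : R :=
  \sum_(t < T) f t (e.2 (now t) ord0) (emp true (e.2 (now t)) ord0)
                 (u (e.1 ord0) (t, e.2 (now t) ord0))
  + F (e.2 ord_max ord0) (emp true (e.2 ord_max) ord0).

Lemma Nr_X_game u (r : N_realization Psi mN gamma u ord0) :
  {ae Nr_P r, forall w, forall (t : 'I_T.+1) j,
     nX r j t w = rgame (r:=r) true u t w j}.
Proof.
apply: filterS (Nr_dynamics r) => w dyn [k kT] /=.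
elim: k kT => [|k ih] kT j.
  rewrite (_ : Ordinal kT = ord0); last exact: val_inj.
  by rewrite /rgame /= ffunE.
have kT' : (k < T)%N by [].
have kT1 : (k < T.+1)%N := ltnW kT'.
rewrite (_ : Ordinal kT = Defs.next (Ordinal kT')); last exact: val_inj.
rewrite dyn /rgame -[k.+1]/((Ordinal kT' : nat).+1) gameS.
rewrite -[game _ _ _ _ _ _ _]/(rgame (r:=r) true u k w).
rewrite (_ : now (Ordinal kT') = Ordinal kT1); last exact: val_inj.
rewrite /game_step /played rPhiE -ih /emp; congr (Psi _ _ _ _ _).
by apply: eq_empirical => i _; rewrite /view /= ih.
Qed.

Lemma N_cost_game u (r : N_realization Psi mN gamma u ord0) :
  N_cost f F r = Ex (Nr_P r) (player_cost u \o rpath (r:=r) true u).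
Proof.
rewrite /N_cost unlock; apply: Ex_ae.
- pose U (w : Nr_Omega r) : strats * paths :=
    (rPhi (r:=r) w, [ffun t => [ffun j => nX r j t w]]).
  apply: (bmeas_factor (U := U)).
    move=> [a x]; rewrite (_ : _ @^-1` _ = rPhi (r:=r) @^-1` [set a] `&`
        \bigcap_(jt in [set: 'I_N * 'I_T.+1]) (nX r jt.1 jt.2 @^-1` [set x jt.2 jt.1])).
      apply: measurableI; first exact: measurable_rPhi.
      apply: fin_bigcap_measurable => [|jt _]; first exact: finite_finset.
      exact: (measurable_preimage (nmX r jt.1 jt.2) (@measurable_disc X _)).
    apply/seteqP; split=> w; rewrite /U /=.
      by move=> [-> <-]; split => // jt _ /=; rewrite !ffunE.
    move=> [-> xw]; congr pair; apply/ffunP => t; apply/ffunP => j; rewrite !ffunE.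
    exact: (xw (j, t)).
  move=> w w' [ea ex].
  have eX j t : nX r j t w = nX r j t w'.
    by move/ffunP: ex => /(_ t)/ffunP/(_ j); rewrite !ffunE.
  have eP : nPhi r ord0 w = nPhi r ord0 w'.
    by move/ffunP: ea => /(_ ord0); rewrite !ffunE.
  have em t : Nr_mu (r:=r) ord0 t w = Nr_mu (r:=r) ord0 t w'.
    by apply: eq_empirical => j _; exact: eX.
  by rewrite eX em; congr (_ + _); apply: eq_bigr => t _; rewrite eX em eP.
- exact: (bmeas_fin _ (measurable_rpath r true u)).
- apply: filterS (Nr_X_game r) => w e /=.
  have em t : Nr_mu (r:=r) ord0 t w = emp true (rgame (r:=r) true u t w) ord0.
    by apply: eq_empirical => j _; rewrite /view /= e.
  rewrite /player_cost /= !ffunE !e em; congr (_ + _).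
  by apply: eq_bigr => t _; rewrite !ffunE !e em.
Qed.

(** The undisturbed game and all its deviations are compared on one sample
   space. *)
Definition N_deviate u (r : N_realization Psi mN gamma id ord0) :
  N_realization Psi mN gamma u ord0.
Proof.
apply: (@NRealization _ _ _ _ _ _ _ _ _ _ _ (Nr_Omega r) (Nr_P r) (nPhi r)
  (fun j t w => rgame (r:=r) true u t w j) (nxi r)).
- exact: Nr_mPhi.
- move=> j t _ B _; rewrite setTI.
  exact: (fin_measurable_set (measurable_rgame r true u t) [set x : states | B (x j)]).
- exact: Nr_mxi.
- have E w : [ffun j => rgame (r:=r) true u (ord0 : 'I_T.+1) w j] = rX0 (r:=r) w :> states.
    by apply/ffunP => j; rewrite ffunE.
  by move=> B mB; rewrite -(Nr_lawX0 r mB); congr (Nr_P r (_ @^-1` B)); apply/funext.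
- exact: Nr_lawPhi.
- exact: Nr_iid.
- move=> A1 A2 A3 h1 h2 h3; apply: (nindep r) => //.
  rewrite (_ : (fun j => Nr_X j ord0 : _ -> disc X) = 
    (fun j w => rgame (r:=r) true u (ord0 : 'I_T.+1) w j : disc X))//.
  by apply/funext => j; apply/funext => w; rewrite /rgame /= ffunE.
- apply: aeW => w t j.
  rewrite /rgame -[nat_of_ord (Defs.next t)]/(t.+1) gameS /game_step /played rPhiE.
  by [].
Defined.

(** All realizations give the same cost, and [N_deviate] provides one on the
   sample space of the undisturbed game. *)
Lemma J_N_game u (r : N_realization Psi mN gamma id ord0) :
  J_N Psi f F mN gamma u ord0 = Ex (Nr_P r) (player_cost u \o rpath (r:=r) true u).
Proof.
rewrite /J_N; set C := [set c | _]; have [r' ->] : C (xget 0 C).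
  by apply: (@xgetI _ _ _ (N_cost f F (N_deviate u r))); exists (N_deviate u r).
by rewrite N_cost_game !Ex_path.
Qed.

(** * Exchangeability of the players *)

Definition permute (s : 'S_N) (e : strats * paths) : strats * paths :=
  ([ffun j => e.1 (s j)], [ffun k => [ffun j => e.2 k (s j)]]).

Hypothesis gamma_symmetric : symmetric_law gamma.

Lemma emp_permute (s : 'S_N) (x : states) j :
  emp true [ffun i => x (s i)] j = emp true x (s j) :> PX.
Proof.
apply: mass_inj => y; rewrite /emp !mass_empirical; congr (_ * _).
rewrite [RHS](reindex_inj (@perm_inj _ s)) /=; apply: eq_big => i.
  by rewrite (inj_eq perm_inj).
by rewrite /view /= ffunE.
Qed.

Lemma path_prob_permute (s : 'S_N) e :
  path_prob true id (permute s e) = path_prob true id e.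
Proof.
case: e => a x; rewrite /path_prob /=; congr (_ * _ * _)%E.
- rewrite -(gamma_symmetric s (@measurable_disc strats [set ([ffun j => a (s j)] : strats)])).
  congr (gamma _); apply/seteqP; split=> b /=; last by move=> ->.
  move=> /ffunP e; apply/ffunP => j.
  by have := e (s^-1 j)%g; rewrite !ffunE permKV.
- rewrite [RHS](reindex_inj (@perm_inj _ s)) /=.
  by apply: eq_bigr => j _; rewrite !ffunE.
- rewrite [RHS](reindex (fun jt : 'I_N * 'I_T => (s jt.1, jt.2))) /=; last first.
    by exists (fun jt => ((s^-1)%g jt.1, jt.2)) => -[j t] _; rewrite /= ?permK ?permKV.
  apply: eq_bigr => -[j t] _ /=; congr (@nu R _); apply/seteqP.
  have E z : game_step Psi true id t [ffun j => a (s j)]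
      ([ffun k => [ffun j => x k (s j)]] (now t)) j z =
      game_step Psi true id t a (x (now t)) (s j) z.
    rewrite /game_step /played !ffunE emp_permute; congr (Psi _ _ _ _ _).
    by case: ifP => _; case: ifP => _.
  by split=> z /=; rewrite E !ffunE.
Qed.

(** Averages over trajectories can be reindexed by a permutation of the players. *)
Lemma exchange u0 i0 (r : N_realization Psi mN gamma u0 i0) (s : 'S_N) (H : strats * paths -> R) :
  Ex (Nr_P r) (H \o permute s \o rpath (r:=r) true id) =
  Ex (Nr_P r) (H \o rpath (r:=r) true id).
Proof.
rewrite (Ex_path r true id (H \o permute s)) Ex_path.
have pK s' : cancel (permute s') (permute (s'^-1)%g).
  move=> [a x]; rewrite /permute /=; congr pair; apply/ffunP => k.
    by rewrite !ffunE permKV.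
  by apply/ffunP => j; rewrite !ffunE permKV.
rewrite [RHS](reindex_inj (can_inj (pK s))) /=.
by apply: eq_bigr => e _; rewrite path_prob_permute.
Qed.

End realization.

(** * Decoupling a player from the others *)

Section full_measurable.
Context {E : pointedType}.

(** The finite tuples describing a state of both games get the discrete
   sigma-algebra, to form measurable products with the noise space. *)
Definition full : Type := g_sigma_algebraType [set: set E].

HB.instance Definition _ := Measurable.on full.

Lemma measurable_full (B : set full) : measurable B.
Proof. exact: sub_sigma_algebra. Qed.

End full_measurable.
Arguments full : clear implicits.

Section decoupling.
Context {R : realType} {T : nat} {X Gamma : pfinType} {n : nat}.
Local Notation PX := (prob R (disc X)).
Local Notation strat := (strategy T X Gamma).
Local Notation flow := (flow R T X Gamma).
Local Notation N := n.+2.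
Local Notation strats := (fpow 'I_N strat).
Local Notation states := (fpow 'I_N X).
Local Notation paths := {ffun 'I_T.+1 -> states}.
Variable Psi : 'I_T -> X -> PX -> Gamma -> noise R -> X.
Hypothesis Psi_measurable : forall t : 'I_T, measurable_fun setT
  (fun q : borel (disc X) * borel PX * borel (disc Gamma) * borel (noise R) =>
     Psi t q.1.1.1 q.1.1.2 q.1.2 q.2 : borel (disc X)).
Variables (mN : prob R (disc states)) (gamma : prob R (disc strats)) (m0N : PX).
Hypothesis mN_product : product_law mN m0N.
Context {u0 : strat -> strat} {i0 : 'I_N}.
Variable r : N_realization Psi mN gamma u0 i0.
Local Notation Om := (Nr_Omega r).
Local Notation P := (Nr_P r).

Definition flow_of (b : bool) (e : strats * paths) : flow :=
  (e.1 ord0, fun t => emp b (e.2 t) ord0).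

Let V u (w : Om) : borel flow := flow_of false (rpath (r:=r) false u w).

Let mV u : measurable_fun setT (V u).
Proof.
move=> _ B _; rewrite setTI.
exact: (fin_measurable_set (measurable_rpath Psi_measurable r false u)
  [set e | B (flow_of false e)]).
Qed.

Let other (i : option ('I_N + 'I_N * 'I_T)) : bool :=
  match i with
  | None => true
  | Some (inl j) => j != ord0
  | Some (inr jt) => jt.1 != ord0
  end.

(** What player 0 sees in the decoupled game is unchanged when its initial state
   and noises are replaced by constants. *)
Let V_others u (A : set (borel flow)) : gen (src (r:=r)) other (V u @^-1` A).
Proof.
pose W' := g_sigma_algebraType (\bigcup_(i in [set i | other i]) src (r:=r) i).
have m i B : other i -> src (r:=r) i B -> measurable (B : set W').
  by move=> oi iB; apply: sub_sigma_algebra; exists i.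
pose X0' (w : W') : states := [ffun j => if j == ord0 then point else nX r j ord0 w].
pose xi' (j : 'I_N) (t : 'I_T) (w : W') : noise R :=
  if j == ord0 then point else nxi r j t w.
pose g (k : nat) (w : W') := game Psi false u (rPhi (r:=r) w) (X0' w) (fun j t => xi' j t w) k.
have mPhi a : measurable ((rPhi (r:=r) : W' -> strats) @^-1` [set a]).
  by apply: (m None) => //; exact: src_rPhi.
have mX0 a : measurable (X0' @^-1` [set a]).
  rewrite (_ : _ @^-1` _ = \bigcap_(j in [set: 'I_N])
     (fun w : W' => X0' w j) @^-1` [set a j]); last first.
    apply/seteqP; split=> w /=; first by move=> <- j _.
    by move=> e; apply/ffunP => j; exact: e.
  apply: fin_bigcap_measurable => [|j _]; first exact: finite_finset.
  have -> : (fun w : W' => X0' w j) =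
      (fun w => if j == ord0 then point else nX r j ord0 w).
    by apply/funext => w; rewrite /X0' ffunE.
  have [_|j0] := eqVneq j ord0; last by apply: (m (Some (inl j))) => //; exists [set a j].
  by rewrite preimage_cst; case: ifP => _; [exact: measurableT|exact: measurable0].
have mg k x : measurable (g k @^-1` [set x]).
  apply: (measurable_game Psi_measurable false u mPhi mX0) => j t _.
  rewrite /xi'; have [_|j0] := eqVneq j ord0; first exact: measurable_cst.
  by move=> _ B mB; rewrite setTI; apply: (m (Some (inr (j, t)))) => //; exists B.
pose p (w : W') : strats * paths := (rPhi (r:=r) w, [ffun k : 'I_T.+1 => g k w]).
have mp e : measurable (p @^-1` [set e]).
  rewrite (_ : _ @^-1` _ = (rPhi (r:=r) : W' -> strats) @^-1` [set e.1] `&`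
      \bigcap_(k in [set: 'I_T.+1]) (g k @^-1` [set e.2 k])).
    apply: measurableI => //.
    by apply: fin_bigcap_measurable => [|k _]; first exact: finite_finset.
  case: e => a x; apply/seteqP; split=> w /=; rewrite /p.
    by move=> [<- <-]; split => // k _ /=; rewrite ffunE.
  by move=> [-> xw]; congr pair; apply/ffunP => k; rewrite ffunE; exact: xw.
have := fin_measurable_set mp [set e | A (flow_of false e)].
congr measurable; apply/seteqP; split=> w; rewrite /V /flow_of /=.
all: rewrite (_ : (fun t => emp false ([ffun k : 'I_T.+1 => g k w] t) ord0) =
  (fun t => emp false ([ffun k : 'I_T.+1 => rgame (r:=r) false u k w] t) ord0 : PX))//.
all: apply/funext => t; rewrite !ffunE; apply: emp_eq => j j0.
all: apply: decoupled_others => // i i0'; rewrite ?ffunE ?(negbTE i0')//.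
all: by apply/funext => s; rewrite /xi' (negbTE i0').
Qed.

Let V_indep u (A : set (borel flow)) (B : set (borel (disc X)))
    (C : 'I_T -> set (borel (noise R))) :
  measurable A -> (forall t, measurable (C t)) ->
  P (V u @^-1` A `&` nX r ord0 ord0 @^-1` B `&`
     \bigcap_(t in setT) (nxi r ord0 t @^-1` C t)) =
  (P (V u @^-1` A) * P (nX r ord0 ord0 @^-1` B) *
   \prod_t P (nxi r ord0 t @^-1` C t))%E.
Proof.
move=> _ mC.
pose E (i : option ('I_N + 'I_N * 'I_T)) : set Om :=
  match i with
  | None => setT
  | Some (inl j) => if j == ord0 then nX r j ord0 @^-1` B else setT
  | Some (inr jt) => if jt.1 == ord0 then nxi r ord0 jt.2 @^-1` C jt.2 else setT
  end.
have srcE i : src (r:=r) i (E i).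
  case: i => [[j|[j t]]|] /=; last exact: (@src_setT _ _ _ _ _ _ _ _ _ _ r None).
    case: eqP => [->|_]; last by exists setT.
    by exists B.
  case: eqP => [->|_]; last by exists setT.
  by exists (C t).
have := @indep_split _ _ _ P _ (src (r:=r)) (@src_measurable _ _ _ _ _ _ _ _ _ _ r)
  (@src_setI _ _ _ _ _ _ _ _ _ _ r) (@src_setT _ _ _ _ _ _ _ _ _ _ r)
  (src_indep mN_product (r:=r)) other _ E (V_others u A) srcE.
rewrite -setIA (_ : _ `&` \bigcap_(t in setT) _ =
  \bigcap_(i in [set i | ~~ other i]) E i); last first.
  apply/seteqP; split=> [w [wB wC] [[j|[j t]]|] //=|w Ew].
  - by rewrite negbK => /eqP ->.
  - by rewrite negbK => /eqP ->; exact: wC.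
  - split=> [|t _]; first exact: (Ew (Some (inl ord0))).
    exact: (Ew (Some (inr (ord0, t)))).
move=> ->; rewrite -muleA; congr (_ * _)%E.
rewrite (bigD1 (Some (inl ord0)))//=; congr (_ * _)%E.
rewrite [LHS](reindex_omap (fun t => Some (inr (ord0, t)))
  (fun i => if i is Some (inr jt) then Some jt.2 else None)).
  by apply: eq_big => [t|t _]; rewrite /= ?eqxx.
by case=> [[j|[j t]]|]//=; rewrite negbK => /andP[/eqP ->]//; rewrite eqxx.
Qed.

Lemma decoupled_chain u k w :
  chain (mf_step Psi u) (V u w) (nX r ord0 ord0 w) (fun t => nxi r ord0 t w) k =
  rgame (r:=r) false u k w ord0.
Proof.
elim: k => [|k ih]; first by rewrite /rgame /= ffunE.
rewrite /rgame /=; case: insubP => [t _ tk|_]; last exact: ih.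
rewrite ih ffunE /mf_step /game_step /played /= ffunE.
by rewrite /rgame -tk !ffunE.
Qed.

(** In the decoupled game player 0 is a mean field player: the environment made
   by the others is independent of its initial state and noises. *)
Lemma decoupled_marginal u (h : flow -> R) k y : bmeas (h : borel flow -> R) ->
  Ex P (fun w => h (V u w) * \1_[set w | rgame (r:=r) false u k w ord0 = y] w) =
  Ex P (fun w => h (V u w) * occ Psi u (mass m0N) k y (V u w)).
Proof.
move=> bh; have := chain_marginal (P := P) (V := V u) (X0 := nX r ord0 ord0)
  (xi := nxi r ord0) (m0 := m0N) (nu := @nu R) (measurable_mf_step Psi_measurable u)
  (mV u) (nmX r ord0 ord0) (nmxi r ord0) (law_X mN_product r ord0)
  (fun t B mB => proj1 (Nr_iid r) (ord0, t) B mB) (@V_indep u) k y bh.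
by move=> <-; congr Ex; apply/funext => w; congr (_ * _);
  rewrite (_ : [set w | _] = [set w | rgame (r:=r) false u k w ord0 = y])//;
  apply/seteqP; split=> w' /=; rewrite decoupled_chain.
Qed.

(** Continuity in probability of the system function, uniformly in time, state
   and action. *)
Definition modulus (eps delta : R) := forall (t : 'I_T) x a (m m' : PX),
  dist m m' < delta ->
  fine (@nu R [set z | Psi t x m a z != Psi t x m' a z]) <= eps.

Definition discrepancy u (k : nat) (j : 'I_N) : set Om :=
  [set w | rgame (r:=r) true u k w j != rgame (r:=r) false u k w j].

Let U u k (w : Om) : (strats * states * states)%type :=
  (rPhi (r:=r) w, rgame (r:=r) true u k w, rgame (r:=r) false u k w).

Let preU u k e : U u k @^-1` [set e] = rPhi (r:=r) @^-1` [set e.1.1] `&`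
  rgame (r:=r) true u k @^-1` [set e.1.2] `&` rgame (r:=r) false u k @^-1` [set e.2].
Proof.
case: e => -[a x] y; apply/seteqP; split=> w /=; rewrite /U; first by move=> [-> -> ->].
by move=> [[-> ->] ->].
Qed.

Let measurable_U u k e : measurable (U u k @^-1` [set e]).
Proof.
rewrite preU; apply: measurableI; first apply: measurableI.
- exact: measurable_rPhi.
- exact: measurable_rgame.
- exact: measurable_rgame.
Qed.

Lemma measurable_discrepancy u k j : measurable (discrepancy u k j).
Proof.
rewrite (_ : discrepancy u k j = U u k @^-1` [set e : (strats * states * states)%type | e.1.2 j != e.2 j])//.
by apply: fin_measurable_set; exact: measurable_U.
Qed.

Let past (k : nat) (i : option ('I_N + 'I_N * 'I_T)) : bool :=
  if i is Some (inr jt) then (jt.2 < k)%N else true.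

(** The states of both games at time k depend on the sources preceding the noise
   of the step from k. *)
Let U_past u k B : gen (src (r:=r)) (past k) (U u k @^-1` B).
Proof.
pose W' := g_sigma_algebraType (\bigcup_(i in [set i | past k i]) src (r:=r) i).
have m i A : past k i -> src (r:=r) i A -> measurable (A : set W').
  by move=> oi iA; apply: sub_sigma_algebra; exists i.
have mPhi a : measurable ((rPhi (r:=r) : W' -> strats) @^-1` [set a]).
  by apply: (m None) => //; exact: src_rPhi.
have mX0 a : measurable ((rX0 (r:=r) : W' -> states) @^-1` [set a]).
  rewrite (_ : _ @^-1` _ = \bigcap_(j in [set: 'I_N])
     (nX r j ord0 : W' -> X) @^-1` [set a j]); last first.
    apply/seteqP; split=> w /=; first by move=> <- j _ /=; rewrite ffunE.
    by move=> e; apply/ffunP => j; rewrite ffunE; exact: e.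
  apply: fin_bigcap_measurable => [|j _]; first exact: finite_finset.
  by apply: (m (Some (inl j))) => //; exists [set a j].
have mg b x : measurable ((rgame (r:=r) b u k : W' -> states) @^-1` [set x]).
  apply: (measurable_game Psi_measurable b u mPhi mX0) => j t tk.
  by move=> _ C mC; rewrite setTI; apply: (m (Some (inr (j, t)))) => //; exists C.
apply: (@fin_measurable_set _ W' _ (U u k)) => e.
by rewrite preU; apply: measurableI => //; exact: measurableI.
Qed.

(** A player whose states agree at time t has different states at time t+1 only if
   its noise separates the two empirical measures.  This has probability at most
   eps if these are within delta; otherwise Markov's inequality applies to their
   distance, whose mean is at most 1/(n+1) + eta by [dist_emp]. *)
Lemma coupling_step u (t : 'I_T) (eps delta eta : R) : 0 <= eps -> 0 < delta ->
  modulus eps delta -> (forall j, fine (P (discrepancy u t j)) <= eta) ->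
  forall j, fine (P (discrepancy u t.+1 j)) <=
    eta + eps + delta^-1 * (n.+1%:R^-1 + eta).
Proof.
move=> eps0 delta0 modP etaP j.
pose E := full (strats * states * states)%type.
pose D (e : E) := dist (emp true e.1.2 j : PX) (emp false e.2 j).
pose A := [set q : E * borel (noise R) |
  (q.1.1.2 j == q.1.2 j) &&
  (game_step Psi true u t q.1.1.1 q.1.1.2 j q.2 !=
   game_step Psi false u t q.1.1.1 q.1.2 j q.2)].
(* A is the event that equal states of j become different. *)
have mAe e : measurable ([set z | A (e, z)] : set (borel (noise R))).
  rewrite (_ : [set z | _] = if e.1.2 j == e.2 j then
      ~` (\bigcup_(x in [set: X]) ([set z | game_step Psi true u t e.1.1 e.1.2 j z = x] `&`
         [set z | game_step Psi false u t e.1.1 e.2 j z = x])) else set0).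
    case: ifP => // _; apply: measurableC; apply: fin_bigcup_measurable => // x _.
    by apply: measurableI; exact: measurable_game_step.
  apply/seteqP; split=> z; rewrite /A /=.
    by move=> /andP[-> ne] [x _ [/= e1 e2]]; rewrite e1 e2 eqxx in ne.
  case: ifP => // _ ne; apply/eqP => e1; apply: ne.
  by exists (game_step Psi false u t e.1.1 e.2 j z).
have mA : measurable A.
  rewrite (_ : A = \bigcup_(e in [set: E]) ([set e] `*` [set z | A (e, z)])).
    apply: fin_bigcup_measurable => [|e _]; first exact: finite_finset.
    by apply: measurableX; [exact: measurable_full|exact: mAe].
  by apply/seteqP; split=> [[e z] Aez|[e z] [e' _ [/= -> ]]//]; exists e.
have mU : measurable_fun setT (U u t : Om -> E).
  by move=> _ B _; rewrite setTI; exact: (fin_measurable_set (measurable_U u t)).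
have ind B (C : set (borel (noise R))) : measurable (B : set E) -> measurable C ->
    P ((U u t : Om -> E) @^-1` B `&` nxi r j t @^-1` C) =
    (P ((U u t : Om -> E) @^-1` B) * @nu R C)%E.
  move=> _ mC; rewrite -(proj1 (Nr_iid r) (j, t) C mC).
  apply: (indep_gen1 (@src_measurable _ _ _ _ _ _ _ _ _ _ r)
    (@src_setI _ _ _ _ _ _ _ _ _ _ r) (@src_setT _ _ _ _ _ _ _ _ _ _ r)
    (src_indep mN_product (r:=r)) (M := past t) (i := Some (inr (j, t)))).
  - by rewrite /= ltnn.
  - exact: U_past.
  - by exists C.
have step := integrate_noise mU (nmxi r j t) ind (bmeas_cst (1 : R)) mA.
have bfac (h : E -> R) : bmeas (h \o U u t) by exact: (bmeas_fin _ (measurable_U u t)).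
have bA : bmeas (fun w => 1 * \1_A (U u t w, nxi r j t w) : R).
  apply: bmeasM; first exact: bmeas_cst.
  exact: (bmeas_comp (measurable_fun_pair mU (nmxi r j t)) (bmeas_indic mA)).
have bd k i : bmeas (\1_(discrepancy u k i) : Om -> R).
  by apply: bmeas_indic; exact: measurable_discrepancy.
have E1 : Ex P (\1_(discrepancy u t.+1 j)) <=
    Ex P (\1_(discrepancy u t j)) + Ex P (fun w => 1 * \1_A (U u t w, nxi r j t w)).
  rewrite -ExD//; apply: le_Ex => //; first exact: bmeasD.
  move=> w; rewrite mul1r.
  have [dw|ndw] := pselect (discrepancy u t j w).
    apply: (@le_trans _ _ 1); first by rewrite indicE lern1 leq_b1.
    by rewrite [X in _ <= X + _]indicE mem_set// lerDl indicE ler0n.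
  have [dw|ndw'] := pselect (discrepancy u t.+1 j w).
    rewrite [X in _ <= _ + X]indicE mem_set.
      apply: (@le_trans _ _ 1); first by rewrite indicE lern1 leq_b1.
      by rewrite lerDr indicE ler0n.
    rewrite /A /U /=; apply/andP; split; first by apply/negPn/negP.
    by move: dw; rewrite /discrepancy /rgame /= !gameS.
  by rewrite [X in X <= _]indicE memNset// addr_ge0// indicE ler0n.
have E2 : Ex P (fun w => 1 * fine (@nu R (xsection A (U u t w)))) <=
    Ex P (fun w => eps + delta^-1 * D (U u t w)).
  apply: le_Ex.
  - exact: (bfac (fun e => 1 * fine (@nu R (xsection A e)))).
  - exact: (bfac (fun e => eps + delta^-1 * D e)).
  move=> w; rewrite mul1r; set e := U u t w.
  have mxA : measurable (xsection A e) by exact: measurable_xsection.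
  have [lt|ge] := ltP (D e) delta; last first.
    apply: (@le_trans _ _ 1); first exact: prob_le1.
    rewrite (@le_trans _ _ (delta^-1 * D e))//; last by rewrite lerDr.
    by rewrite ler_pdivlMl// mulr1.
  apply: (@le_trans _ _ eps); last first.
    by rewrite lerDl mulr_ge0 ?invr_ge0 ?(ltW delta0)// dist_ge0.
  apply: le_trans (modP t (e.1.2 j) (played u e.1.1 j (t, e.1.2 j)) _ _ lt).
  apply: prob_mono => //.
    rewrite (_ : [set z | _] = ~` \bigcup_(x in [set: X])
      ([set z | game_step Psi true u t e.1.1 e.1.2 j z = x] `&`
       [set z | Psi t (e.1.2 j) (emp false e.2 j) (played u e.1.1 j (t, e.1.2 j)) z = x])).
      apply: measurableC; apply: fin_bigcup_measurable => // x _.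
      apply: measurableI; first exact: measurable_game_step.
      exact: (measurable_preimage (measurable_Psi Psi_measurable _ _ _ _) (@measurable_disc X [set x])).
    apply/seteqP; split=> z /=.
      by move=> /eqP ne [x _ [/= e1 e2]]; apply: ne; exact: etrans e1 (esym e2).
    move=> ne; apply/eqP => e1; apply: ne.
    by exists (game_step Psi true u t e.1.1 e.1.2 j z).
  move=> z; rewrite /xsection /= in_setE /A /= => /andP[/eqP e12].
  by rewrite /game_step e12.
have E3 : Ex P (fun w => eps + delta^-1 * D (U u t w)) <=
    eps + delta^-1 * (n.+1%:R^-1 * (1 + \sum_(i < N | i != j) eta)).
  pose Q (w : Om) := 1 + \sum_(i < N | i != j) (\1_(discrepancy u t i) w : R).
  have bsum : bmeas (fun w => \sum_(i < N | i != j) (\1_(discrepancy u t i) w : R)).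
    exact: bmeas_sum.
  have bQ : bmeas Q by apply: bmeasD => //; exact: bmeas_cst.
  have bnQ : bmeas (fun w => n.+1%:R^-1 * Q w) by apply: bmeasM => //; exact: bmeas_cst.
  have bdQ : bmeas (fun w => delta^-1 * (n.+1%:R^-1 * Q w)).
    by apply: bmeasM => //; exact: bmeas_cst.
  apply: (@le_trans _ _ (Ex P (fun w => eps + delta^-1 * (n.+1%:R^-1 * Q w)))).
    apply: le_Ex.
    - exact: (bfac (fun e => eps + delta^-1 * D e)).
    - by apply: bmeasD => //; exact: bmeas_cst.
    move=> w; rewrite lerD2l ler_wpM2l ?invr_ge0 ?(ltW delta0)//.
    apply: le_trans (dist_emp _ _ _) _; rewrite ler_wpM2l ?invr_ge0// lerD2l.
    apply: ler_sum => i _; rewrite indicE ler_nat.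
    case: (boolP (_ != _)) => // ne; rewrite lt0b; exact: mem_set.
  rewrite ExD//; last exact: bmeas_cst.
  rewrite Ex_cst lerD2l ExZl// ler_wpM2l ?invr_ge0 ?(ltW delta0)//.
  rewrite ExZl// ler_wpM2l ?invr_ge0// ExD//; last exact: bmeas_cst.
  rewrite Ex_cst lerD2l Ex_sum//; apply: ler_sum => i _.
  by rewrite Ex_indic//; exact: measurable_discrepancy.
rewrite -Ex_indic; last exact: measurable_discrepancy.
apply: (le_trans E1); rewrite -addrA; apply: lerD.
  by rewrite Ex_indic//; exact: measurable_discrepancy.
rewrite step; apply: (le_trans E2); apply: (le_trans E3).
rewrite lerD2l ler_wpM2l ?invr_ge0 ?(ltW delta0)//.
rewrite sumr_const (_ : #|_| = n.+1); last by rewrite (@eq_card _ _ (predC1 j))// cardC1 card_ord.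
by rewrite mulrDr mulr1 -[eta *+ _]mulr_natl mulrA mulVf// mul1r.
Qed.

End decoupling.

(** * Continuity of the mean field kernels *)

Section kernel_continuity.
Context {R : realType} {T : nat} {X Gamma : pfinType}.
Local Notation PX := (prob R (disc X)).
Local Notation strat := (strategy T X Gamma).
Local Notation flow := (flow R T X Gamma).
Variable Psi : 'I_T -> X -> PX -> Gamma -> noise R -> X.
Hypothesis Psi_measurable : forall t : 'I_T, measurable_fun setT
  (fun q : borel (disc X) * borel PX * borel (disc Gamma) * borel (noise R) =>
     Psi t q.1.1.1 q.1.1.2 q.1.2 q.2 : borel (disc X)).

Lemma measurable_Psi_eq t x m a y :
  measurable ([set z | Psi t x m a z = y] : set (borel (noise R))).
Proof.
exact: (measurable_preimage (measurable_Psi Psi_measurable t x m a)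
  (@measurable_disc X [set y])).
Qed.

Lemma measurable_Psi_neq t x m m' a :
  measurable ([set z | Psi t x m a z != Psi t x m' a z] : set (borel (noise R))).
Proof.
rewrite (_ : [set z | _] = ~` \bigcup_(y in [set: X])
    ([set z | Psi t x m a z = y] `&` [set z | Psi t x m' a z = y])).
  apply: measurableC; apply: fin_bigcup_measurable => // y _.
  by apply: measurableI; exact: measurable_Psi_eq.
apply/seteqP; split=> z /=.
  by move=> /eqP ne [y _ [/= e1 e2]]; apply: ne; rewrite e1 e2.
by move=> ne; apply/eqP => e; apply: ne; exists (Psi t x m a z).
Qed.

(** The function w is controlled to the right of 0 only, so that equal laws are
   treated apart. *)
Lemma modulus_exists (w : R -> R) : w s @[s --> 0^'+] --> 0 ->
  (forall (t : 'I_T) (x : X) (a : Gamma) (m m' : PX),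
     (\int[@nu R]_z (\1_[set z | Psi t x m a z <> Psi t x m' a z] z)%:E
       <= (w (dist m m'))%:E)%E) ->
  forall eps, 0 < eps -> exists2 delta, 0 < delta & modulus Psi eps delta.
Proof.
move=> w0 wP eps eps0.
have [d /= d0 dP] : \forall s \near 0^'+, `|0 - w s| < eps.
  by move: w0 => /(@cvgrPdist_lt _ R^o); apply.
exists d => // t x a m m' lt.
have [e0|ne0] := eqVneq (dist m m') 0.
  rewrite (dist_eq0 e0) (_ : [set z | _] = set0) ?measure0 ?ltW//.
  by apply/seteqP; split=> z //=; rewrite eqxx.
have dpos : 0 < dist m m' by rewrite lt_neqAle eq_sym ne0 dist_ge0.
have := wP t x a m m'.
rewrite (_ : [set z | _] = [set z | Psi t x m a z != Psi t x m' a z]); last first.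
  by apply/seteqP; split=> z /= /eqP.
have mn := measurable_Psi_neq t x m m' a.
rewrite integral_indic// setIT => le.
rewrite -lee_fin fineK ?fin_num_measure// (le_trans le)// lee_fin.
have := dP (dist m m'); rewrite /= !sub0r !normrN.
rewrite gtr0_norm// => /(_ lt dpos) => /ltW; apply: le_trans; exact: ler_norm.
Qed.

Hypothesis Psi_modulus : forall eps, 0 < eps ->
  exists2 delta, 0 < delta & modulus Psi eps delta.

Lemma Psi_prob_continuous t x a y :
  continuous (fun m : PX => fine (@nu R [set z | Psi t x m a z = y])).
Proof.
apply: (metrizes_continuousP dist_metrizes) => m e e0.
have e20 : 0 < e / 2 by rewrite divr_gt0.
have [d d0 dP] := Psi_modulus e20; exists d => // m' lt.
have le m1 m2 : dist m1 m2 < d -> fine (@nu R [set z | Psi t x m1 a z = y]) -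
    fine (@nu R [set z | Psi t x m2 a z = y]) <= e / 2.
  move=> lt'; rewrite lerBlDl; apply: (@le_trans _ _ (fine
    (@nu R ([set z | Psi t x m2 a z = y] `|` [set z | Psi t x m1 a z != Psi t x m2 a z])))).
    apply: prob_mono.
    - exact: measurable_Psi_eq.
    - by apply: measurableU; [exact: measurable_Psi_eq|exact: measurable_Psi_neq].
    - move=> z /= <-; have [e12|ne] := eqVneq (Psi t x m1 a z) (Psi t x m2 a z); last by right.
      by left; rewrite e12.
  apply: (@le_trans _ _ (fine (@nu R [set z | Psi t x m2 a z = y]) +
     fine (@nu R [set z | Psi t x m1 a z != Psi t x m2 a z]))).
    have m1m := measurable_Psi_eq t x m2 a y; have m2m := measurable_Psi_neq t x m1 m2 a.
    rewrite -fineD ?fin_num_measure// fine_le ?fin_num_measure//.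
    - exact: measurableU.
    - by rewrite fin_numD !fin_num_measure.
    - exact: measureU2.
  by rewrite lerD2l; exact: dP.
rewrite (@le_lt_trans _ _ (e / 2))//; last by rewrite ltr_pdivrMr// ltr_pMr// ltr1n.
by rewrite ler_norml lerNl opprB !le// dist_sym.
Qed.

Lemma kern_continuous u t x y :
  continuous (fun v : flow => kern (@nu R : probability (borel (noise R)) R) (mf_step Psi u) t v x y).
Proof.
apply: (flow_marginal_continuous (t := now t)
  (k := fun a m => fine (@nu R [set z | Psi t x m (u a (t, x)) z = y]))).
by move=> a; exact: Psi_prob_continuous.
Qed.

(** This is where the regularity of the system function in the measure carries
   over to the mean field dynamics. *)
Lemma occ_continuous u m k y : continuous (occ Psi u m k y).
Proof.
elim: k y => [|k ih] y; first by move=> v; exact: cvg_cst.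
rewrite /occ /=; case: insubP => [t _ _|_]; last exact: ih.
move=> v; apply: cvg_big => [|x _]; first exact: add_continuous.
by apply: cvgM; [exact: ih|exact: kern_continuous].
Qed.

End kernel_continuity.

(** * Propagation of chaos *)

Section limits.
Context {R : realType} {T : nat} {X Gamma : pfinType}.
Local Notation PX := (prob R (disc X)).
Local Notation strat := (strategy T X Gamma).
Local Notation flow := (flow R T X Gamma).
Variable Psi : 'I_T -> X -> PX -> Gamma -> noise R -> X.
Hypothesis Psi_measurable : forall t : 'I_T, measurable_fun setT
  (fun q : borel (disc X) * borel PX * borel (disc Gamma) * borel (noise R) =>
     Psi t q.1.1.1 q.1.1.2 q.1.2 q.2 : borel (disc X)).
Hypothesis Psi_modulus : forall eps, 0 < eps ->
  exists2 delta, 0 < delta & modulus Psi eps delta.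
Variables (m0 : PX) (m0N : nat -> PX).
Variable mN : forall n, prob R (disc (fpow 'I_n.+2 X)).
Variable gamma : forall n, prob R (disc (fpow 'I_n.+2 strat)).
Hypothesis mN_product : forall n, product_law (mN n) (m0N n).
Hypothesis m0N_cvg : m0N n @[n --> \oo] --> m0.
Variable r : forall n, N_realization Psi (mN n) (gamma n) id ord0.
Local Notation P n := (Nr_P (r n)).

Let invn_near (e : R) : 0 < e -> \forall n \near \oo, n.+1%:R^-1 <= e.
Proof.
move=> e0; exists (Num.bound e^-1) => // n /= le.
rewrite invf_ple ?posrE// (le_trans (ltW (archi_boundP _))) ?invr_ge0 ?(ltW e0)//.
by rewrite ler_nat ltnW.
Qed.

Lemma coupling_limit u k : (k <= T)%N -> forall e, 0 < e ->
  \forall n \near \oo, forall j, fine (P n (discrepancy (r:=r n) u k j)) <= e.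
Proof.
elim: k => [_|k ih kT] e e0.
  apply: nearW => n j; rewrite (_ : discrepancy _ _ _ = set0) ?measure0 ?ltW//.
  by apply/seteqP; split=> w //=; rewrite /discrepancy /= /rgame /= eqxx.
have e40 : 0 < e / 4 by rewrite divr_gt0.
have [d d0 dP] := Psi_modulus e40.
(* The bound eta + e/4 + d^-1 (1/(n+1) + eta) is then at most e. *)
pose eta := Num.min (e / 4) (d * (e / 4)).
have eta0 : 0 < eta by rewrite lt_min e40 mulr_gt0.
have d40 : 0 < d * (e / 4) by rewrite mulr_gt0.
have h1 := ih (ltnW kT) _ eta0; have h2 := invn_near d40.
near=> n; have etaP : forall j, fine (P n (discrepancy (r:=r n) u k j)) <= eta by near: n.
have inv : n.+1%:R^-1 <= d * (e / 4) by near: n.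
move=> j; have := coupling_step Psi_measurable (@mN_product n) (r := r n)
  (t := Ordinal kT) (ltW e40) d0 dP etaP j.
move/le_trans; apply.
rewrite [X in _ + X]mulrDr.
apply: (@le_trans _ _ (e / 4 + e / 4 + (e / 4 + e / 4))); last first.
  by rewrite le_eqVlt; apply/orP; left; apply/eqP; field.
apply: lerD; first by rewrite lerD2r ge_min lexx.
apply: lerD; first by rewrite ler_pdivrMl.
by rewrite ler_pdivrMl// ge_min lexx orbT.
Unshelve. all: by end_near. Qed.

(** What player 0 sees in the true game (v1) and in the decoupled game (v0). *)
Let v1 u n (w : Nr_Omega (r n)) : flow := flow_of true (rpath (r:=r n) true u w).
Let v0 u n (w : Nr_Omega (r n)) : flow := flow_of false (rpath (r:=r n) false u w).

Let bpath b u n (h : flow -> R) :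
  bmeas (fun w => h (flow_of b (rpath (r:=r n) b u w))).
Proof.
exact: (bmeas_fin (fun e => h (flow_of b e)) (measurable_rpath Psi_measurable (r n) b u)).
Qed.

Let bdisc u n k j : bmeas (\1_(discrepancy (r:=r n) u k j) : Nr_Omega (r n) -> R).
Proof. by apply: bmeas_indic; exact: measurable_discrepancy. Qed.

(** The strategies agree, and the marginals differ through the discrepancies. *)
Let fdist_v u n w : fdist (v1 u (n:=n) w) (v0 u w) <=
  \sum_(t < T.+1) n.+1%:R^-1 * \sum_(j < n.+2 | j != ord0) \1_(discrepancy (r:=r n) u t j) w.
Proof.
rewrite /fdist /pdist /= eqxx add0r; apply: ler_sum => t _.
apply: le_trans (dist_empirical _ _ _) _; rewrite ler_wpM2l ?invr_ge0//.
apply: ler_sum => j j0; rewrite /view j0 /= !ffunE indicE ler_nat.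
by case: (boolP (_ != _)) => // ne; rewrite lt0b; exact: mem_set.
Qed.

Let bfdist u n : bmeas (fun w => fdist (v1 u (n:=n) w) (v0 u w)).
Proof.
apply: (bmeas_factor (U := fun w => (rpath (r:=r n) true u w, rpath (r:=r n) false u w))).
  move=> e; rewrite (_ : _ @^-1` _ = rpath (r:=r n) true u @^-1` [set e.1] `&`
    rpath (r:=r n) false u @^-1` [set e.2]).
    by apply: measurableI; exact: measurable_rpath.
  by case: e => e1 e2; apply/seteqP; split=> w /=; move=> [-> ->].
by move=> w w' [e1 e2 _ e3]; rewrite /v1 /v0 /rpath e1 e2 e3.
Qed.

Lemma Ex_fdist_near u e : 0 < e ->
  \forall n \near \oo, Ex (P n) (fun w => fdist (v1 u w) (v0 u w)) <= e.
Proof.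
move=> e0; have eT0 : 0 < e / T.+1%:R by rewrite divr_gt0.
have near_all : \forall n \near \oo, forall t : 'I_T.+1, forall j,
    fine (P n (discrepancy (r:=r n) u t j)) <= e / T.+1%:R.
  have : \forall n \near \oo, forall t : 'I_T.+1, t \in enum 'I_T.+1 -> forall j,
      fine (P n (discrepancy (r:=r n) u t j)) <= e / T.+1%:R.
    elim: (enum _) => [|t s ih]; first exact: nearW.
    have := @coupling_limit u t (leq_ord t) _ eT0; apply: filterS2 ih => n ih ht t'.
    by rewrite inE => /orP[/eqP ->//|/ih].
  by apply: filterS => n h t j; apply: h; rewrite mem_enum.
apply: filterS near_all => n le.
have bs (t : 'I_T.+1) : bmeas (fun w => \sum_(j < n.+2 | j != ord0)
    (\1_(discrepancy (r:=r n) u t j) w : R)) by apply: bmeas_sum => j; exact: bdisc.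
have bns (t : 'I_T.+1) : bmeas (fun w => n.+1%:R^-1 * \sum_(j < n.+2 | j != ord0)
    (\1_(discrepancy (r:=r n) u t j) w : R)) by apply: bmeasM => //; exact: bmeas_cst.
apply: le_trans (le_Ex (P n) (bfdist u n) _ (@fdist_v u n)) _.
  exact: bmeas_sum.
rewrite Ex_sum//.
apply: (@le_trans _ _ (\sum_(t < T.+1) e / T.+1%:R)); last first.
  by rewrite sumr_const card_ord -[_ *+ _]mulr_natr divfK.
apply: ler_sum => t _; rewrite ExZl// Ex_sum; last by move=> j; exact: bdisc.
rewrite ler_pdivrMl//; apply: (@le_trans _ _ (\sum_(j < n.+2 | j != ord0) e / T.+1%:R)).
  apply: ler_sum => j _; rewrite Ex_indic; last exact: measurable_discrepancy.
  exact: le.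
rewrite sumr_const (_ : #|_| = n.+1); first by rewrite mulr_natl.
by rewrite (@eq_card _ _ (predC1 ord0))// cardC1 card_ord.
Qed.

(** Uniform continuity handles close flows; the others are rare by Markov's
   inequality. *)
Lemma decoupling_limit u (h : flow -> R) : continuous h -> forall e, 0 < e ->
  \forall n \near \oo, Ex (P n) (fun w => `|h (v1 u w) - h (v0 u w)|) <= e.
Proof.
move=> ch e e0; have [M hM] := continuous_bounded (@compact_flow R T X Gamma) ch.
have M0 : 0 <= M by rewrite (le_trans _ (hM point)).
have e20 : 0 < e / 2 by rewrite divr_gt0.
have [d d0 dP] := compact_unif_continuous (fdist_metrizes R T X Gamma) (@compact_flow R T X Gamma) ch e20.
have c0 : 0 < 2 * M + 1 by rewrite ltr_wpDl// mulr_ge0.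
have dc0 : 0 < d * (e / 2) / (2 * M + 1) by rewrite divr_gt0// mulr_gt0.
apply: filterS (Ex_fdist_near u dc0) => n le.
have bh : bmeas (fun w => `|h (v1 u (n:=n) w) - h (v0 u w)|).
  by apply: bmeas_norm; apply: bmeasB; exact: bpath.
have bg : bmeas (fun w => ((2 * M + 1) / d) * fdist (v1 u (n:=n) w) (v0 u w)).
  by apply: bmeasM => //; exact: bmeas_cst.
apply: (@le_trans _ _ (Ex (P n) (fun w => e / 2 + ((2 * M + 1) / d) * fdist (v1 u w) (v0 u w)))).
  apply: le_Ex => //; first by apply: bmeasD => //; exact: bmeas_cst.
  move=> w; have f0 := metrizes_ge0 (fdist_metrizes R T X Gamma) (v1 u (n:=n) w) (v0 u w).
  have [lt|ge] := ltP (fdist (v1 u (n:=n) w) (v0 u w)) d.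
    rewrite (le_trans (ltW (dP _ _ lt)))// lerDl mulr_ge0// divr_ge0// ltW//.
  apply: (@le_trans _ _ (2 * M)).
    by rewrite (le_trans (ler_normB _ _))// mulr2n mulrDl mul1r lerD.
  rewrite (@le_trans _ _ ((2 * M + 1) / d * fdist (v1 u (n:=n) w) (v0 u w)))//; last by rewrite lerDr ltW.
  rewrite -mulrA (@le_trans _ _ (2 * M + 1))// ?lerDl//.
  by rewrite ler_peMr ?(ltW c0)// ler_pdivlMl// mulr1.
rewrite ExD//; last exact: bmeas_cst.
rewrite Ex_cst ExZl// [leRHS]splitr lerD2l.
by rewrite -ler_pdivlMl ?divr_gt0// invf_div mulrC (le_trans le)// mulrAC mulrC mulrA.
Qed.

(** In the decoupled game the environment ignores the deviation of player 0.  It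
   can thus be compared with the undisturbed game, whose flow has a law that
   converges. *)
Lemma v0_id u n (w : Nr_Omega (r n)) : v0 u w = v0 id w.
Proof.
rewrite /v0 /flow_of /=; congr pair; apply/funext => t; rewrite !ffunE.
by apply: emp_eq => j j0; apply: decoupled_others.
Qed.

Section along_filter.
Variable V : set_system nat.
Context {PV : ProperFilter V}.
Hypothesis Voo : \oo `<=` V.
Variable rho : prob R flow.
Hypothesis rho_cvg : Nr_flow_law (r n) @[n --> V] --> rho.

Let cvg_close (a b : nat -> R) (l : R) :
  (forall e, 0 < e -> \forall n \near V, `|a n - b n| <= e) ->
  b n @[n --> V] --> l -> a n @[n --> V] --> l.
Proof.
move=> ab bl; apply/(@cvgrPdist_lt _ R^o) => e e0.
have e20 : 0 < e / 2 by rewrite divr_gt0.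
have /(@cvgrPdist_lt _ R^o)/(_ _ e20) bl' := bl.
apply: filterS2 (ab _ e20) bl' => n ab' lb.
rewrite -(subrK (b n) l) -addrA (le_lt_trans (ler_normD _ _))// (splitr e) ltr_leD//.
by rewrite distrC.
Qed.

Lemma Ex_flow_law n (h : flow -> R) : continuous h ->
  Ex (Nr_flow_law (r n)) (h : borel flow -> R) = Ex (P n) (fun w => h (v1 id w)).
Proof.
move=> ch; have bh : bmeas (h : borel flow -> R) by exact: continuous_bmeas (@compact_flow R T X Gamma) ch.
have mf := @measurable_Nr_flow _ _ _ _ _ _ _ _ _ _ (r n).
rewrite -(@Ex_law _ _ _ _ _ (P n) (Nr_flow_law (r n)) (@Nr_flow _ _ _ _ _ _ _ _ _ _ (r n)) h mf)//.
apply: Ex_ae; [exact: (bmeas_comp mf bh)|exact: bpath|].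
apply: filterS (Nr_X_game (r n)) => w e; rewrite /= /Nr_flow /v1 /flow_of /=.
congr h; congr pair; first by rewrite ffunE.
apply/funext => t; rewrite ffunE; apply: eq_empirical => j _.
by rewrite /view /= e.
Qed.

Lemma flow_law_cvg (h : flow -> R) : continuous h ->
  Ex (P n) (fun w => h (v1 id w)) @[n --> V] --> Ex rho (h : borel flow -> R).
Proof.
move=> ch; under eq_fun do rewrite -Ex_flow_law//.
have := @cvg_prob R flow (Nr_flow_law (r n) @[n --> V]) rho h _ ch
  (continuous_bounded (@compact_flow R T X Gamma) ch) rho_cvg.
exact.
Qed.

(** The state of player 0 given its environment is asymptotically that of the
   mean field player, whatever its modification of the strategy.  The true game
   is replaced by the decoupled one, the state by its conditional law with
   initial law m0, and the environment by that of the undisturbed game. *)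
Lemma propagation u (h : flow -> R) (t : 'I_T.+1) y : continuous h ->
  Ex (P n) (fun w => h (v1 u w) * \1_[set w | rgame (r:=r n) true u t w ord0 = y] w)
    @[n --> V] --> Ex rho (fun v => h v * occ Psi u (mass m0) t y v).
Proof.
move=> ch; have [M hM] := continuous_bounded (@compact_flow R T X Gamma) ch.
have M0 : 0 <= M by rewrite (le_trans _ (hM point)).
have bh : bmeas (h : borel flow -> R) by exact: continuous_bmeas (@compact_flow R T X Gamma) ch.
have bI b n : bmeas (\1_[set w | rgame (r:=r n) b u t w ord0 = y] : Nr_Omega (r n) -> R).
  apply: bmeas_indic.
  exact: (fin_measurable_set (measurable_rgame Psi_measurable (r n) b u t) [set x | x ord0 = y]).
pose k v := h v * occ Psi u (mass m0) t y v.
have ck : continuous k by move=> v; apply: cvgM; [exact: ch|exact: occ_continuous].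
pose a n := Ex (P n) (fun w => h (v1 u w) * \1_[set w | rgame (r:=r n) true u t w ord0 = y] w).
pose b n := Ex (P n) (fun w => h (v0 u w) * \1_[set w | rgame (r:=r n) false u t w ord0 = y] w).
pose c n := Ex (P n) (fun w => k (v0 u w)).
pose d n := Ex (P n) (fun w => k (v1 id w)).
have half (e : R) : 0 < e -> 0 < e / 2 by move=> e0; rewrite divr_gt0.
(* Replacing x1, i1 by x0, i0 costs the change of x plus M if i changes. *)
have key (x1 x0 : R) (i1 i0 dd : bool) : `|x0| <= M -> (~~ dd -> i1 = i0) ->
    `|x1 * i1%:R - x0 * i0%:R| <= `|x1 - x0| + M * dd%:R.
  move=> x0M; case: dd => [_|/(_ isT) ->]; last first.
    by rewrite mulr0 addr0 -mulrBl; case: i0; rewrite ?mulr1// mulr0 normr0.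
  case: i1; case: i0; rewrite ?mulr1 ?mulr0 ?subr0 ?sub0r ?normrN ?normr0.
  - by rewrite lerDl.
  - by rewrite -{1}(subrK x0 x1) (le_trans (ler_normD _ _))// lerD2l.
  - by rewrite (le_trans x0M)// lerDr.
  - by rewrite addr_ge0.
have ab e : 0 < e -> \forall n \near V, `|a n - b n| <= e.
  move=> e0.
  have eM0 : 0 < (e / 2) / (M + 1) by rewrite divr_gt0 ?half// ltr_wpDl.
  have n1 := Voo (decoupling_limit u ch (half e e0)).
  have n2 := Voo (coupling_limit u (leq_ord t) eM0).
  apply: filterS2 n1 n2 => n le1 le2.
  have b1 := bmeasM (bpath true u n h) (bI true n).
  have b2 := bmeasM (bpath false u n h) (bI false n).
  have bdif : bmeas (fun w => `|h (v1 u (n:=n) w) - h (v0 u w)|).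
    by apply: bmeas_norm; apply: bmeasB; exact: bpath.
  have bMd : bmeas (fun w => M * \1_(discrepancy (r:=r n) u t ord0) w : R).
    by apply: bmeasM => //; exact: bmeas_cst.
  rewrite /a /b -ExB//; apply: le_trans (Ex_norm _ _) _; first exact: bmeasB.
  apply: (@le_trans _ _ (Ex (P n) (fun w => `|h (v1 u w) - h (v0 u w)| +
      M * \1_(discrepancy (r:=r n) u t ord0) w))).
    apply: le_Ex; [by apply: bmeas_norm; exact: bmeasB|exact: bmeasD|].
    move=> w; rewrite !indicE; apply: key; first exact: hM.
    move=> /negP nd; apply/idP/idP => /set_mem/= e1; apply/mem_set => /=.
      rewrite -e1; apply/esym/eqP/negPn/negP => ne; apply: nd; exact: mem_set.
    rewrite -e1; apply/eqP/negPn/negP => ne; apply: nd; exact: mem_set.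
  rewrite ExD// ExZl// [leRHS]splitr; apply: lerD => //.
  rewrite Ex_indic; last exact: measurable_discrepancy.
  apply: (@le_trans _ _ (M * ((e / 2) / (M + 1)))); first by rewrite ler_wpM2l.
  rewrite mulrCA -[leRHS]mulr1 ler_wpM2l ?(ltW (half e e0))//.
  by rewrite ler_pdivrMr ?mul1r ?lerDl// ltr_wpDl.
(* The conditional law starts from m0N n; contraction allows to start from m0. *)
have bc e : 0 < e -> \forall n \near V, `|b n - c n| <= e.
  move=> e0.
  have eM0 : 0 < e / (M + 1) / 2 by rewrite half// divr_gt0// ltr_wpDl.
  have near0 := Voo (m0N_cvg (metrizes_ball dist_metrizes m0 eM0)).
  apply: filterS near0 => n /= le.
  have bo (m : X -> R) : bmeas (fun w => h (v0 u (n:=n) w) * occ Psi u m t y (v0 u w)).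
    exact: (bpath false u n (fun v => h v * occ Psi u m t y v)).
  rewrite /b /c /k (decoupled_marginal Psi_measurable (@mN_product n))//.
  rewrite -ExB//; apply: le_trans (Ex_norm _ _) _; first exact: bmeasB.
  rewrite -[leRHS](Ex_cst (P n)); apply: le_Ex.
  - by apply: bmeas_norm; exact: bmeasB.
  - exact: bmeas_cst.
  move=> w; rewrite -mulrBr normrM.
  apply: (@le_trans _ _ (M * (2 * dist m0 (m0N n)))).
    apply: ler_pM => //; rewrite distE mulrA divff// mul1r.
    have := marg_contract (@nu R) (measurable_mf_step Psi_measurable u) (mass (m0N n)) (mass m0)
      (v0 u w : borel flow) t.
    under [X in _ <= X -> _]eq_bigr do rewrite distrC.
    by apply: le_trans; rewrite (bigD1 y)//= lerDl sumr_ge0.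
  have le' : 2 * dist m0 (m0N n) <= e / (M + 1) by rewrite mulrC -ler_pdivlMr// ltW.
  apply: (@le_trans _ _ (M * (e / (M + 1)))); first by rewrite ler_wpM2l.
  rewrite mulrCA -[leRHS]mulr1 ler_wpM2l ?(ltW e0)//.
  by rewrite ler_pdivrMr ?mul1r ?lerDl// ltr_wpDl.
have cd e : 0 < e -> \forall n \near V, `|c n - d n| <= e.
  move=> e0; apply: filterS (Voo (decoupling_limit id ck e0)) => n; apply: le_trans.
  rewrite /c /d (_ : (fun w => k (v0 u w)) = (fun w => k (v0 id w))); last first.
    by apply/funext => w; rewrite v0_id.
  rewrite -ExB; [|exact: bpath..].
  apply: le_trans (Ex_norm _ _) _; first by apply: bmeasB; exact: bpath.
  by apply: le_Ex => [||w]; [by apply: bmeas_norm; apply: bmeasB; exact: bpath..|rewrite distrC].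
apply: (cvg_close ab); apply: (cvg_close bc); apply: (cvg_close cd).
exact: flow_law_cvg.
Qed.

Section costs.
Variables (f : 'I_T -> X -> PX -> Gamma -> R) (F : X -> PX -> R).
Hypothesis f_continuous : forall t x a, continuous (fun m : PX => f t x m a).
Hypothesis F_continuous : forall x, continuous (F x).

Let player_cost_flow u n (w : Nr_Omega (r n)) :
  player_cost f F u (rpath (r:=r n) true u w) =
  \sum_(t < T) \sum_y running f u t y (v1 u w) *
     \1_[set w | rgame (r:=r n) true u (now t) w ord0 = y] w +
  \sum_y terminal F y (v1 u w) *
     \1_[set w | rgame (r:=r n) true u (ord_max : 'I_T.+1) w ord0 = y] w.
Proof.
have E (h : X -> R) (k : 'I_T.+1) :
    \sum_y h y * \1_[set w | rgame (r:=r n) true u k w ord0 = y] w =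
    h (rgame (r:=r n) true u k w ord0).
  rewrite (bigD1 (rgame (r:=r n) true u k w ord0))//= indicE mem_set// mulr1.
  by rewrite big1 ?addr0// => y yX; rewrite indicE memNset ?mulr0// => /= e; rewrite e eqxx in yX.
rewrite /player_cost; congr (_ + _).
  apply: eq_bigr => t _; have := E (fun y => running f u t y (v1 u w)) (now t).
  by move=> /= ->; rewrite /running /v1 /flow_of /= !ffunE.
have := E (fun y => terminal F y (v1 u w)) ord_max.
by move=> /= ->; rewrite /terminal /v1 /flow_of /= !ffunE.
Qed.

Lemma cost_limit u :
  J_N Psi f F (mN n) (gamma n) u ord0 @[n --> V] -->
  Ex rho (mean_cost Psi f F (mass m0) u : borel flow -> R).
Proof.
have crun t y : continuous (running f u t y) by exact: running_continuous.
have cter y : continuous (terminal F y : flow -> R) by exact: terminal_continuous.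
have bI n (k : 'I_T.+1) y : bmeas (\1_[set w | rgame (r:=r n) true u k w ord0 = y] : Nr_Omega (r n) -> R).
  apply: bmeas_indic.
  exact: (fin_measurable_set (measurable_rgame Psi_measurable (r n) true u k) [set x | x ord0 = y]).
have bh n (h : flow -> R) (k : 'I_T.+1) y : bmeas (fun w => h (v1 u (n:=n) w) *
    \1_[set w | rgame (r:=r n) true u k w ord0 = y] w : R).
  exact: (bmeasM (bpath true u n h) (bI n k y)).
have bo (h : flow -> R) k y : continuous h ->
    bmeas (fun v : borel flow => h v * occ Psi u (mass m0) k y v).
  move=> ch; apply: bmeasM; last exact: bmeas_occ.
  exact: continuous_bmeas (@compact_flow R T X Gamma) ch.
have brunO (t : 'I_T) y := bo _ t y (crun t y).
have bterO y := bo _ T y (cter y).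
have bsO t := @bmeas_sum _ _ R _ (index_enum X) xpredT _ (brunO t).
have brunE n (t : 'I_T) y := bh n (running f u t y) (now t) y.
have bterE n y := bh n (terminal F y) ord_max y.
have bsE n t := @bmeas_sum _ _ R _ (index_enum X) xpredT _ (brunE n t).
have -> : Ex rho (mean_cost Psi f F (mass m0) u : borel flow -> R) =
    \sum_(t < T) \sum_y Ex rho (fun v => running f u t y v * occ Psi u (mass m0) t y v) +
    \sum_y Ex rho (fun v => terminal F y v * occ Psi u (mass m0) T y v).
  rewrite /mean_cost ExD; [|exact: bmeas_sum..]; congr (_ + _).
    rewrite (Ex_sum _ _ _ bsO); apply: eq_bigr => t _.
    by rewrite (Ex_sum _ _ _ (brunO t)).
  by rewrite (Ex_sum _ _ _ bterO).
rewrite (_ : (fun n => _) = (fun n => \sum_(t < T) \sum_y Ex (P n) (fun w =>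
      running f u t y (v1 u w) * \1_[set w | rgame (r:=r n) true u (now t) w ord0 = y] w) +
    \sum_y Ex (P n) (fun w => terminal F y (v1 u w) *
      \1_[set w | rgame (r:=r n) true u (ord_max : 'I_T.+1) w ord0 = y] w))); last first.
  apply/funext => n; rewrite (J_N_game Psi_measurable (@mN_product n) f F u (r n)).
  rewrite [X in Ex _ X](_ : _ = (fun w =>
    \sum_(t < T) \sum_y running f u t y (v1 u w) *
      \1_[set w | rgame (r:=r n) true u (now t) w ord0 = y] w +
    \sum_y terminal F y (v1 u w) *
      \1_[set w | rgame (r:=r n) true u (ord_max : 'I_T.+1) w ord0 = y] w)); last first.
    by apply/funext => w; exact: player_cost_flow.
  rewrite ExD; [|exact: bmeas_sum..]; congr (_ + _).
    rewrite (Ex_sum _ _ _ (bsE n)); apply: eq_bigr => t _.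
    by rewrite (Ex_sum _ _ _ (brunE n t)).
  by rewrite (Ex_sum _ _ _ (bterE n)).
apply: cvgD.
  apply: cvg_big => [|t _]; first exact: add_continuous.
  apply: cvg_big => [|y _]; first exact: add_continuous.
  exact: (@propagation u _ (now t) y (crun t y)).
apply: cvg_big => [|y _]; first exact: add_continuous.
exact: (@propagation u _ ord_max y (cter y)).
Qed.

End costs.

(** By exchangeability the expectation of h(mu_j) 1_{X_j(t) = y} is the same for
   all players j.  Replacing mu_j by mu_0, which is within 1/(n+1), and averaging
   over j turns the indicator into the mass of y under mu_0(t). *)
Lemma exchange_limit (h : tpow 'I_T.+1 PX -> R) (t : 'I_T.+1) y :
  (forall n, symmetric_law (gamma n)) -> continuous h ->
  Ex rho (fun v : borel flow => h (v : flow).2 * occ Psi id (mass m0) t y v) =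
  Ex rho (fun v : borel flow => h (v : flow).2 * mass ((v : flow).2 t) y).
Proof.
move=> gamma_sym ch.
have chs : continuous (fun v : flow => h v.2).
  by move=> v; apply: (cvg_comp snd h); [exact: cvg_snd|exact: ch].
have cg : continuous (fun v : flow => h v.2 * mass (v.2 t) y).
  move=> v; apply: cvgM; first exact: chs.
  by apply: (cvg_comp (fun v : flow => v.2 t) (fun m => mass m y));
    [exact: flow_snd_continuous|exact: mass_continuous].
pose mu n (j : 'I_n.+2) (e : fpow 'I_n.+2 strat * {ffun 'I_T.+1 -> fpow 'I_n.+2 X}) :
  tpow 'I_T.+1 PX := fun k => emp true (e.2 k) j.
pose H n (j : 'I_n.+2) e := h (mu n j e) * (e.2 t j == y)%:R.
pose path n w := rpath (r:=r n) true id w.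
pose a n := Ex (P n) (fun w => H n ord0 (path n w)).
pose b n := Ex (P n) (fun w => h (mu n ord0 (path n w)) * mass (mu n ord0 (path n w) t) y).
have bfac n g : bmeas (fun w => g (path n w) : R).
  exact: (bmeas_fin g (measurable_rpath Psi_measurable (r n) true id)).
have aE n j : a n = Ex (P n) (fun w => H n j (path n w)).
  rewrite /a -[LHS]/(Ex (P n) (H n ord0 \o path n)).
  rewrite -(exchange Psi_measurable (@mN_product n) (gamma_sym n) (r n) (tperm ord0 j)).
  have HE e : H n ord0 (permute (tperm ord0 j) e) = H n j e.
    rewrite /H [in X in _ * X]/permute /= !ffunE tpermL; congr (h _ * _).
    by apply/funext => k; rewrite /mu /permute /= ffunE emp_permute tpermL.
  by congr Ex; apply/funext => w; exact: HE.
have avg n (c : R) : n.+1%:R^-1 * \sum_(j < n.+2 | j != ord0) c = c.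
  rewrite sumr_const (_ : #|_| = n.+1); last by rewrite (@eq_card _ _ (predC1 ord0))// cardC1 card_ord.
  by rewrite -[c *+ _]mulr_natl mulrA mulVf ?mul1r.
have bE n : b n = n.+1%:R^-1 * \sum_(j < n.+2 | j != ord0)
    Ex (P n) (fun w => h (mu n ord0 (path n w)) * ((path n w).2 t j == y)%:R).
  rewrite -Ex_sum; last by move=> j; exact: (bfac n (fun e => h (mu n ord0 e) * (e.2 t j == y)%:R)).
  rewrite -ExZl; last first.
    exact: (bfac n (fun e => \sum_(j < n.+2 | j != ord0) h (mu n ord0 e) * (e.2 t j == y)%:R)).
  by congr Ex; apply/funext => w; rewrite /mu mass_empirical_sum.
have ab e : 0 < e -> \forall n \near V, `|a n - b n| <= e.
  move=> e0.
  have [d d0 dP] := compact_unif_continuous (tdist_metrizes (I := 'I_T.+1) (@dist_metrizes R X))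
    (compact_tpow (@compact_laws R X)) ch e0.
  have dT0 : 0 < d / 2 / T.+1%:R by rewrite !divr_gt0.
  apply: filterS (Voo (invn_near dT0)) => n le.
  rewrite bE -(avg n (a n)) -mulrBr -sumrB normrM ger0_norm ?invr_ge0//.
  rewrite -[leRHS](avg n e) ler_wpM2l ?invr_ge0//.
  apply: le_trans (ler_norm_sum _ _ _) _; apply: ler_sum => j _.
  rewrite (aE n j) -ExB; [|exact: (bfac n (H n j))|
    exact: (bfac n (fun e => h (mu n ord0 e) * (e.2 t j == y)%:R))].
  apply: le_trans (Ex_norm _ _) _.
    exact: (bfac n (fun e => H n j e - h (mu n ord0 e) * (e.2 t j == y)%:R)).
  rewrite -[leRHS](Ex_cst (P n)); apply: le_Ex.
  - exact: (bfac n (fun e => `|H n j e - h (mu n ord0 e) * (e.2 t j == y)%:R|)).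
  - exact: bmeas_cst.
  move=> w; rewrite /H -mulrBl normrM.
  apply: (@le_trans _ _ `|h (mu n j (path n w)) - h (mu n ord0 (path n w))|).
    by rewrite ler_piMr// ger0_norm ?ler0n// lern1 leq_b1.
  apply/ltW/dP; rewrite /tdist.
  apply: (@le_lt_trans _ _ (\sum_(k < T.+1) d / 2 / T.+1%:R)).
    by apply: ler_sum => k _; apply: le_trans le; exact: dist_empirical_player.
  rewrite sumr_const card_ord -[_ *+ _]mulr_natr divfK//.
  by rewrite ltr_pdivrMr// ltr_pMr// ltr1n.
have la : a n @[n --> V] --> Ex rho (fun v : borel flow => h (v : flow).2 * occ Psi id (mass m0) t y v).
  rewrite (_ : a = (fun n => Ex (P n) (fun w => h (v1 id w).2 *
      \1_[set w | rgame (r:=r n) true id t w ord0 = y] w))).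
    exact: (@propagation id (fun v => h v.2) t y chs).
  apply/funext => n; congr Ex; apply/funext => w.
  rewrite /H /path /v1 /flow_of /=; congr (_ * _).
  rewrite indicE ffunE; congr (nat_of_bool _)%:R.
  by apply/eqP/idP => [e|/set_mem]//; exact/mem_set.
have lb : b n @[n --> V] --> Ex rho (fun v : borel flow => h (v : flow).2 * mass ((v : flow).2 t) y).
  by have := flow_law_cvg cg.
exact: (cvg_unique (@Rhausdorff R) la (cvg_close ab lb)).
Qed.

End along_filter.
End limits.

(** * Consistency *)

Section consistency.
Context {R : realType} {T : nat} {X Gamma : pfinType}.
Local Notation PX := (prob R (disc X)).
Local Notation strat := (strategy T X Gamma).
Local Notation flow := (flow R T X Gamma).
Variable Psi : 'I_T -> X -> PX -> Gamma -> noise R -> X.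
Hypothesis Psi_measurable : forall t : 'I_T, measurable_fun setT
  (fun q : borel (disc X) * borel PX * borel (disc Gamma) * borel (noise R) =>
     Psi t q.1.1.1 q.1.1.2 q.1.2 q.2 : borel (disc X)).
Variables (m0 : PX) (rho : prob R flow).
Hypothesis rho_state : forall (h : tpow 'I_T.+1 PX -> R) (t : 'I_T.+1) y, continuous h ->
  Ex rho (fun v : borel flow => h (v : flow).2 * occ Psi id (mass m0) t y v) =
  Ex rho (fun v : borel flow => h (v : flow).2 * mass ((v : flow).2 t) y).
Variable r : mf_realization Psi m0 rho id.
Local Notation P := (mf_P r).
Local Notation Om := (mf_Omega r).

Let mu (w : Om) : tpow 'I_T.+1 PX := fun t => mf_mu t w.

Let mmu : measurable_fun setT (mu : Om -> borel (tpow 'I_T.+1 PX)).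
Proof.
apply: (measurable_metrizes (tdist_metrizes (I := 'I_T.+1) (@dist_metrizes R X))).
  exact: (compact_tpow (@compact_laws R X)).
move=> p; apply: measurable_sum => t.
have md : measurable_fun setT (@dist R X (p t) : borel PX -> R).
  by apply: continuous_borel; exact: (metrizes_continuous dist_metrizes).
exact: (measurableT_comp md (mf_mmu (m:=r) t)).
Qed.

Let I t y : Om -> R := \1_[set w | mf_X (m:=r) t w = y].
Let Q (t : 'I_T.+1) y (w : Om) : R := mass (mf_mu t w) y.

Let bI t y : bmeas (I t y).
Proof.
apply: bmeas_indic.
exact: (measurable_preimage (mf_mX (m:=r) t) (@measurable_disc X [set y])).
Qed.

Let bmass y : bmeas ((fun m : PX => mass m y) : borel PX -> R).
Proof. by apply: continuous_bmeas; [exact: compact_laws|exact: mass_continuous]. Qed.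

Let bQ t y : bmeas (Q t y).
Proof. exact: (bmeas_comp (mf_mmu (m:=r) t) (bmass y)). Qed.

Let Ex_continuous (h : tpow 'I_T.+1 PX -> R) (t : 'I_T.+1) y : continuous h ->
  Ex P (fun w => h (mu w) * I t y w) = Ex P (fun w => h (mu w) * Q t y w).
Proof.
move=> ch.
have chs : continuous (fun v : flow => h v.2).
  by move=> v; apply: (cvg_comp snd h); [exact: cvg_snd|exact: ch].
have cg : continuous (fun v : flow => h v.2 * mass (v.2 t) y).
  move=> v; apply: cvgM; first exact: chs.
  by apply: (cvg_comp (fun v : flow => v.2 t) (fun m => mass m y));
    [exact: flow_snd_continuous|exact: mass_continuous].
have bhs := continuous_bmeas (@compact_flow R T X Gamma) chs.
have bg := continuous_bmeas (@compact_flow R T X Gamma) cg.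
have := mf_state_marginal Psi_measurable r t y bhs; rewrite rho_state// => ->.
rewrite -(@Ex_law _ _ _ _ _ P rho (fun w => (mf_Phi w, fun t => mf_mu t w) : borel flow)
  (fun v : flow => h v.2 * mass (v.2 t) y))//.
  exact: measurable_mf_flow.
exact: mf_lawflow.
Qed.

(** Dominated convergence along the approximations of [open_approx]. *)
Let Ex_open (A : set (tpow 'I_T.+1 PX)) (t : 'I_T.+1) y : open A ->
  Ex P (fun w => \1_(mu @^-1` A) w * I t y w) = Ex P (fun w => \1_(mu @^-1` A) w * Q t y w).
Proof.
move=> oA; have [h [ch h01 hA]] :=
  open_approx (tdist_metrizes (I := 'I_T.+1) (@dist_metrizes R X)) oA.
have mA : measurable (mu @^-1` A).
  by apply: (measurable_preimage mmu); exact: sub_sigma_algebra.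
have cE (g : Om -> R) : bmeas g -> Ex P (fun w => h n (mu w) * g w) @[n --> \oo] -->
    Ex P (fun w => \1_(mu @^-1` A) w * g w).
  move=> bg; have [mg [M gM]] := bg.
  have bh n : bmeas (fun w => h n (mu w)).
    split; last by exists 1 => w; have /andP[h0 h1] := h01 n (mu w); rewrite ger0_norm.
    exact: (measurableT_comp (continuous_borel (ch n)) mmu).
  apply: (Ex_dominated (M := M)).
  - by move=> n; have [] := bmeasM (bh n) bg.
  - by apply: bmeasM => //; exact: bmeas_indic.
  - move=> n w; rewrite normrM (le_trans _ (gM w))// ler_piMl//.
    by have /andP[h0 h1] := h01 n (mu w); rewrite ger0_norm.
  - by move=> w; apply: cvgM; [exact: hA|exact: cvg_cst].
apply: (cvg_unique (@Rhausdorff R) (cE _ (bI t y))).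
rewrite (_ : (fun n => _) = (fun n => Ex P (fun w => h n (mu w) * Q t y w))).
  exact: cE.
by apply/funext => n; exact: (@Ex_continuous (h n) t y (ch n)).
Qed.

Let openG : set_system Om := [set mu @^-1` A | A in open].

Let sigma_gen_open : sigma_gen (mf_mu (m:=r)) `<=` <<s openG >>.
Proof.
apply: smallest_sub; first exact: smallest_sigma_algebra.
move=> _ [t _ [B mB <-]].
have m : measurable_fun setT (mf_mu (m:=r) t : g_sigma_algebraType openG -> borel PX).
  apply: (@measurability _ _ (g_sigma_algebraType openG) (borel PX) setT _ (@open PX) erefl).
  move=> _ [A oA <-]; rewrite setTI; apply: sub_sigma_algebra.
  exists [set p : tpow 'I_T.+1 PX | A (p t)] => //.
  by apply: (open_comp (f := fun p : tpow 'I_T.+1 PX => p t)) => // p _; exact: proj_tpow_continuous.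
exact: (m measurableT B mB).
Qed.

(** The preimages of open sets of flows form a pi-system that generates the
   sigma-algebra of mu. *)
Lemma rcd_flow t : regular_conditional_distribution P (sigma_gen (mf_mu (m:=r)))
  (mf_X (m:=r) t : Om -> disc X) (mf_mu (m:=r) t).
Proof.
split=> [B mB|B A mB sA].
  have mev : measurable_fun setT (fun m : borel PX => (m : PX) B).
    rewrite (_ : (fun m : borel PX => (m : PX) B) =
      (fun m => (\sum_x \1_B x * mass (m : PX) x)%:E)).
      apply/measurable_EFinP.
      by have [] : bmeas (fun m : borel PX => \sum_x \1_B x * mass (m : PX) x : R);
        [apply: bmeas_sum => x; apply: bmeasM => //; exact: bmeas_cst|].
    apply/funext => m; rewrite -(Ex_mass m (\1_B : X -> R)) Ex_indic// fineK//.
    exact: fin_num_measure.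
  apply: (measurableT_comp mev) => _ D mD; rewrite setTI; apply: sub_sigma_algebra.
  exact: (@sigma_gen_preimage _ _ _ _ (mf_mu (m:=r)) t D mD).
have mX (C : set X) : measurable (mf_X (m:=r) t @^-1` C).
  exact: (measurable_preimage (mf_mX (m:=r) t) (@measurable_disc X C)).
have mA : measurable A.
  move: A sA; apply: smallest_sub; first exact: sigma_algebra_measurable.
  by move=> _ [s _ [D mD <-]]; exact: (mf_mmu (m:=r) s).
have bA : bmeas (\1_A : Om -> R) by exact: bmeas_indic.
have Ey y : Ex P (fun w => \1_A w * I t y w) = Ex P (fun w => \1_A w * Q t y w).
  apply: (@pi_lambda_integral _ _ _ P (I t y) (Q t y) (bI t y) (bQ t y) openG).
  - by move=> _ _ [C oC <-] [D oD <-]; exists (C `&` D) => //; exact: openI.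
  - by exists setT => //; exact: openT.
  - by move=> _ [C oC <-]; apply: (measurable_preimage mmu); exact: sub_sigma_algebra.
  - by move=> _ [C oC <-]; exact: Ex_open.
  - exact: sigma_gen_open.
have bAI y : bmeas (fun w => \1_B y * (\1_A w * I t y w) : R).
  by apply: bmeasM; [exact: bmeas_cst|exact: bmeasM].
have bAQ y : bmeas (fun w => \1_B y * (\1_A w * Q t y w) : R).
  by apply: bmeasM; [exact: bmeas_cst|exact: bmeasM].
transitivity (Ex P (fun w => \sum_y \1_B y * (\1_A w * I t y w)))%:E.
  rewrite -[LHS]fineK ?fin_num_measure//; last exact: measurableI.
  rewrite -Ex_indic; last exact: measurableI.
  congr (Ex _ _)%:E; apply/funext => w.
  rewrite (bigD1 (mf_X t w))//= big1 ?addr0 => [|y yX].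
    rewrite /I [X in _ * (_ * X)]indicE mem_set// mulr1 mulrC !indicE -natrM mulnb in_setI.
    by congr (nat_of_bool (_ && _))%:R; apply/idP/idP => /set_mem h; exact/mem_set.
  by rewrite /I [X in _ * (_ * X)]indicE memNset ?mulr0// => /= e; rewrite e eqxx in yX.
transitivity (Ex P (fun w => \sum_y \1_B y * (\1_A w * Q t y w)))%:E.
  rewrite !Ex_sum//; congr EFin; apply: eq_bigr => y _.
  by rewrite !ExZl ?Ey//; exact: bmeasM.
rewrite -ExE; last exact: bmeas_sum.
rewrite [RHS]integral_mkcond; apply: eq_integral => w _; rewrite patchE.
have e : mf_mu t w B = (\sum_y \1_B y * Q t y w)%:E.
  rewrite -(Ex_mass (mf_mu t w) (\1_B : X -> R)) Ex_indic// fineK//.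
  exact: fin_num_measure.
case: ifPn => wA.
  rewrite e; congr EFin; apply: eq_bigr => y _.
  by rewrite [X in _ * (X * _)]indicE wA mul1r.
by rewrite big1// => y _; rewrite [X in _ * (X * _)]indicE (negbTE wA) mul0r mulr0.
Qed.

End consistency.

(* The index n stands for N = n.+2 players, so that N ranges over N >= 2. *)
Theorem theorem6p1
  (R : realType) (T : nat) (X Gamma : pfinType)
  (Psi : 'I_T -> X -> prob R (disc X) -> Gamma -> noise R -> X)
  (f : 'I_T -> X -> prob R (disc X) -> Gamma -> R)
  (F : X -> prob R (disc X) -> R)
  (Psi_measurable : forall t : 'I_T, measurable_fun setT
     (fun q : borel (disc X) * borel (prob R (disc X)) * borel (disc Gamma)
              * borel (noise R) =>
        Psi t q.1.1.1 q.1.1.2 q.1.2 q.2 : borel (disc X)))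
  (f_measurable : forall t : 'I_T, measurable_fun setT
     (fun q : borel (disc X) * borel (prob R (disc X)) * borel (disc Gamma) =>
        f t q.1.1 q.1.2 q.2))
  (F_measurable : measurable_fun setT
     (fun q : borel (disc X) * borel (prob R (disc X)) => F q.1 q.2))
  (f_bounded : exists M : R, forall t x m a, `|f t x m a| <= M)
  (F_bounded : exists M : R, forall x m, `|F x m| <= M)
  (m0 : prob R (disc X))
  (mN : forall n : nat, prob R (disc (fpow 'I_n.+2 X)))
  (gamma : forall n : nat, prob R (disc (fpow 'I_n.+2 (strategy T X Gamma))))
  (eps : nat -> R)
  (eps_ge0 : forall n, 0 <= eps n)
  (A1_modulus : exists w : R -> R,
     [/\ measurable_fun (`[0, +oo[ : set R) w,
         forall s, 0 <= s -> 0 <= w s <= 1,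
         w s @[s --> 0^'+] --> 0
       & forall (t : 'I_T) (x : X) (a : Gamma) (m m' : prob R (disc X)),
           (\int[@nu R]_z
              (\1_[set z | Psi t x m a z <> Psi t x m' a z] z)%:E
            <= (w (dist m m'))%:E)%E])
  (A1_continuity : forall (t : 'I_T)
     (tau : prob R (disc X * prob R (disc X) * disc Gamma)%type),
     {ae (tau \x @nu R)%E,
        forall p : disc X * prob R (disc X) * disc Gamma * noise R,
          {for p, continuous
             (fun q : disc X * prob R (disc X) * disc Gamma * noise R =>
                Psi t q.1.1.1 q.1.1.2 q.1.2 q.2 : disc X)}})
  (A2_f : forall t : 'I_T, continuous
     (fun q : disc X * prob R (disc X) * disc Gamma => f t q.1.1 q.1.2 q.2))
  (A2_F : continuous (fun q : disc X * prob R (disc X) => F q.1 q.2))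
  (A3 : forall n, symmetric_law (gamma n) /\
     correlated_equilibrium Psi f F (eps n) (mN n) (gamma n))
  (A4 : eps n @[n --> \oo] --> 0)
  (A5 : exists m0N : nat -> prob R (disc X),
     (forall n, product_law (mN n) (m0N n)) /\ (m0N n @[n --> \oo] --> m0))
  (r : forall n, N_realization Psi (mN n) (gamma n) id ord0) :
  let rhoN n := Nr_flow_law (r n) in
  compact (closure (range rhoN)) /\
  forall rho : prob R (flow R T X Gamma),
    cluster (rhoN @ \oo) rho -> correlated_solution Psi f F m0 rho.
Proof.
move=> rhoN.
have [w [_ _ w0 wP]] := A1_modulus.
have Psi_modulus := modulus_exists Psi_measurable w0 wP.
have [m0N [mN_prod m0N_cvg]] := A5.
have f_cont t x a : continuous (fun m : prob R (disc X) => f t x m a).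
  move=> m; have c := continuous_comp
    (@pairr_continuous (disc X) (prob R (disc X)) x m)
    (@pairl_continuous (disc X * prob R (disc X))%type (disc Gamma) a (x, m)).
  exact: (continuous_comp c (A2_f t (x, m, a))).
have F_cont x : continuous (F x).
  by move=> m; exact: (continuous_comp (@pairr_continuous (disc X) _ x m) (A2_F (x, m))).
split.
  apply: (@subclosed_compact _ _ setT) => //; first exact: closed_closure.
  exact: (@prob_compact R _ (@hausdorff_flow R T X Gamma) (@compact_flow R T X Gamma)).
move=> rho /cluster_filter[V [PV Voo rhoV]].
split=> [u|rr t].
  have [real|nreal] := pselect (exists u', inhabited (mf_realization Psi m0 rho u')); last first.
    by rewrite !J_empty.
  rewrite !J_occ//.
  have lim u' : J_N Psi f F (mN n) (gamma n) u' ord0 @[n --> V] -->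
      Ex rho (mean_cost Psi f F (mass m0) u' : borel (flow R T X Gamma) -> R).
    exact: (cost_limit Psi_measurable Psi_modulus mN_prod m0N_cvg Voo rhoV f_cont F_cont).
  have eps0 : eps n @[n --> V] --> 0 by move=> s /A4; exact: Voo.
  rewrite -[leRHS]addr0; apply: (ler_cvg_to (lim id) (cvgD (lim u) eps0)).
  by apply: nearW => n; have [_] := A3 n; exact.
apply: (rcd_flow Psi_measurable) => h s y ch.
apply: (exchange_limit Psi_measurable Psi_modulus mN_prod m0N_cvg Voo rhoV) => // n.
by have [] := A3 n.
Qed.
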